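(* Let $p\in\mathbb Z^+$, let $\alpha_j\in P(k)$, and let $S_1(\alpha),\dots,S_p(\alpha)$ be $\mathcal L(H^1_{per}(\Omega_H))$-valued functions holomorphic on $\overline{B_{\delta_{PML}}(\alpha_j)}$. Define $$\mathsf H(\alpha)=D^{-1}(\alpha)S_1(\alpha)D^{-1}(\alpha)S_2(\alpha)\cdots D^{-1}(\alpha)S_p(\alpha).$$ Then $$\Big|\frac1{2\pi i}\operatorname{tr}\int_{\partial B_{\delta_{PML}}(\alpha_j)}\mathsf H(\alpha)\,d\alpha\Big|\le C_1C_2^{\,p}\prod_{i=1}^p\max_{\alpha\in\partial B_{\delta_{PML}}(\alpha_j)}\|S_i(\alpha)\|_*,$$ where $C_1=\tfrac12m_j\delta_{PML}$ and $C_2=2^{r_{j,1}+2}C_{\delta_{PML}}$ are independent of $p$.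
   Context: Setting. Fix $\Lambda>0$, $k>0$, $0<h_0<H$ and a real-valued $\gamma\in L^\infty(\mathbb R^2)$ with $\gamma(x_1+\Lambda,x_2)=\gamma(x_1,x_2)$ and $\gamma=1$ for $|x_2|>h_0$. Let $\Omega_H=(-\Lambda/2,\Lambda/2)\times(-H,H)$ and $H^1_{per}(\Omega_H)=\{u\in H^1(\Omega_H): u(-\Lambda/2,x_2)=u(\Lambda/2,x_2)\}$ (complex-valued). For $\phi\in H^1_{per}(\Omega_H)$ and $n\in\mathbb Z$ put $\phi_n^\pm=\frac1\Lambda\int_{-\Lambda/2}^{\Lambda/2}\phi(x_1,\pm H)e^{-2\pi i n x_1/\Lambda}dx_1$. Equip $H^1_{per}(\Omega_H)$ with $$(\phi,\psi)_*=\int_{\Omega_H}\nabla\phi\cdot\nabla\bar\psi\,dx+2\pi\sum_{n\in\mathbb Z}\sqrt{n^2+1}\,(\phi_n^+\bar\psi_n^++\phi_n^-\bar\psi_n^-),$$ whose norm $\|\cdot\|_*$ is equivalent to the $H^1$ norm; $\|\cdot\|_*$ also denotes the induced operator norm. The square root has its branch cut along the negative imaginary axis (so $\sqrt{w}$ has argument in $(-\pi/4,3\pi/4)$ off the cut). For $\alpha\in\mathbb C$ let $\beta_n=\sqrt{k^2-(\alpha+2\pi n/\Lambda)^2}$ and $$a_\alpha(\phi,\psi)=\int_{\Omega_H}\Big(\nabla\phi\cdot\nabla\bar\psi-2i\alpha\tfrac{\partial\phi}{\partial x_1}\bar\psi-(k^2\gamma-\alpha^2)\phi\bar\psi\Big)dx-\sum_{n\in\mathbb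 Z}i\Lambda\beta_n(\phi_n^+\bar\psi_n^++\phi_n^-\bar\psi_n^-).$$ $D(\alpha)$ is the bounded operator on $H^1_{per}(\Omega_H)$ with $(D(\alpha)\phi,\psi)_*=a_\alpha(\phi,\psi)$; it is identity plus compact. Propagative wave numbers. $\mathcal A(k)=\{\alpha\in[-\pi/\Lambda,\pi/\Lambda]: k=|\alpha+2\pi m/\Lambda|\text{ for some }m\in\mathbb Z\}$. Standing assumption: $\operatorname{Ker}(D(\hat\alpha))=\{0\}$ for all $\hat\alpha\in\mathcal A(k)$. $P(k)=\{\alpha_j\}_{j\in\mathcal J}$ is the set of $\alpha\in[-\pi/\Lambda,\pi/\Lambda]$ with $\operatorname{Ker}(D(\alpha))\ne\{0\}$; it is known to be finite, and for each $j$ one can fix (and we fix) $\delta_j\in(0,k)$ such that, with $B_r(\alpha_j)$ the open disk in $\mathbb C$ of radius $r$, $\overline{B_{\delta_j}(\alpha_j)}\cap\mathcal A(k)=\emptyset$, $D(\alpha)$ is holomorphic with finite-dimensional kernel on $\overline{B_{\delta_j}(\alpha_j)}$, and $D(\alpha)$ is invertible on $\overline{B_{\delta_j}(\alpha_j)}\setminus\{\alpha_j\}$. Fix $M>3$ and put $\delta_{PML}=\min_j\delta_j/M$ and $C_{\delta_{PML}}=\max_{j}\max_{\alpha\in\partial B_{\delta_{PML}}(\alpha_j)}\|D^{-1}(\alpha)\|_*$. The integers $r_{j,i}$ and $m_j$. On some disk $B_{\delta_j^*}(\alpha_j)$, $0<\delta_j^*<\delta_j$, one has a factorization $D(\alpha)=E_j(\alpha)\big(P_j^{\operatorname{Ran}}+\sum_{i=1}^{n_j}(\alpha-\alpha_j)^{r_{j,i}}P_{j,i}^{\operatorname{Ker}}\big)F_j(\alpha)$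 with $E_j,F_j$ holomorphic and invertible operator-valued functions, $P_j^{\operatorname{Ran}},P_{j,1}^{\operatorname{Ker}},\dots,P_{j,n_j}^{\operatorname{Ker}}$ mutually disjoint projections summing to $I$, each $P_{j,i}^{\operatorname{Ker}}$ of rank one with range in $\operatorname{Ker}(D(\alpha_j))$, $n_j=\dim\operatorname{Ker}(D(\alpha_j))$, and integers $r_{j,1}\ge\dots\ge r_{j,n_j}\ge1$. Put $m_j=\sum_{i=1}^{n_j}r_{j,i}$. Trace. For a finite-rank operator $F$ on a Hilbert space, $\operatorname{tr}F=\operatorname{tr}(F|_{\mathcal C})$ where $\mathcal C$ is a finite-dimensional $F$-invariant subspace such that $F$ annihilates some direct complement of $\mathcal C$. (The operator $\int_{\partial B_{\delta_{PML}}(\alpha_j)}\mathsf H(\alpha)d\alpha$ is of finite rank.) *)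

(* Defs.v *)
From HB Require Import structures.
From mathcomp Require Import all_boot all_order all_algebra.
From mathcomp Require Import generic_quotient ring_quotient.
From mathcomp Require Import all_classical all_reals all_analysis measurable_realfun.
From mathcomp Require Import ring lra.
From mathcomp.real_closed Require Import complex.

Set Implicit Arguments.
Unset Strict Implicit.
Unset Printing Implicit Defensive.

Import Order.TTheory GRing.Theory Num.Theory.
Import numFieldNormedType.Exports.

Local Open Scope classical_set_scope.
Local Open Scope ring_scope.
Local Open Scope complex_scope.

Notation Re := complex.Re.
Notation Im := complex.Im.
Notation normc := ComplexField.Normc.normc.

Section L2.
Context d (T : measurableType d) (R : realType).
Variable mu : {measure set T -> \bar R}.
Implicit Types (f g : T -> R[i]).

Definition memL2 f : Prop :=
  (fun x => Re (f x)) \in Lfun mu 2%:E /\ (fun x => Im (f x)) \in Lfun mu 2%:E.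

Definition N2 (u : T -> R) : \bar R := ('N[mu]_2%:E[EFin \o u])%E.

Definition cvgL2 (w : nat -> T -> R[i]) f : Prop :=
  (fun m => N2 (fun x => Re (w m x - f x))) @ \oo --> 0%E /\
  (fun m => N2 (fun x => Im (w m x - f x))) @ \oo --> 0%E.

Definition cint f : R[i] :=
  (\int[mu]_x Re (f x))%R +i* (\int[mu]_x Im (f x))%R.

Definition cmeas f : Prop :=
  measurable_fun setT (fun x => Re (f x)) /\
  measurable_fun setT (fun x => Im (f x)).

Lemma ReD (x y : R[i]) : Re (x + y) = Re x + Re y.
Proof. by case: x y => [a b] [c e]. Qed.
Lemma ImD (x y : R[i]) : Im (x + y) = Im x + Im y.
Proof. by case: x y => [a b] [c e]. Qed.
Lemma ReM (x y : R[i]) : Re (x * y) = Re x * Re y - Im x * Im y.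
Proof. by case: x y => [a b] [c e]. Qed.
Lemma ImM (x y : R[i]) : Im (x * y) = Re x * Im y + Im x * Re y.
Proof. by case: x y => [a b] [c e]. Qed.

Lemma LfunL (a b : R) (u v : T -> R) : u \in Lfun mu 2%:E -> v \in Lfun mu 2%:E ->
  (fun x => a * u x + b * v x) \in Lfun mu 2%:E.
Proof.
move=> Hu Hv.
have [z0 L] := @Lfun_submod_closed _ T R mu 2%:E (lee1n 2).
have Hbv : (b \*: v : T -> R) \in Lfun mu 2%:E.
  by rewrite -[X in X \in _]addr0; exact: L.
exact: (L a _ _ Hu Hbv).
Qed.

Lemma memL2_lin (a : R[i]) f g :
  memL2 f -> memL2 g -> memL2 (fun x => a * f x + g x).
Proof.
move=> [f1 f2] [g1 g2]; split.
- rewrite (_ : (fun x => _) = (fun x => 1 * (Re a * Re (f x) + (- Im a) * Im (f x)) + 1 * Re (g x))).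
    by apply: LfunL => //; exact: LfunL.
  by apply/funext => x; rewrite ReD ReM !mul1r mulNr.
- rewrite (_ : (fun x => _) = (fun x => 1 * (Re a * Im (f x) + Im a * Re (f x)) + 1 * Im (g x))).
    by apply: LfunL => //; exact: LfunL.
  by apply/funext => x; rewrite ImD ImM !mul1r.
Qed.

Lemma memL2_meas f : memL2 f -> cmeas f.
Proof. by case=> /andP[+ _] /andP[+ _]; rewrite !inE. Qed.

Lemma N2Z (a : R) (u : T -> R) : measurable_fun setT u ->
  (N2 (fun x => a * u x)%R = `|a|%:E * N2 u)%E.
Proof.
move=> mu_; rewrite /N2 unlock /Lnorm.
under eq_integral do rewrite /= normrM powRM// EFinM.
rewrite ge0_integralZl//; last first.
- apply/measurable_EFinP/(@measurableT_comp _ _ _ _ _ _ (fun x : R => x `^ 2)) => //.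
  exact: measurableT_comp.
by rewrite poweRM ?integral_ge0// poweR_EFin -powRrM mulfV ?powRr1.
Qed.

Lemma N2L (a b : R) (u v : T -> R) :
  measurable_fun setT u -> measurable_fun setT v ->
  (N2 (fun x => a * u x + b * v x)%R <= `|a|%:E * N2 u + `|b|%:E * N2 v)%E.
Proof.
move=> m1 m2; rewrite -!N2Z//.
apply: (@eminkowski _ T R mu (fun x => a * u x) (fun x => b * v x) 2%:E).
- exact: measurable_funM.
- exact: measurable_funM.
- exact: lee1n.
Qed.

Lemma squeeze_lin (a b : R) (s t r : nat -> \bar R) :
  (forall n, 0 <= r n <= `|a|%:E * s n + `|b|%:E * t n)%E ->
  s @ \oo --> 0%E -> t @ \oo --> 0%E -> r @ \oo --> 0%E.
Proof.
move=> H s0 t0.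
apply: (@squeeze_cvge _ _ _ _ (fun=> 0%E) _ (fun n => `|a|%:E * s n + `|b|%:E * t n)%E).
- exact: nearW.
- exact: cvg_cst.
- rewrite [X in _ --> X](_ : 0%E = (`|a|%:E * 0 + `|b|%:E * 0)%E); last first.
    by rewrite !mule0 adde0.
  by apply: cvgeD; [rewrite !mule0|exact: cvgeZl|exact: cvgeZl].
Qed.

Lemma N2_lin3 (a b : R) (u v t : nat -> T -> R) (r : nat -> T -> R) :
  (forall n, measurable_fun setT (u n)) -> (forall n, measurable_fun setT (v n)) ->
  (forall n, measurable_fun setT (t n)) ->
  (forall n x, r n x = a * u n x + b * v n x + t n x) ->
  N2 \o u @ \oo --> 0%E -> N2 \o v @ \oo --> 0%E -> N2 \o t @ \oo --> 0%E ->
  N2 \o r @ \oo --> 0%E.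
Proof.
move=> mu_ mv mt E u0 v0 t0.
have H : (fun n => N2 (fun x => a * u n x + b * v n x)) @ \oo --> 0%E.
  by apply: (squeeze_lin (a := a) (b := b)) u0 v0 => n; rewrite Lnorm_ge0 N2L.
apply: (squeeze_lin (a := 1) (b := 1)) H t0 => n; rewrite Lnorm_ge0/=.
rewrite (_ : r n = (fun x => 1 * (a * u n x + b * v n x) + 1 * t n x)).
  by apply: N2L => //; apply: measurable_funD; exact: measurable_funM.
by apply/funext => x /=; rewrite E !mul1r.
Qed.

Lemma cvgL2_lin (a : R[i]) w w' f g :
  (forall m, cmeas (w m)) -> (forall m, cmeas (w' m)) -> cmeas f -> cmeas g ->
  cvgL2 w f -> cvgL2 w' g ->
  cvgL2 (fun m x => a * w m x + w' m x) (fun x => a * f x + g x).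
Proof.
move=> mw mw' mf mg [w1 w2] [w'1 w'2].
have ReB (x y : R[i]) : Re (x - y) = Re x - Re y by case: x y => [? ?] [].
have ImB (x y : R[i]) : Im (x - y) = Im x - Im y by case: x y => [? ?] [].
have mR h k : cmeas h -> cmeas k -> measurable_fun setT (fun x : T => Re (h x - k x)).
  by move=> [? _] [? _]; under eq_fun do rewrite ReB; exact: measurable_funB.
have mI h k : cmeas h -> cmeas k -> measurable_fun setT (fun x : T => Im (h x - k x)).
  by move=> [_ ?] [_ ?]; under eq_fun do rewrite ImB; exact: measurable_funB.
split.
- apply: (N2_lin3 (a := Re a) (b := - Im a)) w1 w2 w'1 => n;
    [exact: mR|exact: mI|exact: mR|move=> x].
  by rewrite !(ReB, ImB, ReD, ReM); ring.
- apply: (N2_lin3 (a := Im a) (b := Re a)) w1 w2 w'2 => n;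
    [exact: mR|exact: mI|exact: mI|move=> x].
  by rewrite !(ReB, ImB, ImD, ImM); ring.
Qed.

End L2.

Section Plane.
Context {R : realType}.

Let plane := (measurableTypeR R * measurableTypeR R)%type.

Definition leb2 := (@lebesgue_measure R \x @lebesgue_measure R)%E.

Lemma open_measurable2 (A : set (R * R)) : open A -> measurable (A : set plane).
Proof.
move=> oA.
pose box (q : (rat * rat) * (rat * rat)) : set plane :=
  `]ratr q.1.1, ratr q.1.2[ `*` `]ratr q.2.1, ratr q.2.2[.
pose F q : set plane := if pselect (box q `<=` A) then box q else set0.
have -> : (A : set plane) = \bigcup_q F q.
  apply/seteqP; split=> [[x y] Axy|z [q _]]; last first.
    by rewrite /F; case: pselect => // bA; exact: bA.
  have /nbhs_ballP[e /= e0 eA] : nbhs (x, y) A by apply: open_nbhs_nbhs.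
  have [q1 /[!in_itv]/= /andP[q1a q1b]] := rat_in_itvoo (ltac:(lra) : x - e < x).
  have [q2 /[!in_itv]/= /andP[q2a q2b]] := rat_in_itvoo (ltac:(lra) : x < x + e).
  have [q3 /[!in_itv]/= /andP[q3a q3b]] := rat_in_itvoo (ltac:(lra) : y - e < y).
  have [q4 /[!in_itv]/= /andP[q4a q4b]] := rat_in_itvoo (ltac:(lra) : y < y + e).
  exists ((q1, q2), (q3, q4)) => //; rewrite /F; case: pselect => /= [_|].
    by split; rewrite /= in_itv/= ?q1b ?q2a ?q3b ?q4a.
  case=> -[u v] [] /=; rewrite !in_itv/= => /andP[u1 u2] /andP[v1 v2].
  apply: eA; split => /=; rewrite /ball/= ltr_norml; lra.
apply: countable_bigcupT_measurable => [|q]; first exact: countableP.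
by rewrite /F; case: pselect => ? /=; [apply: measurableX; exact: measurable_itv|exact: measurable0].
Qed.

Lemma continuous_measurable2 (f : R * R -> R) : continuous f ->
  measurable_fun setT (f : plane -> R).
Proof.
move=> cf; apply: (measurability _ (RGenOInfty.measurableE R)).
move=> _ [_ [a ->] <-]; rewrite setTI; apply: open_measurable2.
by apply: open_comp => //= x _; exact: cf.
Qed.

Variables Lam H : R.

Definition cell : set plane := `]- (Lam / 2), Lam / 2[ `*` `]- H, H[.

Lemma measurable_cell : measurable cell.
Proof. by apply: measurableX; exact: measurable_itv. Qed.

(* measures restricted to the cell and to its horizontal and vertical sides, so
   that functions on the cell are represented by functions on the plane *)
Definition mu_cell := mrestr leb2 measurable_cell.
Definition mu_h := mrestr (@lebesgue_measure R)
  (measurable_itv `]- (Lam / 2), Lam / 2[ : measurable (_ : set (measurableTypeR R))).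
Definition mu_v := mrestr (@lebesgue_measure R)
  (measurable_itv `]- H, H[ : measurable (_ : set (measurableTypeR R))).

Lemma continuous_Lfun_cell (f : R * R -> R) : continuous f ->
  (f : plane -> R) \in Lfun mu_cell 2%:E.
Proof.
move=> cf; have mf := continuous_measurable2 cf.
pose K : set (R * R) := `[- (Lam / 2), Lam / 2] `*` `[- H, H].
have [M [_ fM]] : bounded_set (f @` K).
  apply: compact_bounded; apply: continuous_compact.
    exact: continuous_subspaceT.
  by apply: compact_setX; exact: segment_compact.
have {fM} := fM (M + 1) (ltac:(by rewrite ltrDl)) => fM.
have bf x : cell x -> `|f x| <= M + 1.
  move=> [] /=; rewrite !in_itv/= => /andP[? ?] /andP[? ?].
  by apply: fM; exists x => //; split; rewrite /= in_itv/=; apply/andP; split; apply: ltW.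
pose g : plane -> R := f \* \1_cell.
have M0 : 0 <= Num.max 0 (M + 1) by rewrite le_max lexx.
have gM x : `|g x| <= Num.max 0 (M + 1).
  rewrite /g /= indicE; case: (pselect (cell x)) => cx.
    by rewrite mem_set// mulr1 le_max bf ?orbT.
  by rewrite memNset// mulr0 normr0.
have mg : measurable_fun setT g.
  by apply: measurable_funM => //; apply: measurable_indic; exact: measurable_cell.
have fg : ae_eq mu_cell setT (fun x => (`|f x| `^ 2)%:E) (fun x => (`|g x| `^ 2)%:E).
  exists (~` cell); split.
  - by apply: measurableC; exact: measurable_cell.
  - exact: (etrans (congr1 leb2 (setICl cell)) (measure0 leb2)).
  - move=> x /= nfg cx; apply: nfg => _.
    by rewrite /g /= indicE mem_set// mulr1.
have mp (h : plane -> R) : measurable_fun setT h ->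
    measurable_fun setT (fun x => (`|h x| `^ 2)%:E).
  move=> mh; apply/measurable_EFinP/(@measurableT_comp _ _ _ _ _ _ (fun x : R => x `^ 2)) => //.
  exact: measurableT_comp.
apply/andP; split; rewrite inE//= /finite_norm unlock /Lnorm.
apply: poweR_lty.
rewrite (ge0_ae_eq_integral measurableT (mp _ mf) (mp _ mg) _ _ fg);
  [|by move=> *; rewrite lee_fin powR_ge0..].
apply: (@le_lt_trans _ _ (\int[mu_cell]_x ((Num.max 0 (M + 1))%R `^ 2)%:E)%E).
  apply: ge0_le_integral => //=.
  - exact: mp.
  - move=> x _; rewrite lee_fin ge0_ler_powR ?nnegrE//.
rewrite integral_cst// lte_mul_pinfty// ?lee_fin ?powR_ge0//.
pose I1 := [set` `]- (Lam / 2), Lam / 2[]; pose I2 := [set` `]- H, H[].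
have E : mu_cell setT = (@lebesgue_measure R I1 * @lebesgue_measure R I2)%E.
  apply: (etrans (congr1 leb2 (setTI cell))).
  by apply: product_measure1E; exact: measurable_itv.
apply: (eq_ind_r (fun z => z < +oo)%E _ E).
by rewrite /I1 /I2 !lebesgue_measure_itv /=; do 2 case: ifP => _; rewrite ?mule0 ?mul0e ?ltry.
Qed.

Fixpoint Ck (n : nat) (f : R * R -> R) : Prop :=
  if n is m.+1 then
    [/\ continuous f, forall x, derivable f x (1, 0), forall x, derivable f x (0, 1),
        Ck m (fun x => 'D_(1, 0) f x) & Ck m (fun x => 'D_(0, 1) f x)]
  else continuous f.

Definition smooth (f : R * R -> R) : Prop := forall n, Ck n f.

Definition csmooth (w : R * R -> R[i]) : Prop :=
  smooth (fun x => Re (w x)) /\ smooth (fun x => Im (w x)).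

Definition cderiv (v : R * R) (w : R * R -> R[i]) (x : R * R) : R[i] :=
  ('D_v (fun y => Re (w y)) x) +i* ('D_v (fun y => Im (w y)) x).

(* real test functions suffice, both sides being linear in [eta] *)
Definition weak_partial (v : R * R) (u du : R * R -> R[i]) : Prop :=
  forall eta : R * R -> R, smooth eta ->
    closure [set x | eta x != 0] `<=` cell ->
    cint mu_cell (fun x => u x * ('D_v eta x)%:C) =
    - cint mu_cell (fun x => du x * (eta x)%:C).

(* [g] is the trace of [u] along the side parametrized by [i]: the restriction to
   the side, extended by continuity from the smooth functions, which are dense
   in H^1 of the (bounded) cell *)
Definition is_trace (mu : {measure set (measurableTypeR R) -> \bar R})
    (i : R -> R * R) (u du1 du2 : R * R -> R[i]) (g : R -> R[i]) : Prop :=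
  memL2 mu g /\
  exists w : nat -> R * R -> R[i],
    [/\ forall m, csmooth (w m),
        cvgL2 mu_cell w u,
        cvgL2 mu_cell (fun m => cderiv (1, 0) (w m)) du1,
        cvgL2 mu_cell (fun m => cderiv (0, 1) (w m)) du2 &
        cvgL2 mu (fun m t => w m (i t)) g].

(* An element of H^1_per is carried together with its weak gradient and its
   traces on the sides x_2 = H and x_2 = - H.  These four functions are almost
   everywhere determined by the first one, so that identifying null data below
   amounts to identifying functions that are equal almost everywhere. *)
Definition H1raw : Type :=
  ((R * R -> R[i]) * (R * R -> R[i]) * (R * R -> R[i]) *
   (R -> R[i]) * (R -> R[i]))%type.

Definition rfun (x : H1raw) := x.1.1.1.1.
Definition rd1 (x : H1raw) := x.1.1.1.2.
Definition rd2 (x : H1raw) := x.1.1.2.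
Definition rtop (x : H1raw) := x.1.2.
Definition rbot (x : H1raw) := x.2.

Record in_H1per (x : H1raw) : Prop := InH1per {
  in_fun : memL2 mu_cell (rfun x);
  in_d1 : memL2 mu_cell (rd1 x);
  in_d2 : memL2 mu_cell (rd2 x);
  in_weak1 : weak_partial (1, 0) (rfun x) (rd1 x);
  in_weak2 : weak_partial (0, 1) (rfun x) (rd2 x);
  in_top : is_trace mu_h (fun t => (t, H)) (rfun x) (rd1 x) (rd2 x) (rtop x);
  in_bot : is_trace mu_h (fun t => (t, - H)) (rfun x) (rd1 x) (rd2 x) (rbot x);
  in_per : exists g : R -> R[i],
    is_trace mu_v (fun t => (- (Lam / 2), t)) (rfun x) (rd1 x) (rd2 x) g /\
    is_trace mu_v (fun t => (Lam / 2, t)) (rfun x) (rd1 x) (rd2 x) g }.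

Definition raw_null (x : H1raw) : Prop :=
  [/\ {ae mu_cell, forall z, rfun x z = 0}, {ae mu_cell, forall z, rd1 x z = 0},
      {ae mu_cell, forall z, rd2 x z = 0}, {ae mu_h, forall t, rtop x t = 0} &
      {ae mu_h, forall t, rbot x t = 0}].


Lemma deriv_lin (v : R * R) (a b : R) (f g : R * R -> R) x :
  derivable f x v -> derivable g x v ->
  derivable (fun y => a * f y + b * g y) x v /\
  'D_v (fun y => a * f y + b * g y) x = a * 'D_v f x + b * 'D_v g x.
Proof.
move=> df dg; have da := @derivableZ _ _ _ f a x v df; have db := @derivableZ _ _ _ g b x v dg.
split; first exact: (derivableD da db).
exact: (etrans (deriveD da db) (f_equal2 +%R (@deriveZ _ _ _ f a x v df) (@deriveZ _ _ _ g b x v dg))).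
Qed.

Lemma Ck_lin n (a b : R) f g : Ck n f -> Ck n g -> Ck n (fun y => a * f y + b * g y).
Proof.
have cl (f1 g1 : R * R -> R) : continuous f1 -> continuous g1 ->
    continuous (fun y => a * f1 y + b * g1 y).
  move=> cf cg x; apply: cvgD; apply: cvgM; by [exact: cvg_cst|exact: cf|exact: cg].
elim: n f g => [|n IH] f g /=; first exact: cl.
move=> [cf f1 f2 Df1 Df2] [cg g1 g2 Dg1 Dg2]; split.
- exact: cl.
- by move=> x; have [] := deriv_lin a b (f1 x) (g1 x).
- by move=> x; have [] := deriv_lin a b (f2 x) (g2 x).
- rewrite (_ : (fun x => _) = (fun x => a * 'D_(1,0) f x + b * 'D_(1,0) g x)); first exact: IH.
  by apply/funext => x; have [] := deriv_lin a b (f1 x) (g1 x).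
- rewrite (_ : (fun x => _) = (fun x => a * 'D_(0,1) f x + b * 'D_(0,1) g x)); first exact: IH.
  by apply/funext => x; have [] := deriv_lin a b (f2 x) (g2 x).
Qed.

Lemma smooth_lin (a b : R) f g : smooth f -> smooth g -> smooth (fun y => a * f y + b * g y).
Proof. by move=> sf sg n; exact: Ck_lin. Qed.

Let Re_lin (a x y : R[i]) : Re (a * x + y) = 1 * (Re a * Re x + (- Im a) * Im x) + 1 * Re y.
Proof. by rewrite ReD ReM; ring. Qed.
Let Im_lin (a x y : R[i]) : Im (a * x + y) = 1 * (Re a * Im x + Im a * Re x) + 1 * Im y.
Proof. by rewrite ImD ImM; ring. Qed.

Lemma csmooth_lin (a : R[i]) w w' : csmooth w -> csmooth w' ->
  csmooth (fun x => a * w x + w' x).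
Proof.
move=> [w1 w2] [w'1 w'2]; split.
- under eq_fun do rewrite Re_lin.
  by apply: smooth_lin => //; exact: smooth_lin.
- under eq_fun do rewrite Im_lin.
  by apply: smooth_lin => //; exact: smooth_lin.
Qed.

Lemma cderiv_lin v (a : R[i]) w w' : v = (1, 0) \/ v = (0, 1) ->
  csmooth w -> csmooth w' ->
  cderiv v (fun x => a * w x + w' x) = (fun x => a * cderiv v w x + cderiv v w' x).
Proof.
move=> vE [w1 w2] [w'1 w'2]; apply/funext => x.
have D (f : R * R -> R) : smooth f -> derivable f x v.
  by move=> /(_ 1%N)[_ d1 d2 _ _]; case: vE => ->.
have L (b c : R) f g : smooth f -> smooth g ->
    'D_v (fun y => b * f y + c * g y) x = b * 'D_v f x + c * 'D_v g x.
  by move=> sf sg; have [] := deriv_lin b c (D _ sf) (D _ sg).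
rewrite /cderiv; under eq_fun do rewrite Re_lin; under [in X in _ +i* X]eq_fun do rewrite Im_lin.
rewrite !L//; try exact: smooth_lin.
by apply/eqP; rewrite eq_complex; apply/andP; split; apply/eqP; rewrite (ReD, ImD) (ReM, ImM) /=; ring.
Qed.

Lemma csmooth_cmeas w : csmooth w -> @cmeas _ plane _ w.
Proof. by move=> [/(_ 0%N) w1 /(_ 0%N) w2]; split; exact: continuous_measurable2. Qed.

Lemma cderiv_cmeas v w : v = (1, 0) \/ v = (0, 1) -> csmooth w ->
  @cmeas _ plane _ (cderiv v w).
Proof.
move=> [] -> [/(_ 1%N)[_ _ _ a1 a2] /(_ 1%N)[_ _ _ b1 b2]].
- exact: (conj (continuous_measurable2 a1) (continuous_measurable2 b1)).
- exact: (conj (continuous_measurable2 a2) (continuous_measurable2 b2)).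
Qed.

Lemma csmooth_section (i : R -> R * R) w : continuous i -> csmooth w ->
  @cmeas _ (measurableTypeR R) _ (fun t => w (i t)).
Proof.
move=> ci [/(_ 0%N) w1 /(_ 0%N) w2]; split; apply: continuous_measurable_fun => x.
- exact: (@continuous_comp _ _ _ i (fun y => Re (w y)) x (ci x) (w1 _)).
- exact: (@continuous_comp _ _ _ i (fun y => Im (w y)) x (ci x) (w2 _)).
Qed.

Lemma is_trace_lin mu i (a : R[i]) u u1 u2 g u' u1' u2' g' : continuous i ->
  memL2 mu_cell u -> memL2 mu_cell u1 -> memL2 mu_cell u2 ->
  memL2 mu_cell u' -> memL2 mu_cell u1' -> memL2 mu_cell u2' ->
  is_trace mu i u u1 u2 g -> is_trace mu i u' u1' u2' g' ->
  is_trace mu i (fun x => a * u x + u' x) (fun x => a * u1 x + u1' x)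
    (fun x => a * u2 x + u2' x) (fun x => a * g x + g' x).
Proof.
move=> ci /memL2_meas mu_ /memL2_meas mu1 /memL2_meas mu2 /memL2_meas mu_'
  /memL2_meas mu1' /memL2_meas mu2' [Lg [w [sw w0 w1 w2 wg]]] [Lg' [w' [sw' w0' w1' w2' wg']]].
split; first exact: memL2_lin.
have e1 : (1, 0) = (1, 0) :> R * R \/ (1, 0) = (0, 1) :> R * R by left.
have e2 : (0, 1) = (1, 0) :> R * R \/ (0, 1) = (0, 1) :> R * R by right.
exists (fun m x => a * w m x + w' m x); split.
- by move=> m; exact: csmooth_lin.
- by apply: cvgL2_lin => // m; exact: csmooth_cmeas.
- under eq_fun do rewrite cderiv_lin//.
  by apply: cvgL2_lin => // m; exact: cderiv_cmeas.
- under eq_fun do rewrite cderiv_lin//.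
  by apply: cvgL2_lin => // m; exact: cderiv_cmeas.
- apply: cvgL2_lin => //; [by move=> m; exact: csmooth_section|by move=> m; exact: csmooth_section|exact: (memL2_meas Lg)|exact: (memL2_meas Lg')].
Qed.

Lemma cint_lin (a : R[i]) f g :
  mu_cell.-integrable setT (EFin \o (fun x => Re (f x))) ->
  mu_cell.-integrable setT (EFin \o (fun x => Im (f x))) ->
  mu_cell.-integrable setT (EFin \o (fun x => Re (g x))) ->
  mu_cell.-integrable setT (EFin \o (fun x => Im (g x))) ->
  cint mu_cell (fun x => a * f x + g x) = a * cint mu_cell f + cint mu_cell g.
Proof.
move=> f1 f2 g1 g2.
have L (b c : R) (h k : plane -> R) : mu_cell.-integrable setT (EFin \o h) ->
    mu_cell.-integrable setT (EFin \o k) ->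
    mu_cell.-integrable setT (EFin \o (fun x => b * h x + c * k x)) /\
    \int[mu_cell]_x (b * h x + c * k x) =
    b * \int[mu_cell]_x h x + c * \int[mu_cell]_x k x.
  move=> ih ik.
  have ih' : mu_cell.-integrable setT (EFin \o (fun x => b * h x)) by exact: (integrableZl _ b ih).
  have ik' : mu_cell.-integrable setT (EFin \o (fun x => c * k x)) by exact: (integrableZl _ c ik).
  split; first exact: (integrableD _ ih' ik').
  by rewrite RintegralD// !RintegralZl.
have [i1 E1] := L (Re a) (- Im a) _ _ f1 f2.
have [i2 E2] := L (Re a) (Im a) _ _ f2 f1.
have [_ E3] := L 1 1 _ _ i1 g1.
have [_ E4] := L 1 1 _ _ i2 g2.
rewrite /cint; under eq_Rintegral do rewrite Re_lin.
under [in X in _ +i* X]eq_Rintegral do rewrite Im_lin.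
rewrite E3 E4 E1 E2; apply/eqP; rewrite eq_complex; apply/andP; split; apply/eqP.
- by rewrite ReD ReM /=; ring.
- by rewrite ImD ImM /=; ring.
Qed.

Lemma integrable_pair u (c : R * R -> R) : memL2 mu_cell u -> continuous c ->
  mu_cell.-integrable setT (EFin \o (fun x => Re (u x * (c x)%:C))) /\
  mu_cell.-integrable setT (EFin \o (fun x => Im (u x * (c x)%:C))).
Proof.
move=> [u1 u2] /continuous_Lfun_cell Lc.
have ReE (z : R[i]) (t : R) : Re (z * t%:C) = Re z * t by rewrite ReM /= mulr0 subr0.
have ImE (z : R[i]) (t : R) : Im (z * t%:C) = Im z * t by rewrite ImM /= mulr0 add0r.
split.
- by under eq_fun do rewrite ReE; apply/Lfun1_integrable; exact: Lfun2_mul_Lfun1.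
- by under eq_fun do rewrite ImE; apply/Lfun1_integrable; exact: Lfun2_mul_Lfun1.
Qed.

Lemma weak_partial_lin v (a : R[i]) u du u' du' : v = (1, 0) \/ v = (0, 1) ->
  memL2 mu_cell u -> memL2 mu_cell du -> memL2 mu_cell u' -> memL2 mu_cell du' ->
  weak_partial v u du -> weak_partial v u' du' ->
  weak_partial v (fun x => a * u x + u' x) (fun x => a * du x + du' x).
Proof.
move=> vE Lu Ldu Lu' Ldu' wu wu' eta se supp.
have c0 : continuous eta by exact: (se 0%N).
have c1 : continuous (fun x => 'D_v eta x).
  by have [_ _ _ e1 e2] := se 1%N; case: vE => ->; [exact: e1|exact: e2].
have D (x y z : R[i]) : (a * x + y) * z = a * (x * z) + y * z by ring.
under eq_fun do rewrite D; under [in RHS]eq_fun do rewrite D.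
have [? ?] := integrable_pair Lu c1; have [? ?] := integrable_pair Lu' c1.
have [? ?] := integrable_pair Ldu c0; have [? ?] := integrable_pair Ldu' c0.
by rewrite !cint_lin// wu// wu'//; ring.
Qed.


Definition H1pred : {pred H1raw} := fun x => `[< in_H1per x >].

Lemma cvgL2_0 d (T : measurableType d) (mu : {measure set T -> \bar R}) :
  @cvgL2 _ T _ mu (fun _ _ => 0) (fun=> 0).
Proof.
have E : N2 mu (fun=> 0) = 0%E by rewrite /N2 Lnorm0.
by split; under eq_fun do rewrite subrr /= E; exact: cvg_cst.
Qed.

Lemma memL2_0 d (T : measurableType d) (mu : {measure set T -> \bar R}) :
  @memL2 _ T _ mu (fun=> 0).
Proof. by split; have [+ _] := @Lfun_submod_closed _ T R mu 2%:E (lee1n 2). Qed.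

Lemma smooth0 : smooth (fun _ : R * R => 0 : R).
Proof.
elim=> [|n IH] /=; first by move=> x; exact: cvg_cst.
by split=> [x|x|x||]; [exact: cvg_cst|exact: derivable_cst|exact: derivable_cst
  |under eq_fun do rewrite derive_cst|under eq_fun do rewrite derive_cst].
Qed.

Lemma is_trace_0 mu i : is_trace mu i (fun=> 0) (fun=> 0) (fun=> 0) (fun=> 0).
Proof.
have D v : cderiv v (fun=> 0) = (fun=> 0).
  by apply/funext => x; rewrite /cderiv !derive_cst.
split; first exact: memL2_0.
exists (fun _ _ => 0); split; rewrite ?D; try exact: cvgL2_0.
by move=> _; split; exact: smooth0.
Qed.

Lemma H1pred_submod_closed : submod_closed H1pred.
Proof.
have e1 : (1, 0) = (1, 0) :> R * R \/ (1, 0) = (0, 1) :> R * R by left.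
have e2 : (0, 1) = (1, 0) :> R * R \/ (0, 1) = (0, 1) :> R * R by right.
have W v : weak_partial v (fun=> 0) (fun=> 0).
  move=> eta _ _; rewrite /cint -[LHS]opprK; congr (- _).
  by under eq_Rintegral do rewrite mul0r; under [in X in _ +i* X]eq_Rintegral do rewrite mul0r;
    under [in RHS]eq_Rintegral do rewrite mul0r; under [in X in _ = _ +i* X]eq_Rintegral do rewrite mul0r;
    rewrite /= /Rintegral !integral0 /= ; apply/eqP; rewrite eq_complex /= !oppr0 eqxx.
split.
  apply/asboolP; split; try exact: memL2_0; try exact: W; try exact: is_trace_0.
  by exists (fun=> 0); split; exact: is_trace_0.
move=> a x y /asboolP[x0 x1 x2 x3 x4 x5 x6 [g [x7 x8]]] /asboolP[y0 y1 y2 y3 y4 y5 y6 [k [y7 y8]]].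
have cp (f h : R -> R) : continuous f -> continuous h -> continuous (fun t => (f t, h t)).
  by move=> cf cg t; exact: (cvg_pair (cf t) (cg t)).
have ch (b : R) : continuous (fun t : R => (t, b)).
  by apply: cp => t; [exact: cvg_id|exact: cvg_cst].
have cv (b : R) : continuous (fun t : R => (b, t)).
  by apply: cp => t; [exact: cvg_cst|exact: cvg_id].
apply/asboolP; split.
- exact: (memL2_lin a x0 y0).
- exact: (memL2_lin a x1 y1).
- exact: (memL2_lin a x2 y2).
- exact: (weak_partial_lin a e1 x0 x1 y0 y1 x3 y3).
- exact: (weak_partial_lin a e2 x0 x2 y0 y2 x4 y4).
- exact: (is_trace_lin a (ch _) x0 x1 x2 y0 y1 y2 x5 y5).
- exact: (is_trace_lin a (ch _) x0 x1 x2 y0 y1 y2 x6 y6).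
- exists (fun t => a * g t + k t); split.
  + exact: (is_trace_lin a (cv _) x0 x1 x2 y0 y1 y2 x7 y7).
  + exact: (is_trace_lin a (cv _) x0 x1 x2 y0 y1 y2 x8 y8).
Qed.

HB.instance Definition _ := GRing.isSubmodClosed.Build _ _ H1pred H1pred_submod_closed.

Definition H1data := {x : H1raw | H1pred x}.
HB.instance Definition _ := [isSub of H1data for @sval _ _].
HB.instance Definition _ := [Choice of H1data by <:].
HB.instance Definition _ := [SubChoice_isSubLmodule of H1data by <:].

Definition H1null : {pred H1data} := fun x => `[< raw_null (val x) >].

Lemma H1null_submod_closed : submod_closed H1null.
Proof.
split; first by apply/asboolP; split; exact: nearW.
move=> a x y /asboolP[x1 x2 x3 x4 x5] /asboolP[y1 y2 y3 y4 y5].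
have L d (T : measurableType d) (mu : {measure set T -> \bar R}) (f g : T -> R[i]) :
    {ae mu, forall z, f z = 0} -> {ae mu, forall z, g z = 0} ->
    {ae mu, forall z, a * f z + g z = 0}.
  by move=> f0 g0; apply: filterS2 f0 g0 => z -> ->; rewrite mulr0 addr0.
apply/asboolP; split.
- exact: (L _ _ _ _ _ x1 y1).
- exact: (L _ _ _ _ _ x2 y2).
- exact: (L _ _ _ _ _ x3 y3).
- exact: (L _ _ _ _ _ x4 y4).
- exact: (L _ _ _ _ _ x5 y5).
Qed.

HB.instance Definition _ := GRing.isSubmodClosed.Build _ _ H1null H1null_submod_closed.

Definition H1per : Type := Quotient.quot H1null.
HB.instance Definition _ := GRing.Zmodule.copy H1per (Quotient.quot H1null).

Definition H1repr (phi : H1per) : H1data := repr (phi : Quotient.quot H1null).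

Definition H1class (x : H1data) : H1per := \pi_(Quotient.quot H1null)%qT x.

Definition H1scale (a : R[i]) (phi : H1per) : H1per := H1class (a *: H1repr phi).

Lemma H1classP (x y : H1data) : H1class x = H1class y <-> x - y \in H1null.
Proof.
split=> [/eqmodP|h]; first by rewrite /= Quotient.equivE.
by apply/eqmodP; rewrite /= Quotient.equivE.
Qed.

Lemma H1reprK : cancel H1repr H1class.
Proof. by move=> x; rewrite /H1class /H1repr reprK. Qed.

Lemma H1classD x y : H1class (x + y) = H1class x + H1class y.
Proof. exact: Quotient.pi_add. Qed.

Lemma H1classZ a x : H1class (a *: x) = H1scale a (H1class x).
Proof.
apply/H1classP; rewrite -scalerBr rpredZ//; apply/H1classP.
by rewrite H1reprK.
Qed.

Lemma H1scaleA a b phi : H1scale a (H1scale b phi) = H1scale (a * b) phi.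
Proof. by rewrite -[phi]H1reprK -!H1classZ scalerA. Qed.
Lemma H1scale1 : left_id 1 H1scale.
Proof. by move=> phi; rewrite -[phi]H1reprK -H1classZ scale1r. Qed.
Lemma H1scaleDr : right_distributive H1scale +%R.
Proof.
move=> a phi psi; rewrite -[phi]H1reprK -[psi]H1reprK.
by rewrite -H1classD -!H1classZ -H1classD scalerDr.
Qed.
Lemma H1scaleDl phi : {morph H1scale^~ phi : a b / a + b}.
Proof.
by move=> a b; rewrite -[phi]H1reprK -!H1classZ -H1classD scalerDl.
Qed.

HB.instance Definition _ := GRing.Zmodule_isLmodule.Build R[i] H1per
  H1scaleA H1scale1 H1scaleDr H1scaleDl.

Definition u_ (phi : H1per) : R * R -> R[i] := rfun (val (H1repr phi)).
Definition d1_ (phi : H1per) : R * R -> R[i] := rd1 (val (H1repr phi)).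
Definition d2_ (phi : H1per) : R * R -> R[i] := rd2 (val (H1repr phi)).
Definition top_ (phi : H1per) : R -> R[i] := rtop (val (H1repr phi)).
Definition bot_ (phi : H1per) : R -> R[i] := rbot (val (H1repr phi)).
Definition expi (t : R) : R[i] := cos t +i* sin t.

Definition fcoef (g : R -> R[i]) (n : int) : R[i] :=
  (Lam^-1)%:C *
  cint mu_h (fun t : R => g t * expi (- (2 * pi * n%:~R * t / Lam))).

(* sums over all integers, by symmetric partial sums; the series below converge
   absolutely, so that the order of summation is immaterial *)
Definition psumZ (c : int -> R[i]) (N : nat) : R[i] :=
  \sum_(i < N.*2.+1) c (i%:Z - N%:Z).

Definition sumZ (c : int -> R[i]) : R[i] :=
  limn (fun N => Re (psumZ c N)) +i* limn (fun N => Im (psumZ c N)).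

Definition star_term (phi psi : H1per) (n : int) : R[i] :=
  (Num.sqrt (n%:~R ^+ 2 + 1))%:C *
  (fcoef (top_ phi) n * conjc (fcoef (top_ psi) n) +
   fcoef (bot_ phi) n * conjc (fcoef (bot_ psi) n)).

Definition star_ip (phi psi : H1per) : R[i] :=
  cint mu_cell (fun x => d1_ phi x * conjc (d1_ psi x) +
                         d2_ phi x * conjc (d2_ psi x)) +
  (2 * pi)%:C * sumZ (star_term phi psi).

Definition star_norm (phi : H1per) : R := Num.sqrt (Re (star_ip phi phi)).

Definition H1norm (phi : H1per) : R :=
  Num.sqrt (\int[mu_cell]_x
    (normc (u_ phi x) ^+ 2 + normc (d1_ phi x) ^+ 2 + normc (d2_ phi x) ^+ 2)).

(* [star_ip] is defined by a convergent series and its norm is equivalent to the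
   norm of H^1 *)
Definition star_norm_equiv : Prop :=
  (forall phi, cvgn (fun N => Re (psumZ (star_term phi phi) N))) /\
  exists c C : R, [/\ 0 < c, 0 < C &
    forall phi, c * H1norm phi <= star_norm phi <= C * H1norm phi].

(* argument in ]-pi/4, 3pi/4], that is Re + Im > 0, or Re + Im = 0 <= Im when [w]
   lies on the cut {- i t, t >= 0} *)
Definition branch_sqrt (w : R[i]) : R[i] :=
  let z := sqrtc w in
  if (0 < Re z + Im z) || ((Re z + Im z == 0) && (0 <= Im z)) then z else - z.

Definition beta (k : R) (alpha : R[i]) (n : int) : R[i] :=
  branch_sqrt ((k ^+ 2)%:C - (alpha + (2 * pi * n%:~R / Lam)%:C) ^+ 2).

Definition a_form (k : R) (gamma : R * R -> R) (alpha : R[i])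
    (phi psi : H1per) : R[i] :=
  cint mu_cell (fun x =>
    d1_ phi x * conjc (d1_ psi x) + d2_ phi x * conjc (d2_ psi x)
    - 2%:R * (0 +i* 1) * alpha * d1_ phi x * conjc (u_ psi x)
    - ((k ^+ 2 * gamma x)%:C - alpha ^+ 2) * u_ phi x * conjc (u_ psi x))
  - sumZ (fun n => (0 +i* 1) * Lam%:C * beta k alpha n *
      (fcoef (top_ phi) n * conjc (fcoef (top_ psi) n) +
       fcoef (bot_ phi) n * conjc (fcoef (bot_ psi) n))).

End Plane.

Section Operators.
Context {R : realType} {V : lmodType R[i]}.
Variable nrm : V -> R.
Implicit Types (T : V -> V) (F : R[i] -> V -> V).

Definition ker T : set V := [set v | T v = 0].

Definition bounded_linear T : Prop :=
  linear T /\ exists C : R, forall v, nrm (T v) <= C * nrm v.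

Definition opnorm T : R := sup [set nrm (T v) | v in [set v | nrm v <= 1]].

Definition is_inverse T T' : Prop :=
  [/\ bounded_linear T', cancel T T' & cancel T' T].

Definition op_invertible T : Prop := exists T', is_inverse T T'.

(* inverses, circle integrals and traces are unique when they exist; by
   convention they are 0 otherwise *)
Definition op_inv T : V -> V := xget (fun=> 0) [set T' | is_inverse T T'].

(* complex derivative in operator norm *)
Definition op_derivative F (z : R[i]) T' : Prop :=
  bounded_linear T' /\
  forall e : R, 0 < e -> exists2 d : R, 0 < d & forall w, 0 < normc (w - z) < d ->
    forall v, nrm ((w - z)^-1 *: (F w v - F z v) - T' v) <= e * nrm v.

(* complex differentiability on a neighbourhood of [K] *)
Definition holomorphic_on (K : set R[i]) F : Prop :=
  forall z, K z -> exists2 rho : R, 0 < rho & forall w, normc (w - z) < rho ->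
    bounded_linear (F w) /\ exists T', op_derivative F w T'.

Definition lin_indep n (b : 'I_n -> V) : Prop :=
  forall c : 'I_n -> R[i], \sum_i c i *: b i = 0 -> forall i, c i = 0.

Definition spans n (b : 'I_n -> V) (W : set V) : Prop :=
  W = [set v | exists c : 'I_n -> R[i], v = \sum_i c i *: b i].

Definition finite_dim (W : set V) : Prop := exists n (b : 'I_n -> V), spans b W.

Definition has_dim (W : set V) (n : nat) : Prop :=
  exists b : 'I_n -> V, lin_indep b /\ spans b W.

Definition subspace (W : set V) : Prop :=
  W 0 /\ forall (a : R[i]) u v, W u -> W v -> W (a *: u + v).

Definition direct_complement (C W : set V) : Prop :=
  [/\ subspace W, C `&` W = [set 0] & forall v, exists u w, [/\ C u, W w & v = u + w]].

(* [A] is the matrix, in a basis [b] of the invariant subspace [C], of the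
   restriction of [T] to [C]; [T] vanishes on the complement [W] *)
Definition has_trace T (t : R[i]) : Prop :=
  exists n (b : 'I_n -> V) (C W : set V) (A : 'M[R[i]]_n),
    [/\ lin_indep b, spans b C, direct_complement C W /\ (forall w, W w -> T w = 0),
        forall j, T (b j) = \sum_i A i j *: b i & t = \tr A].

Definition op_trace T : R[i] := xget 0 [set t | has_trace T t].

Definition tagged_partition (N : nat) (t s : nat -> R) (d : R) : Prop :=
  [/\ t 0%N = 0, t N = 2 * pi &
      forall i, (i < N)%N -> t i <= s i <= t i.+1 /\ t i.+1 - t i < d].

Definition circle_sum F (a : R[i]) (r : R) (N : nat) (t s : nat -> R) (v : V) : V :=
  \sum_(i < N) ((t i.+1 - t i)%:C * ((0 +i* 1) * r%:C * expi (s i))) *: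
    F (a + r%:C * expi (s i)) v.

(* norm-convergent Riemann integral along [s |-> a + r * expi s], 0 <= s <= 2 pi *)
Definition is_circle_integral F (a : R[i]) (r : R) T : Prop :=
  bounded_linear T /\
  forall e : R, 0 < e -> exists2 d : R, 0 < d & forall N t s, tagged_partition N t s d ->
    forall v, nrm (circle_sum F a r N t s v - T v) <= e * nrm v.

Definition circle_integral F (a : R[i]) (r : R) : V -> V :=
  xget (fun=> 0) [set T | is_circle_integral F a r T].

Definition odisk (a : R[i]) (r : R) : set R[i] := [set z | normc (z - a) < r].
Definition cdisk (a : R[i]) (r : R) : set R[i] := [set z | normc (z - a) <= r].
Definition circle (a : R[i]) (r : R) : set R[i] := [set z | normc (z - a) = r].

Definition projection T : Prop := bounded_linear T /\ forall v, T (T v) = T v.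

Definition rank_one T : Prop := has_dim (range T) 1.

Record local_factorization (D : R[i] -> V -> V) (a : R[i]) (rho : R) (n : nat)
    (r : 'I_n -> nat) (E F : R[i] -> V -> V)
    (Pran : V -> V) (Pker : 'I_n -> V -> V) : Prop := LocalFactorization {
  lf_holE : holomorphic_on (odisk a rho) E;
  lf_holF : holomorphic_on (odisk a rho) F;
  lf_invE : forall z, odisk a rho z -> op_invertible (E z);
  lf_invF : forall z, odisk a rho z -> op_invertible (F z);
  lf_projR : projection Pran;
  lf_projK : forall i, projection (Pker i);
  lf_disjRK : forall i v, Pran (Pker i v) = 0 /\ Pker i (Pran v) = 0;
  lf_disjKK : forall i i' v, i != i' -> Pker i (Pker i' v) = 0;
  lf_sum : forall v, Pran v + \sum_i Pker i v = v;
  lf_rank1 : forall i, rank_one (Pker i);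
  lf_range : forall i, range (Pker i) `<=` ker (D a);
  lf_dim : has_dim (ker (D a)) n;
  lf_sorted : forall i i' : 'I_n, (i <= i')%N -> (r i' <= r i)%N;
  lf_pos : forall i, (1 <= r i)%N;
  lf_eq : forall z, odisk a rho z -> forall v,
    D z v = E z (Pran (F z v) + \sum_i (z - a) ^+ r i *: Pker i (F z v)) }.

Definition Hprod (D : R[i] -> V -> V) p (S : 'I_p -> R[i] -> V -> V)
    (z : R[i]) : V -> V :=
  \big[(fun f g : V -> V => f \o g)/idfun]_(i < p) (op_inv (D z) \o S i z).

(* a maximum over a compact circle, for continuous operator norms *)
Definition max_circle F (a : R[i]) (r : R) : R :=
  sup [set opnorm (F z) | z in circle a r].

(* [inf] and [sup] over the finite nonempty [J] are the minimum and maximum *)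
Definition delta_PML (J : finType) (delta : J -> R) (M : R) : R :=
  inf (range delta) / M.

Definition C_PML (D : R[i] -> V -> V) (J : finType) (alpha delta : J -> R) (M : R) : R :=
  sup [set max_circle (fun z => op_inv (D z)) (alpha j)%:C (delta_PML delta M) | j in setT].

End Operators.

Section WaveNumbers.
Context {R : realType}.

Definition cutoffs (Lam k : R) : set R :=
  [set a | - (pi / Lam) <= a <= pi / Lam /\
           exists m : int, k = `|a + 2 * pi * m%:~R / Lam| ].

Definition propagative (Lam : R) (V : lmodType R[i]) (D : R[i] -> V -> V) : set R :=
  [set a | - (pi / Lam) <= a <= pi / Lam /\ ker (D a%:C) <> [set 0] ].

End WaveNumbers.

(* Main.v *)
(* Write [R z] for the inverse of [D (a + z)].  Acting on functionals,
   [phi |-> phi \o R z] splits into its principal part [K z] at 0 and a remainder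
   [A z] that is bounded near 0.  By the factorization, the pole has order at most
   [r_0 = r ord0] (the largest of the [r_i]) and [K z] has rank at most
   [m = \sum_i r_i].  On the circle |z| = rho, the Cauchy estimates bound [R z],
   [K z] and [A z] by [C], [r_0 C] and [(1 + r_0) C].
   Replace in [H = R S_1 ... R S_p] the factors [R] by [A] one after the other.
   The product of the [A S_i] is holomorphic in the punctured disk and bounded, so
   its integral vanishes.  Each of the telescoping differences contains a factor [K],
   hence has rank at most [m], and its trace is at most [m] times its norm, since
   every eigenvalue is bounded by the norm.  Summing up, the trace of the integral,
   divided by [2 pi i], is at most
   [m rho ((1 + r_0)^p - 1) C^p] times the product of the norms of the [S_i].
   Traces are computed in a basis of the invariant subspace, with the dual basis of
   functionals given by the Gram matrix of the inner product; this requires the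
   inner product on [H1per] to be definite, that is, the trace of a null function
   to be null. *)

From Pilot Require Import Defs.
From mathcomp Require Import all_boot all_order all_algebra.
From mathcomp Require Import all_classical all_reals all_analysis measurable_realfun.
From mathcomp Require Import ring lra.
From mathcomp.real_closed Require Import complex.

Set Implicit Arguments.
Unset Strict Implicit.
Unset Printing Implicit Defensive.

Import Order.TTheory GRing.Theory Num.Theory.
Import numFieldNormedType.Exports.

Local Open Scope classical_set_scope.
Local Open Scope ring_scope.
Local Open Scope complex_scope.

Import Pilot.Defs.

(** [H1per] is nowhere shown to be complete, so the Laurent coefficients of [R z] are not formed as
    operators by integration. Paired with a functional and a vector they become scalar contour
    integrals. This is why [K z] and [A z] act on functionals, and why the function theory,
    developed from Goursat's theorem on, concerns scalar functions. The circle integral of operators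
    enters through its Riemann sums, to which a functional is applied. The product of the [A S_i]
    must be bounded near 0, so each [A z] has to be bounded uniformly in the functional and the
    vector. The factorization gives a bound for each fixed pair only; the Cauchy estimate on |z| =
    rho makes it uniform. The constants arise at the end: 1 + r_0 <= 2^(r_0) gives (1 + r_0)^p <=
    2^(r_0 p), and for p >= 1 the additional factor 4^p outweighs the 1/2 in [C1]. A trace or an
    integral that does not exist is 0 by convention; the estimate has content when both exist. *)

Section Modulus.
Context {R : realType}.
Implicit Types x y z : R[i].

Lemma normc_ge0 x : 0 <= normc x.
Proof. by case: x => a b; exact: sqrtr_ge0. Qed.

Lemma normcM x y : normc (x * y) = normc x * normc y.
Proof. exact: ComplexField.Normc.normcM. Qed.

Lemma normcD x y : normc (x + y) <= normc x + normc y.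
Proof. exact: le_normcD. Qed.

Lemma normcN x : normc (- x) = normc x.
Proof. exact: normcN. Qed.

Lemma normcB x y : normc (x - y) <= normc x + normc y.
Proof. by rewrite -(normcN y); exact: normcD. Qed.

Lemma normc_distrC x y : normc (x - y) = normc (y - x).
Proof. by rewrite -normcN opprB. Qed.

Lemma normc_le_distD y x z : normc (x - z) <= normc (x - y) + normc (y - z).
Proof. by rewrite (_ : x - z = (x - y) + (y - z)) ?normcD//; ring. Qed.

Lemma normc0 : normc (0 : R[i]) = 0.
Proof. exact: ComplexField.Normc.normc0. Qed.

Lemma normc1 : normc (1 : R[i]) = 1.
Proof. exact: ComplexField.Normc.normc1. Qed.

Lemma normc_eq0 x : (normc x == 0) = (x == 0).
Proof.
apply/eqP/eqP => [|->]; last exact: normc0.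
exact: ComplexField.Normc.eq0_normc.
Qed.

Lemma normc_gt0 x : (0 < normc x) = (x != 0).
Proof. by rewrite lt_neqAle normc_ge0 andbT eq_sym normc_eq0. Qed.

Lemma normcV x : normc x^-1 = (normc x)^-1.
Proof. exact: ComplexField.Normc.normcV. Qed.

Lemma normcX x n : normc (x ^+ n) = normc x ^+ n.
Proof. by elim: n => [|n IH]; rewrite ?expr0 ?normc1// !exprS normcM IH. Qed.

Lemma normcR (a : R) : normc a%:C = `|a|.
Proof. by rewrite /= expr0n /= addr0 sqrtr_sqr. Qed.

Lemma normc_sum n (F : 'I_n -> R[i]) : normc (\sum_i F i) <= \sum_i normc (F i).
Proof.
elim/big_ind2: _ => //; first by rewrite normc0.
by move=> a b c e ab ce; apply: le_trans (normcD _ _) (lerD ab ce).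
Qed.

Lemma normc_Re x : `|Re x| <= normc x.
Proof.
by case: x => a b /=; rewrite -sqrtr_sqr ler_wsqrtr// lerDl sqr_ge0.
Qed.

Lemma normc_Im x : `|Im x| <= normc x.
Proof.
by case: x => a b /=; rewrite -sqrtr_sqr ler_wsqrtr// lerDr sqr_ge0.
Qed.

Lemma normc_sqr x : normc x ^+ 2 = Re x ^+ 2 + Im x ^+ 2.
Proof. by case: x => a b /=; rewrite sqr_sqrtr// addr_ge0// sqr_ge0. Qed.

Lemma normc_le_ReIm x : normc x <= `|Re x| + `|Im x|.
Proof.
rewrite -(@ler_pXn2r _ 2)// ?nnegrE ?normc_ge0 ?addr_ge0//.
rewrite normc_sqr sqrrD !real_normK ?num_real// lerD2r lerDl.
by rewrite mulrn_wge0// mulr_ge0.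
Qed.

Lemma normc_i : normc (0 +i* 1 : R[i]) = 1.
Proof. by rewrite /= expr0n /= expr1n add0r sqrtr1. Qed.

Lemma normc_conj x : normc (conjc x) = normc x.
Proof. by case: x => a b /=; rewrite sqrrN. Qed.

Lemma mulc_conj x : x * conjc x = (normc x ^+ 2)%:C.
Proof.
rewrite normc_sqr; case: x => a b; apply/eqP; rewrite eq_complex /=.
by apply/andP; split; apply/eqP; ring.
Qed.

Lemma normc_expi (t : R) : normc (expi t) = 1.
Proof. by rewrite /= cos2Dsin2 sqrtr1. Qed.

Lemma expiD (s t : R) : expi (s + t) = expi s * expi t.
Proof.
by rewrite /expi cosD sinD; apply/eqP; rewrite eq_complex /= eqxx; apply/eqP; ring.
Qed.

Lemma rC_eq0 (a : R) : (a%:C == 0 :> R[i]) = (a == 0).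
Proof. by rewrite eq_complex /= eqxx andbT. Qed.

Lemma rCB (a b : R) : (a - b)%:C = a%:C - b%:C :> R[i].
Proof. exact: rmorphB. Qed.
Lemma rCM (a b : R) : (a * b)%:C = a%:C * b%:C :> R[i].
Proof. exact: rmorphM. Qed.

End Modulus.

(* Cousin's lemma for rectangles [a, a + h L1] x [c, c + h L2] of a fixed shape;
   L2 = 0 gives the version for intervals. *)
Lemma rectangle_cousin (R : realType) (P : R -> R -> R -> Prop) (a0 c0 L1 L2 : R) :
  0 <= L1 -> 0 <= L2 ->
  (forall a c h, 0 < h ->
     P a c (h / 2) -> P (a + h / 2 * L1) c (h / 2) ->
     P a (c + h / 2 * L2) (h / 2) -> P (a + h / 2 * L1) (c + h / 2 * L2) (h / 2) ->
     P a c h) ->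
  (forall x y, a0 <= x <= a0 + L1 -> c0 <= y <= c0 + L2 ->
     exists2 d : R, 0 < d & forall a c h, 0 < h < d ->
       a0 <= a -> a + h * L1 <= a0 + L1 -> c0 <= c -> c + h * L2 <= c0 + L2 ->
       a <= x <= a + h * L1 -> c <= y <= c + h * L2 -> P a c h) ->
  P a0 c0 1.
Proof.
move=> L10 L20 split local; apply: contrapT => nP.
pose st := (R * R)%type.
(* If [P] fails on a rectangle, then by [split] it fails on one of its four half-scale parts. The
   conclusion is an implication, so that it holds for every state and yields a choice function to
   iterate. *)
have step (q : st * R) : exists q' : st * R,
   0 < q.2 -> ~ P q.1.1 q.1.2 q.2 ->
   [/\ q'.2 = q.2 / 2, ~ P q'.1.1 q'.1.2 q'.2,
      q.1.1 <= q'.1.1, q'.1.1 + q'.2 * L1 <= q.1.1 + q.2 * L1 &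
      q.1.2 <= q'.1.2 /\ q'.1.2 + q'.2 * L2 <= q.1.2 + q.2 * L2].
  case: q => [[a c] h] /=.
  have [h0|] := ltP 0 h; last by move=> h0; exists ((a, c), h).
  have hL1 : 0 <= h * L1 by rewrite mulr_ge0// ltW.
  have hL2 : 0 <= h * L2 by rewrite mulr_ge0// ltW.
  have e1 : h / 2 * L1 = h * L1 / 2 by ring.
  have e2 : h / 2 * L2 = h * L2 / 2 by ring.
  case: (pselect (P a c (h / 2))) => p1; last first.
    by exists ((a, c), h / 2) => _ _ /=; split=> //; rewrite ?e1 ?e2; try split; lra.
  case: (pselect (P (a + h / 2 * L1) c (h / 2))) => p2; last first.
    by exists ((a + h / 2 * L1, c), h / 2) => _ _ /=; split=> //; rewrite ?e1 ?e2; try split; lra.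
  case: (pselect (P a (c + h / 2 * L2) (h / 2))) => p3; last first.
    by exists ((a, c + h / 2 * L2), h / 2) => _ _ /=; split=> //; rewrite ?e1 ?e2; try split; lra.
  case: (pselect (P (a + h / 2 * L1) (c + h / 2 * L2) (h / 2))) => p4; last first.
    by exists ((a + h / 2 * L1, c + h / 2 * L2), h / 2) => _ _ /=; split=> //; rewrite ?e1 ?e2; try split; lra.
  by exists ((a, c), h) => _ n; exfalso; apply: n; exact: split.
have {step} [f fP] := choice step.
pose q n := iter n f ((a0, c0), 1 : R).
have qP n : (q n).2 = 2^-1 ^+ n /\ ~ P (q n).1.1 (q n).1.2 (q n).2.
  elim: n => [|n [e nPn]]; first by rewrite /q /= expr0.
  have h0 : 0 < (q n).2 by rewrite e exprn_gt0// invr_gt0.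
  have [e' nP' _ _ _] := fP (q n) h0 nPn.
  by split=> //; rewrite /q iterS e' e exprSr.
have qS n : [/\ (q n).1.1 <= (q n.+1).1.1,
   (q n.+1).1.1 + (q n.+1).2 * L1 <= (q n).1.1 + (q n).2 * L1,
   (q n).1.2 <= (q n.+1).1.2 &
   (q n.+1).1.2 + (q n.+1).2 * L2 <= (q n).1.2 + (q n).2 * L2].
  have [e nPn] := qP n.
  have h0 : 0 < (q n).2 by rewrite e exprn_gt0// invr_gt0.
  by have [_ _ ? ? []] := fP (q n) h0 nPn.
have h0 n : 0 < (q n).2 by have [-> _] := qP n; rewrite exprn_gt0// invr_gt0.
have mono n m : (n <= m)%N -> [/\ (q n).1.1 <= (q m).1.1,
   (q m).1.1 + (q m).2 * L1 <= (q n).1.1 + (q n).2 * L1,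
   (q n).1.2 <= (q m).1.2 &
   (q m).1.2 + (q m).2 * L2 <= (q n).1.2 + (q n).2 * L2].
  move=> /subnKC <-; elim: (m - n)%N => [|k [i1 i2 i3 i4]]; first by rewrite addn0.
  rewrite addnS; have [j1 j2 j3 j4] := qS (n + k)%N.
  by split; [exact: le_trans i1 j1|exact: le_trans j2 i2|exact: le_trans i3 j3|exact: le_trans j4 i4].
have sandwich (u : nat -> R) (v : nat -> R) :
   (forall n m, (n <= m)%N -> u n <= u m /\ v m <= v n) -> (forall n, u n <= v n) ->
   exists x, forall n, u n <= x <= v n.
  move=> uv le; exists (sup (range u)) => n.
  have ub m : ubound (range u) (v m).
    move=> _ [k _ <-]; have [? ?] := uv _ _ (leq_maxl k m); have [? ?] := uv _ _ (leq_maxr k m).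
    by have := le (maxn k m); lra.
  apply/andP; split; first by apply: ub_le_sup; [by exists (v 0%N)|by exists n].
  by apply: ge_sup; [by exists (u 0%N), 0%N|].
have [x xP] : exists x, forall n, (q n).1.1 <= x <= (q n).1.1 + (q n).2 * L1.
  apply: sandwich => [n m /mono[]//|n].
  by rewrite lerDl mulr_ge0// ltW.
have [y yP] : exists x, forall n, (q n).1.2 <= x <= (q n).1.2 + (q n).2 * L2.
  apply: sandwich => [n m /mono[]//|n].
  by rewrite lerDl mulr_ge0// ltW.
have := xP 0%N; have := yP 0%N; rewrite /q /= !mul1r => y0 x0.
have [d d0 dP] := local x y x0 y0.
have [n nd] : exists n, 2^-1 ^+ n < d :> R.
  have : (fun n => 2^-1 ^+ n : R) @ \oo --> (0 : R).
    by apply: cvg_expr; rewrite ger0_norm ?invr_ge0// invf_lt1// ltr1n.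
  move=> /cvgrPdist_lt /(_ d d0) [n _ /(_ n (leqnn n))] /=.
  by rewrite sub0r normrN ger0_norm ?exprn_ge0 ?invr_ge0//; exists n.
have [e nPn] := qP n; apply: nPn.
have [m1 m2 m3 m4] := mono 0%N n (leq0n n); rewrite /q /= !mul1r in m1 m2 m3 m4.
by apply: dP => //; rewrite h0 e.
Qed.

(** This is the compactness argument of what follows: uniform continuity, boundedness on a circle
    and continuity of circle integrals in the radius are all inherited by a union of adjacent
    intervals and clear on short ones. *)
Lemma interval_cousin (R : realType) (P : R -> R -> Prop) (a b : R) : a < b ->
  (forall x c y, x <= c -> c <= y -> P x c -> P c y -> P x y) ->
  (forall x, a <= x <= b -> exists2 d : R, 0 < d & forall s t,
      a <= s -> t <= b -> s <= x <= t -> t - s < d -> P s t) ->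
  P a b.
Proof.
move=> ab add local.
have ab' : a + (b - a) = b by ring.
suff : P a (a + 1 * (b - a)) by rewrite mul1r ab'.
have ba0 : 0 < b - a by rewrite subr_gt0.
(* With [L2 = 0] only the first coordinate moves; [h] is the length relative to [b - a]. *)
apply: (@rectangle_cousin R (fun s _ h => P s (s + h * (b - a))) a 0 (b - a) 0 (ltW ba0) (lexx 0)).
- move=> s c h h0 p1 p2 _ _; have hb : 0 < h / 2 * (b - a) by rewrite mulr_gt0// divr_gt0.
  have e : s + h * (b - a) = s + h / 2 * (b - a) + h / 2 * (b - a) by field.
  by rewrite e; apply: (add _ (s + h / 2 * (b - a))); rewrite // lerDl ltW.
- move=> x y; rewrite ab' => xab _; have [d d0 dP] := local x xab.
  exists (d / (b - a)); first by rewrite divr_gt0.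
  move=> s c h /andP[h0 hd] as_ sb _ _ xs _.
  by apply: dP => //; rewrite (addrC s) addrK -ltr_pdivlMr.
Qed.

(** * Integrals of continuous complex functions over an interval *)

Section PathIntegral.
Context {R : realType}.
Implicit Types (f g : R -> R[i]) (a b c x y : R).

(** Written with the real modulus [normc], so that all estimates are inequalities in [R]; the same
    holds for [cct] and [dif_at]. *)
Definition ct f x : Prop := forall e : R, 0 < e -> exists2 d : R, 0 < d &
  forall y, `|y - x| < d -> normc (f y - f x) < e.

Definition ct_on a b f : Prop := forall x, a <= x <= b -> ct f x.

Definition cI a b f : R[i] :=
  (\int[lebesgue_measure]_(x in `[a, b]) Re (f x))%R +i*
  (\int[lebesgue_measure]_(x in `[a, b]) Im (f x))%R.

Lemma ct_lin (u : R[i]) f g x : ct f x -> ct g x -> ct (fun t => u * f t + g t) x.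
Proof.
move=> cf cg e e0; have u0 := normc_ge0 u.
have [d1 d10 h1] := cf (e / 2 / (1 + normc u)) (ltac:(by rewrite !divr_gt0// ltr_wpDr)).
have [d2 d20 h2] := cg (e / 2) (ltac:(by rewrite !divr_gt0// ltr_wpDr)).
exists (Num.min d1 d2); first by rewrite lt_min d10.
move=> y; rewrite lt_min => /andP[/h1 y1 /h2 y2].
rewrite (_ : _ - _ = u * (f y - f x) + (g y - g x)); last by ring.
apply: le_lt_trans (normcD _ _) _; rewrite normcM (splitr e) ler_ltD//.
apply: (@le_trans _ _ (normc u * (e / 2 / (1 + normc u)))); first by rewrite ler_wpM2l// ltW.
rewrite mulrCA ler_piMr//; first by rewrite divr_ge0// ltW.
by rewrite ler_pdivrMr ?ltr_wpDr// mul1r lerDr.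
Qed.

Lemma ct_cst (u : R[i]) x : ct (fun=> u) x.
Proof. by move=> e e0; exists 1 => // y _; rewrite subrr normc0. Qed.

Lemma ct_scale (u : R[i]) f x : ct f x -> ct (fun t => u * f t) x.
Proof.
move=> cf; have := ct_lin u cf (@ct_cst 0 x).
by rewrite (_ : (fun t => _ + _) = (fun t => u * f t))//; apply/funext => t; rewrite addr0.
Qed.

Lemma ctD f g x : ct f x -> ct g x -> ct (fun t => f t + g t) x.
Proof.
move=> cf cg; have := ct_lin 1 cf cg.
by rewrite (_ : (fun t => _ + _) = (fun t => f t + g t))//; apply/funext => t; rewrite mul1r.
Qed.

Lemma ctB f g x : ct f x -> ct g x -> ct (fun t => f t - g t) x.
Proof.
move=> cf cg; have := ct_lin (-1) cg cf.
by rewrite (_ : (fun t => _ + _) = (fun t => f t - g t))//; apply/funext => t; ring.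
Qed.

Lemma ct_sum (I : Type) (s : seq I) (F : I -> R -> R[i]) x :
  (forall i, ct (F i) x) -> ct (fun t => \sum_(i <- s) F i t) x.
Proof.
move=> cF; elim: s => [|i s IH].
  by rewrite (_ : (fun t => _) = (fun=> 0)); [exact: ct_cst|apply/funext => t; rewrite big_nil].
rewrite (_ : (fun t => _) = (fun t => F i t + \sum_(i <- s) F i t)); first exact: ctD.
by apply/funext => t; rewrite big_cons.
Qed.

Lemma ct_mul f g x : ct f x -> ct g x -> ct (fun t => f t * g t) x.
Proof.
move=> cf cg e e0.
pose k := 1 + normc (f x) + normc (g x).
have fx0 := normc_ge0 (f x); have gx0 := normc_ge0 (g x).
have k0 : 0 < k by rewrite /k; lra.
pose e' := Num.min 1 (e / 3 / k).
have e'0 : 0 < e' by rewrite lt_min ltr01 !divr_gt0.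
have [d1 d10 h1] := cf e' e'0.
have [d2 d20 h2] := cg e' e'0.
exists (Num.min d1 d2); first by rewrite lt_min d10.
move=> y; rewrite lt_min => /andP[/h1 y1 /h2 y2].
rewrite (_ : _ - _ = (f y - f x) * (g y - g x) + f x * (g y - g x) + (f y - f x) * g x); last by ring.
have e1 : e' <= 1 by rewrite ge_min lexx.
have e2 : e' * k <= e / 3 by rewrite -ler_pdivlMr// ge_min lexx orbT.
have n1 := normc_ge0 (f y - f x); have n2 := normc_ge0 (g y - g x).
apply: le_lt_trans (normcD _ _) _; apply: (@le_lt_trans _ _ (normc ((f y - f x) * (g y - g x)) + normc (f x * (g y - g x)) + normc ((f y - f x) * g x))).
  by rewrite lerD2r normcD.
rewrite !normcM.
have : normc (f y - f x) * normc (g y - g x) <= e' * 1.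
  by apply: ler_pM => //; [exact: ltW|exact: le_trans (ltW y2) e1].
have : normc (f x) * normc (g y - g x) <= normc (f x) * e' by rewrite ler_wpM2l// ltW.
have : normc (f y - f x) * normc (g x) <= e' * normc (g x) by rewrite ler_wpM2r// ltW.
move: e2; rewrite /k; lra.
Qed.

Lemma ct_ReIm f x : ct f x ->
  {for x, continuous (fun t => Re (f t))} /\ {for x, continuous (fun t => Im (f t))}.
Proof.
move=> cf; split; apply/cvgrPdist_lt => e e0; have [d d0 h] := cf e e0;
  apply/nbhs_ballP; exists d => //= y; rewrite /ball /= => /[!distrC x y] /h; apply: le_lt_trans.
- by rewrite -(normc_distrC (f x)) (_ : _ - _ = Re (f x - f y)) ?normc_Re//; case: (f x) (f y) => [? ?] [].
- by rewrite -(normc_distrC (f x)) (_ : _ - _ = Im (f x - f y)) ?normc_Im//; case: (f x) (f y) => [? ?] [].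
Qed.

Lemma ct_integrable a b f : ct_on a b f ->
  lebesgue_measure.-integrable `[a, b] (EFin \o (fun x => Re (f x))) /\
  lebesgue_measure.-integrable `[a, b] (EFin \o (fun x => Im (f x))).
Proof.
move=> cf; split; apply: continuous_compact_integrable; try exact: segment_compact.
- by apply: continuous_in_subspaceT => x /set_mem/=; rewrite in_itv/= => /cf /ct_ReIm[].
- by apply: continuous_in_subspaceT => x /set_mem/=; rewrite in_itv/= => /cf /ct_ReIm[].
Qed.

Lemma cI_ext a b f g : (forall x, a <= x <= b -> f x = g x) -> cI a b f = cI a b g.
Proof.
move=> fg; rewrite /cI; congr (_ +i* _); apply: eq_Rintegral => x /set_mem/=;
  by rewrite in_itv/= => /fg ->.
Qed.

Let int_lin a b (u v : R) (h k : R -> R) :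
  lebesgue_measure.-integrable `[a, b] (EFin \o h) ->
  lebesgue_measure.-integrable `[a, b] (EFin \o k) ->
  lebesgue_measure.-integrable `[a, b] (EFin \o (fun x => u * h x + v * k x)) /\
    (\int[lebesgue_measure]_(x in `[a, b]) (u * h x + v * k x) =
    u * \int[lebesgue_measure]_(x in `[a, b]) h x + v * \int[lebesgue_measure]_(x in `[a, b]) k x)%R.
Proof.
move=> ih ik.
have mD : measurable (`[a, b] : set (measurableTypeR R)) by exact: measurable_itv.
have ih' := integrableZl mD u ih.
have ik' := integrableZl mD v ik.
split; first exact: (integrableD mD ih' ik').
by rewrite RintegralD// !RintegralZl.
Qed.

Lemma cI_lin a b (u : R[i]) f g : ct_on a b f -> ct_on a b g ->
  cI a b (fun t => u * f t + g t) = u * cI a b f + cI a b g.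
Proof.
move=> /ct_integrable[f1 f2] /ct_integrable[g1 g2].
have [i1 E1] := int_lin (Re u) (- Im u) f1 f2.
have [i2 E2] := int_lin (Re u) (Im u) f2 f1.
have [_ E3] := int_lin 1 1 i1 g1.
have [_ E4] := int_lin 1 1 i2 g2.
rewrite /cI.
have ReE (z w : R[i]) : Re (u * z + w) = 1 * (Re u * Re z + (- Im u) * Im z) + 1 * Re w.
  by rewrite ReD ReM; ring.
have ImE (z w : R[i]) : Im (u * z + w) = 1 * (Re u * Im z + Im u * Re z) + 1 * Im w.
  by rewrite ImD ImM; ring.
under eq_Rintegral do rewrite ReE.
under [in X in _ +i* X]eq_Rintegral do rewrite ImE.
rewrite E3 E4 E1 E2; apply/eqP; rewrite eq_complex; apply/andP; split; apply/eqP.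
- by rewrite ReD ReM /=; ring.
- by rewrite ImD ImM /=; ring.
Qed.

Lemma cI_cst a b (u : R[i]) : a <= b -> cI a b (fun=> u) = (b - a)%:C * u.
Proof.
move=> ab; have mD : measurable (`[a, b] : set (measurableTypeR R)) by exact: measurable_itv.
rewrite /cI !Rintegral_cst//.
have -> : fine (lebesgue_measure (`[a, b] : set (measurableTypeR R))) = b - a.
  rewrite lebesgue_measure_itv /=; case: ltP => [_|ba]; first by rewrite -EFinB.
  by rewrite (@le_anti _ _ a b) ?subrr// ab -lee_fin.
by case: u => p q; apply/eqP; rewrite eq_complex /= !mul0r subr0 addr0 ![_ * (b - a)]mulrC !eqxx.
Qed.

Lemma cI_scale a b (u : R[i]) f : a <= b -> ct_on a b f -> cI a b (fun t => u * f t) = u * cI a b f.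
Proof.
move=> ab cf; rewrite -[RHS]addr0 -[X in _ + X](mulr0 (b - a)%:C) -(cI_cst _ ab).
rewrite -cI_lin => [|//|x _]; last exact: ct_cst.
by apply: cI_ext => x _; rewrite addr0.
Qed.

Lemma cID a b f g : ct_on a b f -> ct_on a b g ->
  cI a b (fun t => f t + g t) = cI a b f + cI a b g.
Proof.
move=> cf cg; rewrite -[X in _ = X + _]mul1r -cI_lin//.
by apply: cI_ext => x _; rewrite mul1r.
Qed.

Lemma cIB a b f g : ct_on a b f -> ct_on a b g ->
  cI a b (fun t => f t - g t) = cI a b f - cI a b g.
Proof.
move=> cf cg; rewrite -[RHS]addrC -mulN1r -cI_lin//.
by apply: cI_ext => x _; rewrite mulN1r addrC.
Qed.

Lemma cI_sum a b (I : Type) (s : seq I) (F : I -> R -> R[i]) : a <= b ->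
  (forall i, ct_on a b (F i)) ->
  cI a b (fun t => \sum_(i <- s) F i t) = \sum_(i <- s) cI a b (F i).
Proof.
move=> ab cF; elim: s => [|i s IH].
  rewrite big_nil -[RHS](mulr0 (b - a)%:C) -(cI_cst _ ab).
  by apply: cI_ext => x _; rewrite big_nil.
rewrite big_cons -IH -cID//; last by move=> x xab; apply: ct_sum => j; exact: cF.
by apply: cI_ext => x _; rewrite big_cons.
Qed.

Lemma cI_split a b c f : a <= c -> c <= b -> ct_on a b f ->
  cI a b f = cI a c f + cI c b f.
Proof.
move=> ac cb /ct_integrable[f1 f2].
have S (h : R -> R) : lebesgue_measure.-integrable `[a, b] (EFin \o h) ->
   (\int[lebesgue_measure]_(x in `[a, b]) h x = \int[lebesgue_measure]_(x in `[a, c]) h x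
     + \int[lebesgue_measure]_(x in `[c, b]) h x)%R.
  move=> ih; have := Rintegral_itvB ih.
  move=> /(_ c); rewrite !bnd_simp => /(_ ac cb) /eqP; rewrite subr_eq => /eqP ->.
  rewrite addrC Rintegral_itv_obnd_cbnd//.
  have m1 : measurable (`[a, b] : set (measurableTypeR R)) by exact: measurable_itv.
  have m2 : measurable (`]c, b] : set (measurableTypeR R)) by exact: measurable_itv.
  apply: (integrableS m1 m2 _ ih).
  by move=> x /=; rewrite !in_itv/= => /andP[/ltW cx ->]; rewrite (le_trans ac cx).
by rewrite /cI !S//; apply/eqP; rewrite eq_complex /= !eqxx.
Qed.

(** Rotation: if I is the integral, |I|^2 is the real part of the integral of [conjc I * f], whose
    real part is at most |I| M pointwise. A factor |I| is then cancelled. *)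
Lemma cI_bound a b f (M : R) : a <= b -> ct_on a b f ->
  (forall x, a <= x <= b -> normc (f x) <= M) -> normc (cI a b f) <= (b - a) * M.
Proof.
move=> ab cf fM; set I := cI a b f.
have M0 : 0 <= M by apply: le_trans (normc_ge0 _) (fM a _); rewrite lexx.
have [->|I0] := eqVneq I 0; first by rewrite normc0 mulr_ge0// subr_ge0.
have E : ((normc I ^+ 2)%:C : R[i]) = cI a b (fun t => conjc I * f t).
  by rewrite cI_scale// mulrC mulc_conj.
have cI' : ct_on a b (fun t => conjc I * f t) by move=> x /cf; exact: ct_scale.
have [i1 i2] := ct_integrable cI'.
have mD : measurable (`[a, b] : set (measurableTypeR R)) by exact: measurable_itv.
have E2 : normc I ^+ 2 = (\int[lebesgue_measure]_(x in `[a, b]) Re (conjc I * f x))%R.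
  by have /(congr1 (@complex.Re R)) := E.
suff : normc I ^+ 2 <= normc I * ((b - a) * M).
  by rewrite expr2 ler_pM2l ?normc_gt0.
rewrite {1}E2; apply: (@le_trans _ _ (\int[lebesgue_measure]_(x in `[a, b]) (cst (normc I * M) x))%R).
  have [ic _] := @ct_integrable a b (fun=> (normc I * M)%:C) (fun x _ => @ct_cst _ x).
  apply: le_Rintegral => //.
  move=> x /=; rewrite in_itv/= => xab; apply: le_trans (ler_norm _) _.
  have e : normc (conjc I * f x) = normc I * normc (f x) by rewrite normcM normc_conj.
  apply: (le_trans (normc_Re (conjc I * f x))); rewrite e.
  by apply: ler_wpM2l; [exact: normc_ge0|exact: fM].
rewrite Rintegral_cst//.
have -> : fine (lebesgue_measure (`[a, b] : set (measurableTypeR R))) = b - a.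
  rewrite lebesgue_measure_itv /=; case: ltP => [_|ba]; first by rewrite -EFinB.
  by rewrite (@le_anti _ _ a b) ?subrr// ab -lee_fin.
by rewrite -mulrA (mulrC M).
Qed.

(** Only [x] is confined to the interval, [y] may leave it. The statements for two adjacent
    intervals then combine by taking the smaller [d], even when [x] and [y] lie on different sides
    of the common point. *)
Lemma ct_unif a b f (e : R) : a < b -> ct_on a b f -> 0 < e -> exists2 d : R, 0 < d &
  forall x y, a <= x <= b -> `|y - x| < d -> normc (f y - f x) < e.
Proof.
move=> ab cf e0.
apply: (@interval_cousin R (fun a b => exists2 d : R, 0 < d &
  forall x y, a <= x <= b -> `|y - x| < d -> normc (f y - f x) < e) a b ab).
- move=> s c t sc ct0 [d1 d10 h1] [d2 d20 h2].
  exists (Num.min d1 d2); first by rewrite lt_min d10.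
  move=> x y /andP[sx xt]; rewrite lt_min => /andP[y1 y2].
  have [xc|/ltW cx] := leP x c; first by apply: h1 => //; rewrite sx.
  by apply: h2 => //; rewrite cx.
- move=> x xab; have [d d0 h] := cf x xab (e / 2) (ltac:(by rewrite divr_gt0)).
  exists (d / 2); first by rewrite divr_gt0.
  move=> s t _ _ /andP[sx xt] ts; exists (d / 2); first by rewrite divr_gt0.
  move=> u v /andP[su ut] uv.
  have dux : `|u - x| < d / 2 by rewrite ltr_norml; lra.
  have dvx : `|v - x| < d.
    by move: uv dux; rewrite !ltr_norml => /andP[? ?] /andP[? ?]; lra.
  apply: le_lt_trans (normc_le_distD (f x) _ _) _.
  rewrite (splitr e) ltrD//; first exact: h.
  by rewrite normc_distrC h//; apply: lt_trans dux _; lra.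
Qed.

(** Links the tagged sums in [is_circle_integral] to the Lebesgue integral: on each piece of a fine
    partition [f] differs from its value at the tag by less than e / (2 pi). *)
Lemma cI_Riemann f (e : R) : ct_on 0 (2 * pi) f -> 0 < e -> exists2 d : R, 0 < d &
  forall N t s, tagged_partition N t s d ->
    normc (\sum_(i < N) (t i.+1 - t i)%:C * f (s i) - cI 0 (2 * pi) f) <= e.
Proof.
move=> cf e0; have p0 : 0 < 2 * pi :> R by rewrite mulr_gt0// pi_gt0.
have [d d0 h] := ct_unif p0 cf (ltac:(by rewrite divr_gt0) : 0 < e / (2 * pi)).
exists d => // N t s [t0 tN tP].
have mono n m : (n <= m <= N)%N -> t n <= t m.
  move=> /andP[/subnKC <-]; elim: (m - n)%N => [|k IH]; first by rewrite addn0.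
  rewrite addnS => nk; apply: le_trans (IH (ltnW nk)) _.
  by have [/andP[a1 a2] _] := tP _ nk; exact: le_trans a1 a2.
suff : forall n, (n <= N)%N ->
    normc (\sum_(i < n) (t i.+1 - t i)%:C * f (s i) - cI 0 (t n) f) <= t n * (e / (2 * pi)).
  move=> /(_ N (leqnn N)); rewrite tN mulrCA divff ?mulr1//; exact: lt0r_neq0.
elim=> [|n IH] nN.
  rewrite big_ord0 t0 sub0r normcN mul0r.
  have := @cI_bound 0 0 f (normc (f 0)) (lexx 0).
  rewrite subrr mul0r; apply => x; first by move=> x0; apply: cf; move: x0 p0; lra.
  by move=> /le_anti ->.
have tn0 : 0 <= t n by rewrite -t0 mono//= ltnW.
have tS := mono n n.+1 (ltac:(by rewrite leqnSn nN)).
have tS2 : t n.+1 <= 2 * pi by rewrite -tN mono// nN leqnn.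
have cf' a b : 0 <= a -> b <= 2 * pi -> ct_on a b f.
  by move=> a0 b2 x /andP[ax xb]; apply: cf; rewrite (le_trans a0 ax) (le_trans xb b2).
rewrite (cI_split tn0 tS (cf' _ _ (lexx 0) tS2)) big_ord_recr/=.
have cc : ct_on (t n) (t n.+1) (fun=> f (s n)) by move=> x _; exact: ct_cst.
rewrite (_ : _ - _ = (\sum_(i < n) (t i.+1 - t i)%:C * f (s i) - cI 0 (t n) f)
   + (cI (t n) (t n.+1) (fun=> f (s n)) - cI (t n) (t n.+1) f)); last by rewrite cI_cst//; ring.
apply: le_trans (normcD _ _) _; rewrite -cIB//; last exact: cf'.
have -> : t n.+1 * (e / (2 * pi)) = t n * (e / (2 * pi)) + (t n.+1 - t n) * (e / (2 * pi)) by ring.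
apply: lerD; first by apply: IH; exact: ltnW.
have [/andP[a1 a2] dn] := tP n nN.
apply: cI_bound => //.
  by move=> x xt; apply: ctB; [exact: ct_cst|exact: (cf' _ _ tn0 tS2)].
move=> x /andP[x1 x2]; apply/ltW/h.
  by rewrite (le_trans tn0 x1) (le_trans x2 tS2).
by rewrite ltr_norml; lra.
Qed.

End PathIntegral.

Lemma ler_mul_div1D (R : realFieldType) (u e : R) : 0 <= u -> 0 <= e -> u * (e / (1 + u)) <= e.
Proof. by move=> u0 e0; rewrite mulrA ler_pdivrMr ?ltr_wpDr//; nra. Qed.

(** * Complex differentiability of scalar functions *)

Section ComplexDerivative.
Context {R : realType}.
Implicit Types (f g : R[i] -> R[i]) (z w u v : R[i]).

Definition cct f z : Prop := forall e : R, 0 < e -> exists2 d : R, 0 < d &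
  forall w, normc (w - z) < d -> normc (f w - f z) < e.

Definition dif_at f z u : Prop := forall e : R, 0 < e -> exists2 d : R, 0 < d &
  forall w, normc (w - z) < d ->
    normc (f w - f z - (w - z) * u) <= e * normc (w - z).

Definition dif f z : Prop := exists u, dif_at f z u.

Lemma dif_at_cct f z u : dif_at f z u -> cct f z.
Proof.
move=> fu e e0; have u0 := normc_ge0 u.
have [d d0 h] := fu 1 ltr01.
exists (Num.min d (e / (1 + normc u))).
  by rewrite lt_min d0 divr_gt0// ltr_wpDr.
move=> w; rewrite lt_min => /andP[/h wd we].
rewrite (_ : f w - f z = (f w - f z - (w - z) * u) + (w - z) * u); last by ring.
apply: le_lt_trans (normcD _ _) _; rewrite normcM.
apply: (@le_lt_trans _ _ (normc (w - z) * (1 + normc u))); first by rewrite mulrDr mulr1 lerD2r -[leRHS]mul1r.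
by rewrite -ltr_pdivlMr// ltr_wpDr.
Qed.

Lemma dif_cct f z : dif f z -> cct f z.
Proof. by case=> u; exact: dif_at_cct. Qed.

Lemma dif_cst u z : dif (fun=> u) z.
Proof.
exists 0 => e e0; exists 1 => // w _.
by rewrite subrr mulr0 subr0 normc0 mulr_ge0 ?normc_ge0// ltW.
Qed.

Lemma dif_id z : dif id z.
Proof.
exists 1 => e e0; exists 1 => // w _.
by rewrite mulr1 subrr normc0 mulr_ge0 ?normc_ge0// ltW.
Qed.

Lemma dif_lin u f g z : dif f z -> dif g z -> dif (fun w => u * f w + g w) z.
Proof.
move=> [f' cf] [g' cg]; exists (u * f' + g') => e e0; have u0 := normc_ge0 u.
have [d1 d10 h1] := cf (e / 2 / (1 + normc u)) (ltac:(by rewrite !divr_gt0// ltr_wpDr)).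
have [d2 d20 h2] := cg (e / 2) (ltac:(by rewrite !divr_gt0// ltr_wpDr)).
exists (Num.min d1 d2); first by rewrite lt_min d10.
move=> y; rewrite lt_min => /andP[/h1 y1 /h2 y2].
rewrite (_ : _ - _ - _ = u * (f y - f z - (y - z) * f') + (g y - g z - (y - z) * g')); last by ring.
apply: le_trans (normcD _ _) _; rewrite normcM.
have -> : e * normc (y - z) = e / 2 * normc (y - z) + e / 2 * normc (y - z) by field.
apply: lerD => //.
apply: (@le_trans _ _ (normc u * (e / 2 / (1 + normc u) * normc (y - z)))); first by rewrite ler_wpM2l.
by rewrite mulrA ler_wpM2r ?normc_ge0//; apply: ler_mul_div1D => //; rewrite divr_ge0// ltW.
Qed.

Lemma difD f g z : dif f z -> dif g z -> dif (fun w => f w + g w) z.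
Proof.
move=> df dg; have := dif_lin 1 df dg.
by rewrite (_ : (fun t => _ + _) = (fun t => f t + g t))//; apply/funext => t; rewrite mul1r.
Qed.

Lemma difB f g z : dif f z -> dif g z -> dif (fun w => f w - g w) z.
Proof.
move=> df dg; have := dif_lin (-1) dg df.
by rewrite (_ : (fun t => _ + _) = (fun t => f t - g t))//; apply/funext => t; ring.
Qed.

Lemma dif_sum (I : Type) (s : seq I) (F : I -> R[i] -> R[i]) z :
  (forall i, dif (F i) z) -> dif (fun t => \sum_(i <- s) F i t) z.
Proof.
move=> cF; elim: s => [|i s IH].
  by rewrite (_ : (fun t => _) = (fun=> 0)); [exact: dif_cst|apply/funext => t; rewrite big_nil].
rewrite (_ : (fun t => _) = (fun t => F i t + \sum_(i <- s) F i t)); first exact: difD.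
by apply/funext => t; rewrite big_cons.
Qed.

Lemma dif_mul f g z : dif f z -> dif g z -> dif (fun w => f w * g w) z.
Proof.
move=> [f' df] [g' dg]; have cg := dif_at_cct dg.
exists (f' * g z + f z * g') => e e0.
pose k := 1 + normc (f z) + normc (g z) + normc f'.
have fz0 := normc_ge0 (f z); have gz0 := normc_ge0 (g z); have f'0 := normc_ge0 f'.
have k0 : 0 < k by rewrite /k; lra.
pose e' := Num.min 1 (e / 3 / k).
have e'0 : 0 < e' by rewrite lt_min ltr01 !divr_gt0.
have [d1 d10 h1] := df e' e'0.
have [d2 d20 h2] := dg e' e'0.
have [d3 d30 h3] := cg e' e'0.
exists (Num.min d1 (Num.min d2 d3)); first by rewrite !lt_min d10 d20.
move=> w; rewrite !lt_min => /andP[/h1 w1 /andP[/h2 w2 /h3 w3]].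
have e1 : e' <= 1 by rewrite ge_min lexx.
have e2 : e' * k <= e / 3 by rewrite -ler_pdivlMr// ge_min lexx orbT.
rewrite (_ : _ - _ - _ = (f w - f z - (w - z) * f') * g w + f z * (g w - g z - (w - z) * g')
   + (w - z) * f' * (g w - g z)); last by ring.
have n := normc_ge0 (w - z).
apply: le_trans (normcD _ _) _.
apply: le_trans (lerD (normcD _ _) (lexx _)) _; rewrite !normcM.
have gw : normc (g w) <= normc (g z) + 1.
  rewrite -(subrK (g z) (g w)) addrC; apply: le_trans (normcD _ _) _.
  by rewrite lerD2l; apply: ltW; apply: lt_le_trans w3 e1.
have : normc (f w - f z - (w - z) * f') * normc (g w) <= e' * normc (w - z) * (normc (g z) + 1).
  by apply: ler_pM => //; exact: normc_ge0.
have : normc (f z) * normc (g w - g z - (w - z) * g') <= normc (f z) * (e' * normc (w - z)).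
  by rewrite ler_wpM2l.
have : normc (w - z) * normc f' * normc (g w - g z) <= normc (w - z) * normc f' * e'.
  by rewrite ler_wpM2l ?mulr_ge0// ltW.
have : e' * k * normc (w - z) <= e / 3 * normc (w - z) by rewrite ler_wpM2r.
have : 0 <= e * normc (w - z) by rewrite mulr_ge0// ltW.
move: (normc (w - z)) => N; rewrite /k; lra.
Qed.

Lemma dif_inv f z : dif f z -> f z != 0 -> dif (fun w => (f w)^-1) z.
Proof.
move=> [f' df] fz; have cf := dif_at_cct df.
have a0 : 0 < normc (f z) by rewrite normc_gt0.
exists (- f' / (f z) ^+ 2) => e e0.
pose a := normc (f z); pose b := normc f'.
have b0 : 0 <= b := normc_ge0 _.
pose e1 := e * a ^+ 2 / 4.
pose e2 := e * a ^+ 3 / 4 / (1 + b).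
have e10 : 0 < e1 by rewrite !(divr_gt0, mulr_gt0, exprn_gt0).
have e20 : 0 < e2 by rewrite !(divr_gt0, mulr_gt0, exprn_gt0)// ltr_wpDr.
have [d1 d10 h1] := df e1 e10.
have [d2 d20 h2] := cf (Num.min (a / 2) e2) (ltac:(by rewrite lt_min e20 divr_gt0)).
exists (Num.min d1 d2); first by rewrite lt_min d10.
move=> w; rewrite lt_min => /andP[/h1 w1 /h2]; rewrite lt_min => /andP[w2 w3].
(* The denominator stays away from 0. With N = |w - z|, the tolerances [e1] and [e2] make each of
   the two terms of the numerator at most e N a^3 / 4, hence their sum at most e N a^2 (a / 2). *)
have aw : a / 2 <= normc (f w).
  have := normc_le_distD (f w) (f z) 0; rewrite !subr0 normc_distrC -/a; move: w2; lra.
have fw : f w != 0 by rewrite -normc_gt0; apply: lt_le_trans aw; rewrite divr_gt0.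
rewrite (_ : _ - _ - _ = (- (f w - f z - (w - z) * f') * f z
    + (w - z) * f' * (f w - f z)) / (f z ^+ 2 * f w)); last by field; rewrite fz fw.
rewrite normcM normcV normcM normcX ler_pdivrMr; last by rewrite mulr_gt0 ?exprn_gt0// normc_gt0.
have n := normc_ge0 (w - z).
apply: le_trans (normcD _ _) _; rewrite !normcM normcN -/a -/b.
have i1 : normc (f w - f z - (w - z) * f') * a <= e1 * normc (w - z) * a by rewrite ler_wpM2r// ltW.
have i2 : normc (w - z) * b * normc (f w - f z) <= normc (w - z) * (b * e2).
  by rewrite -mulrA !ler_wpM2l// ltW.
have i3 : b * e2 <= e * a ^+ 3 / 4.
  by apply: ler_mul_div1D => //; rewrite !(divr_ge0, mulr_ge0, exprn_ge0)// ltW.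
have i4 : normc (w - z) * (b * e2) <= normc (w - z) * (e * a ^+ 3 / 4) by rewrite ler_wpM2l.
have i5 : e * normc (w - z) * a ^+ 2 * (a / 2) <= e * normc (w - z) * a ^+ 2 * normc (f w).
  by rewrite ler_wpM2l// !mulr_ge0 ?exprn_ge0// ltW.
have -> : e * normc (w - z) * (a ^+ 2 * normc (f w)) = e * normc (w - z) * a ^+ 2 * normc (f w) by ring.
apply: le_trans i5; move: i1 i2 i4; rewrite /e1; set N := normc (w - z).
have -> : e * a ^+ 2 / 4 * N * a = e * N * a ^+ 3 / 4 by ring.
have -> : N * (e * a ^+ 3 / 4) = e * N * a ^+ 3 / 4 by ring.
have -> : e * N * a ^+ 2 * (a / 2) = e * N * a ^+ 3 / 2 by ring.
by lra.
Qed.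

Lemma dif_exp f z n : dif f z -> dif (fun w => f w ^+ n) z.
Proof.
move=> df; elim: n => [|n IH].
  by rewrite (_ : (fun w => _) = (fun=> 1)); [exact: dif_cst|apply/funext => w; rewrite expr0].
rewrite (_ : (fun w => _) = (fun w => f w * f w ^+ n)); first exact: dif_mul.
by apply/funext => w; rewrite exprS.
Qed.

Lemma dif_comp f g z : dif g z -> dif f (g z) -> dif (fun w => f (g w)) z.
Proof.
move=> [g' dg] [f' df]; have cg := dif_at_cct dg; exists (f' * g') => e e0.
have f0 := normc_ge0 f'; have g0 := normc_ge0 g'.
pose e1 := e / 2 / (1 + normc g'); pose e2 := Num.min 1 (e / 2 / (1 + normc f')).
have e10 : 0 < e1 by rewrite !divr_gt0// ltr_wpDr.
have e20 : 0 < e2 by rewrite lt_min ltr01 !divr_gt0// ltr_wpDr.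
have [d1 d10 h1] := df e1 e10.
have [d2 d20 h2] := dg e2 e20.
have [d3 d30 h3] := cg d1 d10.
exists (Num.min d2 d3); first by rewrite lt_min d20.
move=> w; rewrite lt_min => /andP[/h2 w2 /h3/h1 w3].
rewrite (_ : _ - _ - _ = (f (g w) - f (g z) - (g w - g z) * f') + (g w - g z - (w - z) * g') * f'); last by ring.
have n := normc_ge0 (w - z).
apply: le_trans (normcD _ _) _; rewrite normcM.
have k : normc (g w - g z) <= (1 + normc g') * normc (w - z).
  rewrite (_ : g w - g z = (g w - g z - (w - z) * g') + (w - z) * g'); last by ring.
  apply: le_trans (normcD _ _) _; rewrite normcM.
  rewrite [leRHS](_ : _ = normc (w - z) + normc (w - z) * normc g') ?lerD2r; last by ring.
  rewrite -[leRHS]mul1r.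
  by apply: le_trans w2 _; rewrite ler_wpM2r// ge_min lexx.
have -> : e * normc (w - z) = e / 2 * normc (w - z) + e / 2 * normc (w - z) by field.
apply: lerD.
  apply: le_trans w3 _; apply: le_trans (ler_wpM2l (ltW e10) k) _.
  by rewrite /e1 mulrA mulfVK// gt_eqF// ltr_wpDr.
apply: le_trans (ler_wpM2r f0 w2) _; rewrite mulrAC ler_wpM2r//.
apply: (@le_trans _ _ (e2 * (1 + normc f'))); first by rewrite ler_wpM2l ?(ltW e20)// lerDr.
by rewrite -ler_pdivlMr ?ltr_wpDr// ge_min lexx orbT.
Qed.

Definition cexp z : R[i] := (expR (Re z))%:C * expi (Im z).

Lemma cexpD z w : cexp (z + w) = cexp z * cexp w.
Proof. by rewrite /cexp ReD ImD expRD expiD rCM; ring. Qed.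

Lemma normc_cexp z : normc (cexp z) = expR (Re z).
Proof. by rewrite normcM normc_expi normcR mulr1 ger0_norm// expR_ge0. Qed.

Let real_dif (f : R -> R) (df e : R) : is_derive (0 : R) (1 : R) f df -> 0 < e -> exists2 d : R, 0 < d &
  forall x, `|x| < d -> `|f x - f 0 - x * df| <= e * `|x|.
Proof.
move=> D e0.
have /cvgrPdist_lt/(_ e e0) : (fun h : R => h^-1 *: (f (h *: (1 : R) + 0) - f 0)) @ 0^' --> df.
  by rewrite -(@derive_val _ _ _ _ _ _ _ D); exact: (@ex_derive _ _ _ _ _ _ _ D).
move=> /nbhs_ballP[d /= d0 h]; exists d => // x xd.
have [->|x0] := eqVneq x 0; first by rewrite subrr mul0r subr0 normr0 mulr0.
have /= := h x; rewrite /ball /= sub0r normrN => /(_ xd x0).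
rewrite addr0 [_ *: 1]mulr1 distrC => lt.
rewrite (_ : _ - _ - _ = x * (x^-1 * (f x - f 0) - df)); last by field.
by rewrite normrM mulrC ler_wpM2r// ltW.
Qed.

(** By [cexpD], the first-order remainder at [z] is [cexp z] times the one at 0, that is
    [cexp u - 1 - u]. *)
Lemma dif_cexp z : dif cexp z.
Proof.
exists (cexp z) => e e0.
pose k := normc (cexp z); have k0 : 0 <= k := normc_ge0 _.
pose e1 := Num.min 1 (e / (1 + k) / 6).
have e10 : 0 < e1 by rewrite lt_min ltr01 !divr_gt0// ltr_wpDr.
have [d1 d10 h1] := real_dif (is_derive_expR (0 : R)) e10.
have [d2 d20 h2] := real_dif (is_derive_cos (0 : R)) e10.
have [d3 d30 h3] := real_dif (is_derive_sin (0 : R)) e10.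
exists (Num.min (Num.min d1 e1) (Num.min d2 d3)); first by rewrite lt_min; apply/andP; split; rewrite lt_min ?d10 ?e10 ?d20.
move=> w; rewrite lt_min [_ < Num.min d1 _]lt_min [_ < Num.min d2 _]lt_min => /andP[/andP[w1 wk] /andP[w2 w3]].
pose u := w - z; have wE : w = z + u by rewrite /u addrC subrK.
rewrite -/u in w1 w2 w3 wk *; rewrite wE cexpD.
rewrite (_ : _ - _ - _ = cexp z * (cexp u - 1 - u)); last by ring.
rewrite normcM -/k.
have us := normc_Re u; have ut := normc_Im u.
have := h1 (Re u) (le_lt_trans us w1).
have := h2 (Im u) (le_lt_trans ut w2).
have := h3 (Im u) (le_lt_trans ut w3).
rewrite expR0 cos0 sin0 oppr0 !mulr0 !mulr1 !(subr0, addr0) => s1 s2 s3.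
set s := Re u in us s1 s2 s3 *; set t := Im u in ut s1 s2 s3 *.
have uE : u = s%:C + (0 +i* 1) * t%:C.
  by rewrite /s /t; move: (u) => [a b]; apply/eqP; rewrite eq_complex /= !(mul0r, mul1r, mulr0, addr0, add0r, subr0) !eqxx.
(* The first three terms contain the first-order remainders at 0 of [expR], [cos] and [sin]. Since
   |1 + s| <= 2, the four moduli are at most 1, 2, 2 and 1 times e1 |u|, whence the 6 below. *)
have E : cexp u - 1 - u = (expR s - 1 - s)%:C * expi t
   + ((1 + s) * (cos t - 1))%:C + (0 +i* 1) * ((1 + s) * (sin t - t))%:C
   + (0 +i* 1) * (s * t)%:C.
  rewrite {2}uE /cexp -/s -/t /expi; apply/eqP; rewrite eq_complex /=; apply/andP; split; apply/eqP; ring.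
have n := normc_ge0 u.
have e11 : e1 <= 1 by rewrite ge_min lexx.
have sb : `|1 + s| <= 2.
  by apply: le_trans (ler_normD _ _) _; rewrite normr1; move: us wk e11; lra.
suff : normc (cexp u - 1 - u) <= 6 * e1 * normc u.
  move=> /(ler_wpM2l k0) /le_trans; apply.
  rewrite mulrA ler_wpM2r//.
  apply: (@le_trans _ _ (k * (e / (1 + k)))); last by apply: ler_mul_div1D => //; exact: ltW.
  rewrite ler_wpM2l// mulrC -ler_pdivlMr// ge_min lexx orbT//.
rewrite E; apply: le_trans (normcD _ _) _.
apply: le_trans (lerD (normcD _ _) (lexx _)) _.
apply: le_trans (lerD (lerD (normcD _ _) (lexx _)) (lexx _)) _.
rewrite !normcM normc_i !normcR normc_expi mulr1 !mul1r !normrM.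
have e1' := ltW e10.
have p1 : `|expR s - 1 - s| <= e1 * normc u by apply: le_trans s3 _; rewrite ler_wpM2l.
have p2 : `|1 + s| * `|cos t - 1| <= 2 * (e1 * normc u).
  by apply: ler_pM => //; apply: le_trans s2 _; rewrite ler_wpM2l.
have p3 : `|1 + s| * `|sin t - t| <= 2 * (e1 * normc u).
  by apply: ler_pM => //; apply: le_trans s1 _; apply: ler_wpM2l.
have p4 : `|s| * `|t| <= e1 * normc u.
  have se : `|s| <= e1 := le_trans us (ltW wk).
  by apply: ler_pM.
have -> : 6 * e1 * normc u = e1 * normc u + 2 * (e1 * normc u) + 2 * (e1 * normc u) + e1 * normc u by ring.
by rewrite !lerD.
Qed.

End ComplexDerivative.

(** * Goursat's theorem for rectangles *)

Section CauchyGoursat.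
Context {R : realType}.
Implicit Types (f g : R[i] -> R[i]) (z w u v : R[i]) (a b c d h x y : R).

Let i : R[i] := 0 +i* 1.

Lemma complexE x y : x +i* y = x%:C + i * y%:C.
Proof.
by apply/eqP; rewrite eq_complex /= !(mul0r, mul1r, mulr0, addr0, add0r, subr0) !eqxx.
Qed.

Lemma normc_complex x y : normc (x +i* y) <= `|x| + `|y|.
Proof. exact: normc_le_ReIm. Qed.

Lemma cct_horizontal g x y : cct g (x +i* y) -> ct (fun t => g (t +i* y)) x.
Proof.
move=> cg e e0; have [d d0 h] := cg e e0; exists d => // t tx; apply: h.
have -> : (t +i* y) - (x +i* y) = (t - x)%:C by apply/eqP; rewrite eq_complex /= subrr !eqxx.
by rewrite normcR.
Qed.

Lemma cct_vertical g x y : cct g (x +i* y) -> ct (fun t => g (x +i* t)) y.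
Proof.
move=> cg e e0; have [d d0 h] := cg e e0; exists d => // t tx; apply: h.
have -> : (x +i* t) - (x +i* y) = i * (t - y)%:C.
  by rewrite !complexE rCB; ring.
by rewrite normcM normc_i mul1r normcR.
Qed.

(* the integral of [g z dz] along the boundary of [a, b] x [c, d] *)
Definition bd g a b c d : R[i] :=
  (cI a b (fun x => g (x +i* c)) - cI a b (fun x => g (x +i* d))) +
  i * (cI c d (fun y => g (b +i* y)) - cI c d (fun y => g (a +i* y))).

Definition cct_rect g a b c d : Prop :=
  forall x y, a <= x <= b -> c <= y <= d -> cct g (x +i* y).

Lemma bd_split1 g a b c d m : a <= m -> m <= b -> c <= d -> cct_rect g a b c d ->
  bd g a b c d = bd g a m c d + bd g m b c d.
Proof.
move=> am mb cd cg.
have c1 y : c <= y <= d -> ct_on a b (fun x => g (x +i* y)).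
  by move=> yc x xab; apply: cct_horizontal; exact: cg.
rewrite /bd (cI_split am mb (c1 c _)) ?lexx// (cI_split am mb (c1 d _)) ?lexx ?cd//.
by rewrite /bd; ring.
Qed.

Lemma bd_split2 g a b c d m : a <= b -> c <= m -> m <= d -> cct_rect g a b c d ->
  bd g a b c d = bd g a b c m + bd g a b m d.
Proof.
move=> ab cm md cg.
have c1 x : a <= x <= b -> ct_on c d (fun y => g (x +i* y)).
  by move=> xab y yc; apply: cct_vertical; exact: cg.
rewrite /bd (cI_split cm md (c1 a _)) ?lexx// (cI_split cm md (c1 b _)) ?lexx ?ab//.
by rewrite /bd; ring.
Qed.

Lemma bd_bound g a b c d (M : R) : a <= b -> c <= d -> cct_rect g a b c d ->
  (forall x y, a <= x <= b -> c <= y <= d -> normc (g (x +i* y)) <= M) ->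
  normc (bd g a b c d) <= 2 * ((b - a) + (d - c)) * M.
Proof.
move=> ab cd cg gM.
have h y : c <= y <= d -> normc (cI a b (fun x => g (x +i* y))) <= (b - a) * M.
  move=> yc; apply: cI_bound => // x xab; last exact: gM.
  by apply: cct_horizontal; exact: cg.
have v x : a <= x <= b -> normc (cI c d (fun y => g (x +i* y))) <= (d - c) * M.
  move=> xab; apply: cI_bound => // y yc; last exact: gM.
  by apply: cct_vertical; exact: cg.
apply: le_trans (normcD _ _) _; rewrite normcM normc_i mul1r.
apply: le_trans (lerD (normcB _ _) (normcB _ _)) _.
have := h c; have := h d; have := v a; have := v b; rewrite !lexx ab cd /=.
move=> /(_ isT) h1 /(_ isT) h2 /(_ isT) h3 /(_ isT) h4.
have -> : 2 * ((b - a) + (d - c)) * M = (b - a) * M + (b - a) * M + ((d - c) * M + (d - c) * M) by ring.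
by rewrite !lerD.
Qed.

Lemma bd_affine u v a b c d : a <= b -> c <= d -> bd (fun z => u + v * z) a b c d = 0.
Proof.
move=> ab cd.
have ca z : cct (fun z => u + v * z) z.
  apply: dif_cct; apply: difD; first exact: dif_cst.
  by apply: dif_mul; [exact: dif_cst|exact: dif_id].
have ch y : ct_on a b (fun x => u + v * (x +i* y)).
  by move=> x _; apply: (@cct_horizontal (fun z => u + v * z)); exact: ca.
have cv x : ct_on c d (fun y => u + v * (x +i* y)).
  by move=> y _; apply: (@cct_vertical (fun z => u + v * z)); exact: ca.
rewrite /bd -cIB// -cIB//.
rewrite (@cI_ext _ a b _ (fun=> v * (i * (c - d)%:C))); last first.
  by move=> x _; rewrite !complexE rCB; ring.
rewrite (@cI_ext _ c d _ (fun=> v * (b - a)%:C)); last first.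
  by move=> x _; rewrite !complexE rCB; ring.
rewrite !cI_cst// !rCB; ring.
Qed.

Lemma bdB f g a b c d : a <= b -> c <= d -> cct_rect f a b c d -> cct_rect g a b c d ->
  bd (fun z => f z - g z) a b c d = bd f a b c d - bd g a b c d.
Proof.
move=> ab cd cf cg.
have ch k y : cct_rect k a b c d -> c <= y <= d -> ct_on a b (fun x => k (x +i* y)).
  by move=> ck yc x xab; apply: cct_horizontal; exact: ck.
have cv k x : cct_rect k a b c d -> a <= x <= b -> ct_on c d (fun y => k (x +i* y)).
  by move=> ck xab y yc; apply: cct_vertical; exact: ck.
rewrite /bd !cIB; first by ring.
all: by [apply: ch; rewrite ?lexx ?cd|apply: cv; rewrite ?lexx ?ab].
Qed.

(** Goursat's subdivision, with [rectangle_cousin] supplying the limit point: near a point where [g]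
    is differentiable, its affine part [l] has zero boundary integral, and only the remainder
    contributes. *)
Theorem goursat_rectangle g a b c d : a <= b -> c <= d ->
  (forall x y, a <= x <= b -> c <= y <= d -> dif g (x +i* y)) -> bd g a b c d = 0.
Proof.
move=> ab cd dg.
have cg : cct_rect g a b c d by move=> x y xab ycd; apply: dif_cct; exact: dg.
pose L1 := b - a; pose L2 := d - c.
have L10 : 0 <= L1 by rewrite subr_ge0.
have L20 : 0 <= L2 by rewrite subr_ge0.
have bE : b = a + L1 by rewrite /L1; ring.
have dE : d = c + L2 by rewrite /L2; ring.
apply/eqP; rewrite -normc_eq0 eq_le normc_ge0 andbT.
apply/ler_addgt0Pl => e e0; rewrite addr0.
(* At scale h the perimeter is 2 h (L1 + L2) and two points are at most h (L1 + L2) apart, so a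
   remainder e1 |z - z0| integrates to at most e1 k h^2. *)
pose k := 2 * (L1 + L2) ^+ 2.
have k0 : 0 <= k by rewrite mulr_ge0// exprn_ge0// addr_ge0.
pose e1 := e / (1 + k).
have e10 : 0 < e1 by rewrite divr_gt0// ltr_wpDr.
(* The bound is quadratic in [h], so the bounds of four half-scale rectangles add up to exactly the
   one required. The inclusions are premises because the cutting step of [rectangle_cousin] ranges
   over all rectangles. *)
pose P x y h := a <= x -> x + h * L1 <= b -> c <= y -> y + h * L2 <= d ->
  normc (bd g x (x + h * L1) y (y + h * L2)) <= e1 * k * h ^+ 2.
have : P a c 1.
  apply: (@rectangle_cousin R P a c L1 L2) => //.
  - move=> x y h h0 p1 p2 p3 p4 ax xb cy yd.
    have hL1 : 0 <= h / 2 * L1 by rewrite mulr_ge0// divr_ge0// ltW.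
    have hL2 : 0 <= h / 2 * L2 by rewrite mulr_ge0// divr_ge0// ltW.
    have E1 : x + h * L1 = x + h / 2 * L1 + h / 2 * L1 by field.
    have E2 : y + h * L2 = y + h / 2 * L2 + h / 2 * L2 by field.
    rewrite E1 E2 in xb yd *.
    have cg' x1 x2 y1 y2 : a <= x1 -> x2 <= b -> c <= y1 -> y2 <= d -> cct_rect g x1 x2 y1 y2.
      move=> q1 q2 q3 q4 s t /andP[s1 s2] /andP[t1 t2]; apply: cg.
        by rewrite (le_trans q1 s1) (le_trans s2 q2).
      by rewrite (le_trans q3 t1) (le_trans t2 q4).
    rewrite (@bd_split1 _ _ _ _ _ (x + h / 2 * L1)) ?lerDl//; last 2 first.
      by rewrite -addrA lerDl addr_ge0.
      exact: cg'.
    move: p1 p2 p3 p4; rewrite /P; move: xb yd hL1 hL2.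
    set u := h / 2 * L1; set v := h / 2 * L2 => xb yd u0 v0 p1 p2 p3 p4.
    have ax' : a <= x + u by rewrite (le_trans ax)// lerDl.
    have cy' : c <= y + v by rewrite (le_trans cy)// lerDl.
    have xb' : x + u <= b by apply: le_trans xb; rewrite lerDl.
    have yd' : y + v <= d by apply: le_trans yd; rewrite lerDl.
    have q1 := p1 ax xb' cy yd'.
    have q2 := p2 ax' xb cy yd'.
    have q3 := p3 ax xb' cy' yd.
    have q4 := p4 ax' xb cy' yd.
    have S2 x1 x2 : a <= x1 -> x1 <= x2 -> x2 <= b ->
        bd g x1 x2 y (y + v + v) = bd g x1 x2 y (y + v) + bd g x1 x2 (y + v) (y + v + v).
      by move=> w1 w2 w3; apply: bd_split2; rewrite ?lerDl//; exact: cg'.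
    rewrite !S2 ?lerDl//.
    apply: le_trans (normcD _ _) _; apply: le_trans (lerD (normcD _ _) (normcD _ _)) _.
    have -> : e1 * k * h ^+ 2 = (e1 * k * (h / 2) ^+ 2 + e1 * k * (h / 2) ^+ 2) +
       (e1 * k * (h / 2) ^+ 2 + e1 * k * (h / 2) ^+ 2) by field.
    exact: (lerD (lerD q1 q3) (lerD q2 q4)).
  - rewrite -bE -dE => x0 y0 x0ab y0cd.
    have [u du] := dg x0 y0 x0ab y0cd; have [r r0 hr] := du e1 e10.
    pose z0 : R[i] := x0 +i* y0.
    have L0 : 0 < 1 + (L1 + L2) by lra.
    exists (r / (1 + (L1 + L2))); first by rewrite divr_gt0.
    move=> x y h /andP[h0 hr'] _ _ _ _ /andP[xx0 x0x] /andP[yy0 y0y] ax xb cy yd.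
    have hL1 : 0 <= h * L1 by rewrite mulr_ge0// ltW.
    have hL2 : 0 <= h * L2 by rewrite mulr_ge0// ltW.
    have cg' : cct_rect g x (x + h * L1) y (y + h * L2).
      move=> s t /andP[s1 s2] /andP[t1 t2]; apply: cg.
        by rewrite (le_trans ax s1) (le_trans s2 xb).
      by rewrite (le_trans cy t1) (le_trans t2 yd).
    pose l z := (g z0 - u * z0) + u * z.
    have cl : cct_rect l x (x + h * L1) y (y + h * L2).
      move=> s t _ _; apply: dif_cct; apply: difD; first exact: dif_cst.
      by apply: dif_mul; [exact: dif_cst|exact: dif_id].
    have -> : bd g x (x + h * L1) y (y + h * L2) = bd (fun z => g z - l z) x (x + h * L1) y (y + h * L2).
      by rewrite bdB// ?lerDl// bd_affine ?lerDl// subr0.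
    have -> : e1 * k * h ^+ 2 = 2 * ((x + h * L1 - x) + (y + h * L2 - y)) * (e1 * (h * (L1 + L2))).
      by rewrite /k; ring.
    apply: bd_bound; rewrite ?lerDl//.
      move=> s t s1 t1 e' e'0.
      have [d1 d10 q1] := cg' s t s1 t1 (e' / 2) (ltac:(by rewrite divr_gt0)).
      have [d2 d20 q2] := cl s t s1 t1 (e' / 2) (ltac:(by rewrite divr_gt0)).
      exists (Num.min d1 d2); first by rewrite lt_min d10.
      move=> w; rewrite lt_min => /andP[/q1 w1 /q2 w2].
      rewrite (_ : _ - _ = (g w - g (s +i* t)) - (l w - l (s +i* t))); last by ring.
      by apply: le_lt_trans (normcB _ _) _; rewrite (splitr e') ltrD.
    move=> s t /andP[s1 s2] /andP[t1 t2].
    have dist : normc ((s +i* t) - z0) <= h * (L1 + L2).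
      rewrite (_ : (s +i* t) - z0 = (s - x0) +i* (t - y0)); last first.
        by rewrite /z0 !complexE !rCB; ring.
      apply: le_trans (normc_complex _ _) _; rewrite mulrDr lerD// ler_norml; lra.
    rewrite (_ : _ - _ = g (s +i* t) - g z0 - ((s +i* t) - z0) * u); last by rewrite /l; ring.
    apply: (@le_trans _ _ (e1 * normc ((s +i* t) - z0))); last by rewrite ler_wpM2l// ltW.
    apply: hr; apply: le_lt_trans dist _.
    move: hr'; rewrite ltr_pdivlMr// mulrDr mulr1; lra.
move=> /(_ (lexx _)); rewrite !mul1r -bE -dE expr1n mulr1 => /(_ (lexx _) (lexx _) (lexx _)).
move=> /le_trans; apply.
by rewrite mulrC; apply: ler_mul_div1D => //; exact: ltW.
Qed.

End CauchyGoursat.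

(** * Integrals along circles about 0 *)

Section CircleIntegral.
Context {R : realType}.
Implicit Types (f g : R[i] -> R[i]) (z w u v : R[i]) (a b c d r e t x : R).

Lemma ct_comp f (g : R -> R[i]) x : ct g x -> cct f (g x) -> ct (fun t => f (g t)) x.
Proof.
move=> cg cf e /cf[d d0 h]; have [d' d'0 h'] := cg d d0.
by exists d' => // y /h' /h.
Qed.

Lemma ct_expi x : ct expi x.
Proof.
have := @cct_vertical R cexp 0 x (dif_cct (dif_cexp _)).
by congr ct; apply/funext => t; rewrite /cexp /= expR0 mul1r.
Qed.

Lemma ct_circle r x : ct (fun t => r%:C * expi t) x.
Proof. exact/ct_scale/ct_expi. Qed.

Lemma normc_circle r t : 0 <= r -> normc (r%:C * expi t) = r.
Proof. by move=> r0; rewrite normcM normc_expi normcR mulr1 ger0_norm. Qed.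

Lemma circle_neq0 r t : 0 < r -> r%:C * expi t != 0.
Proof. by move=> r0; rewrite -normc_gt0 normc_circle// ltW. Qed.

Definition cct_circ f r : Prop := forall z, normc z = r -> cct f z.

(* [J f r] is the integral of [f z dz / i] along the circle of radius [r] about 0 *)
Definition J f r : R[i] :=
  cI 0 (2 * pi) (fun t => f (r%:C * expi t) * (r%:C * expi t)).

Lemma twopi_gt0 : 0 < 2 * pi :> R. Proof. by rewrite mulr_gt0// pi_gt0. Qed.
Let tp0 : 0 <= 2 * pi :> R := ltW twopi_gt0.

Lemma J_ct_on f r a b : 0 <= r -> cct_circ f r ->
  ct_on a b (fun t => f (r%:C * expi t) * (r%:C * expi t)).
Proof.
move=> r0 cf x _; apply: ct_mul; last exact: ct_circle.
by apply: (ct_comp (@ct_circle r x)); apply: cf; exact: normc_circle.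
Qed.

Lemma J_ext f g r : 0 <= r -> (forall z, normc z = r -> f z = g z) -> J f r = J g r.
Proof. by move=> r0 fg; apply: cI_ext => x _; rewrite fg// normc_circle. Qed.

Lemma J_lin u f g r : 0 <= r -> cct_circ f r -> cct_circ g r ->
  J (fun z => u * f z + g z) r = u * J f r + J g r.
Proof.
move=> r0 cf cg; rewrite /J -cI_lin; [|exact: J_ct_on..].
by apply: cI_ext => x _; ring.
Qed.

Lemma J_scale u f r : 0 <= r -> cct_circ f r -> J (fun z => u * f z) r = u * J f r.
Proof.
move=> r0 cf; rewrite /J -cI_scale//; last exact: J_ct_on.
by apply: cI_ext => x _; ring.
Qed.

Lemma JD f g r : 0 <= r -> cct_circ f r -> cct_circ g r ->
  J (fun z => f z + g z) r = J f r + J g r.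
Proof.
move=> r0 cf cg; rewrite /J -cID; [|exact: J_ct_on..].
by apply: cI_ext => x _; ring.
Qed.

Lemma JB f g r : 0 <= r -> cct_circ f r -> cct_circ g r ->
  J (fun z => f z - g z) r = J f r - J g r.
Proof.
move=> r0 cf cg; rewrite /J -cIB; [|exact: J_ct_on..].
by apply: cI_ext => x _; ring.
Qed.

Lemma J_sum (I : Type) (s : seq I) (F : I -> R[i] -> R[i]) r : 0 <= r ->
  (forall i, cct_circ (F i) r) ->
  J (fun z => \sum_(i <- s) F i z) r = \sum_(i <- s) J (F i) r.
Proof.
move=> r0 cF; rewrite /J -cI_sum => [||i]//; last exact: J_ct_on.
by apply: cI_ext => x _; rewrite mulr_suml.
Qed.

Lemma J_bound f r (M : R) : 0 <= r -> cct_circ f r ->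
  (forall z, normc z = r -> normc (f z) <= M) -> normc (J f r) <= 2 * pi * (r * M).
Proof.
move=> r0 cf fM; have := @cI_bound R 0 (2 * pi) _ (r * M) tp0 (@J_ct_on f r _ _ r0 cf).
rewrite subr0; apply => x _; rewrite normcM normc_circle// mulrC ler_wpM2l//.
by apply: fM; rewrite normc_circle.
Qed.

Lemma expi2pi : expi (2 * pi) = 1 :> R[i].
Proof. by rewrite /expi mulr_natl cos2pi sin2pi. Qed.

Lemma expi0 : expi 0 = 1 :> R[i].
Proof. by rewrite /expi cos0 sin0. Qed.

(** The exponential maps the rectangle [ln a, ln b] x [0, 2 pi] onto the annulus. The horizontal
    sides carry equal integrals by periodicity, the vertical ones carry [J f a] and [J f b]. *)
Lemma J_const f a b : 0 < a -> a <= b ->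
  (forall z, a <= normc z <= b -> dif f z) -> J f a = J f b.
Proof.
move=> a0 ab df; have b0 : 0 < b := lt_le_trans a0 ab.
have lnab : ln a <= ln b by rewrite ler_ln.
pose g z := f (cexp z) * cexp z.
have ce s t : cexp (s +i* t) = (expR s)%:C * expi t by [].
have := @goursat_rectangle R g (ln a) (ln b) 0 (2 * pi) lnab tp0.
have dg x y : ln a <= x <= ln b -> 0 <= y <= 2 * pi -> dif g (x +i* y).
  move=> /andP[ax xb] _; apply: dif_mul; last exact: dif_cexp.
  apply: dif_comp; first exact: dif_cexp.
  apply: df; rewrite normc_cexp /=; apply/andP; split.
    by rewrite -[leLHS](@lnK R)// ler_expR.
  by rewrite -[leRHS](@lnK R)// ler_expR.
move=> /(_ dg); rewrite /bd.
rewrite (@cI_ext _ _ _ (fun x => g (x +i* 0)) (fun x => g (x +i* (2 * pi)))); last first.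
  by move=> x _; rewrite /g !ce expi2pi expi0.
rewrite subrr add0r => /eqP; rewrite mulf_eq0.
have -> : (0 +i* 1 == 0 :> R[i]) = false by rewrite eq_complex /= oner_eq0 andbF.
rewrite orFb subr_eq0 => /eqP E.
have JE r : 0 < r -> J f r = cI 0 (2 * pi) (fun y => g (ln r +i* y)).
  by move=> r0; apply: cI_ext => x _; rewrite /g ce lnK.
by apply: (etrans (JE a a0)); apply: (etrans (esym E)); exact: (esym (JE b b0)).
Qed.

(** By [J_const] the circle may be shrunk, and its length tends to 0 while [f] stays bounded: a
    bounded singularity at 0 contributes nothing. *)
Lemma J_small f r (M eta : R) : 0 < r -> 0 < eta ->
  (forall z, 0 < normc z <= r -> dif f z) ->
  (forall z, 0 < normc z < eta -> normc (f z) <= M) -> J f r = 0.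
Proof.
move=> r0 eta0 df fM; apply/eqP; rewrite -normc_eq0 eq_le normc_ge0 andbT.
apply/ler_addgt0Pl => e e0; rewrite addr0.
pose k := 2 * pi * `|M|; have k0 : 0 <= k by rewrite mulr_ge0.
pose s := Num.min r (Num.min (eta / 2) (e / (1 + k))).
have s0 : 0 < s.
  rewrite /s lt_min r0 lt_min; apply/andP; split => //; apply/andP; split; rewrite divr_gt0//.
  by rewrite ltr_wpDr.
have sr : s <= r by rewrite ge_min lexx.
have se : s < eta.
  have : s <= eta / 2 by rewrite ge_min; apply/orP; right; rewrite ge_min lexx.
  by move: eta0; lra.
have se' : s <= e / (1 + k) by rewrite ge_min; apply/orP; right; rewrite ge_min lexx orbT.
rewrite -(@J_const f s r)//; last first.
  by move=> z /andP[sz zr]; apply: df; rewrite (lt_le_trans s0 sz).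
have c : cct_circ f s by move=> z zs; apply/dif_cct/df; rewrite zs s0 sr.
apply: le_trans (@J_bound f s `|M| (ltW s0) c _) _.
  by move=> z zs; apply: le_trans (ler_norm _); apply: fM; rewrite zs s0.
rewrite mulrCA -mulrA (_ : s * (2 * (pi * `|M|)) = k * s); last by rewrite /k; ring.
by apply: le_trans (ler_wpM2l k0 se') _; apply: ler_mul_div1D => //; exact: ltW.
Qed.

(** Near the circle [f] is merely continuous, so the radius may pass through a point where
    differentiability is unknown. [cauchy_formula] relies on this at the radius |w|. *)
Lemma J_ct f r eta e : 0 < r -> 0 < eta ->
  (forall z, z != 0 -> `|normc z - r| < eta -> cct f z) -> 0 < e ->
  exists2 d, 0 < d & forall s, `|s - r| < d -> normc (J f s - J f r) <= e.
Proof.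
move=> r0 eta0 cf e0; pose g z := f z * z.
have cg z : z != 0 -> `|normc z - r| < eta -> cct g z.
  move=> z0 zr e1 e10; have := cf z z0 zr; have := dif_cct (dif_id z).
  move=> ci cfz; pose k := 1 + normc (f z) + normc z.
  have fz0 := normc_ge0 (f z); have gz0 := normc_ge0 z.
  have k0 : 0 < k by rewrite /k; lra.
  pose e' := Num.min 1 (e1 / 3 / k).
  have e'0 : 0 < e' by rewrite lt_min ltr01 !divr_gt0.
  have [d1 d10 h1] := cfz e' e'0.
  exists (Num.min d1 e'); first by rewrite lt_min d10.
  move=> y; rewrite lt_min => /andP[/h1 y1 y2].
  rewrite /g (_ : _ - _ = (f y - f z) * (y - z) + f z * (y - z) + (f y - f z) * z); last by ring.
  have e2 : e' <= 1 by rewrite ge_min lexx.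
  have e3 : e' * k <= e1 / 3 by rewrite -ler_pdivlMr// ge_min lexx orbT.
  have n1 := normc_ge0 (f y - f z); have n2 := normc_ge0 (y - z).
  apply: le_lt_trans (normcD _ _) _; apply: le_lt_trans (lerD (normcD _ _) (lexx _)) _.
  rewrite !normcM.
  have : normc (f y - f z) * normc (y - z) <= e' * 1.
    by apply: ler_pM => //; [exact: ltW|exact: le_trans (ltW y2) e2].
  have : normc (f z) * normc (y - z) <= normc (f z) * e' by rewrite ler_wpM2l// ltW.
  have : normc (f y - f z) * normc z <= e' * normc z by rewrite ler_wpM2r// ltW.
  move: e3; rewrite /k; lra.
pose e1 := e / (2 * pi); have e10 : 0 < e1 by rewrite divr_gt0// twopi_gt0.
(* Continuity in the radius, uniformly over an interval of angles; [interval_cousin] extends it to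
   the full turn. *)
pose P a b := exists2 d, 0 < d & forall x s, a <= x <= b -> `|s - r| < d ->
  normc (g (s%:C * expi x) - g (r%:C * expi x)) < e1.
have : P 0 (2 * pi).
  apply: (@interval_cousin R P 0 (2 * pi) twopi_gt0).
  - move=> s c t sc ct0 [d1 d10 h1] [d2 d20 h2].
    exists (Num.min d1 d2); first by rewrite lt_min d10.
    move=> x y /andP[sx xt]; rewrite lt_min => /andP[y1 y2].
    have [xc|/ltW cx] := leP x c; first by apply: h1 => //; rewrite sx.
    by apply: h2 => //; rewrite cx.
  - move=> x _; pose z0 := r%:C * expi x.
    have [d d0 h] := cg z0 (circle_neq0 _ r0) (ltac:(by rewrite normc_circle ?subrr ?normr0// ltW))
      (e1 / 2) (ltac:(by rewrite divr_gt0)).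
    have [d' d'0 h'] := @ct_circle r x (d / 2) (ltac:(by rewrite divr_gt0)).
    exists d' => // s t _ _ /andP[sx xt] ts; exists (d / 2); first by rewrite divr_gt0.
    move=> y q /andP[sy yt] qr.
    have yx : `|y - x| < d' by rewrite ltr_norml; apply/andP; split; lra.
    have a1 := h' y yx.
    have a2 : normc (q%:C * expi y - r%:C * expi y) < d / 2.
      by rewrite -mulrBl -rCB normcM normc_expi mulr1 normcR.
    apply: le_lt_trans (normc_le_distD (g z0) _ _) _.
    rewrite (splitr e1) ltrD//.
      apply: h; apply: le_lt_trans (normc_le_distD (r%:C * expi y) _ _) _.
      by rewrite (splitr d) ltrD.
    rewrite normc_distrC; apply: h; apply: lt_trans a1 _; lra.
move=> [d d0 h]; exists (Num.min (Num.min d r) eta); first by rewrite !lt_min d0 r0.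
move=> s; rewrite !lt_min => /andP[/andP[sd sr] se].
have s0 : 0 < s by move: sr; rewrite ltr_norml => /andP[? _]; lra.
have cc q : 0 < q -> `|q - r| < eta -> cct_circ f q.
  by move=> q0 qr z zq; apply: cf; rewrite -?normc_gt0 zq.
have cs : ct_on 0 (2 * pi) (fun t => f (s%:C * expi t) * (s%:C * expi t)).
  by apply: J_ct_on; [exact: ltW|exact: cc].
have cr : ct_on 0 (2 * pi) (fun t => f (r%:C * expi t) * (r%:C * expi t)).
  by apply: J_ct_on; [exact: ltW|apply: cc; rewrite // subrr normr0].
rewrite /J -cIB//.
have -> : e = (2 * pi - 0) * e1 by rewrite subr0 /e1 mulrC divfK// gt_eqF// twopi_gt0.
apply: cI_bound => //.
  by move=> x x1; apply: ctB; [exact: cs|exact: cr].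
by move=> x x1; apply/ltW/h.
Qed.

Lemma polar z : exists2 t, 0 <= t <= 2 * pi & z = (normc z)%:C * expi t.
Proof.
have p0 := pi_gt0 R.
have [->|z0] := eqVneq z 0.
  by exists 0; [rewrite lexx mulr_ge0// ltW|rewrite normc0 mul0r].
have r0 : 0 < normc z by rewrite normc_gt0.
pose y := z / (normc z)%:C.
have zE : z = (normc z)%:C * y by rewrite /y mulrC divfK// rC_eq0 gt_eqF.
have y1 : normc y = 1.
  by rewrite /y normcM normcV normcR (ger0_norm (ltW r0)) divff// gt_eqF.
have E : Re y ^+ 2 + Im y ^+ 2 = 1 by rewrite -normc_sqr y1 expr1n.
have yb : -1 <= Re y <= 1 by rewrite -ler_norml -y1 normc_Re.
have Es : sin (acos (Re y)) = `|Im y|.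
  rewrite sin_acos// (_ : 1 - Re y ^+ 2 = Im y ^+ 2) ?sqrtr_sqr//.
  by rewrite -E; ring.
have tb : 0 <= acos (Re y) <= pi by rewrite acos_ge0// acos_lepi.
have Ec : cos (acos (Re y)) = Re y by rewrite acosK// in_itv.
have [i0|i0] := leP 0 (Im y).
  exists (acos (Re y)); first by lra.
  by rewrite {1}zE /expi Ec Es ger0_norm//; case: (y).
exists (2 * pi - acos (Re y)); first by lra.
rewrite {1}zE addrC expiD expi2pi mulr1 /expi cosN sinN Ec Es ltr0_norm// opprK.
by case: (y).
Qed.

Lemma circle_bounded f r : cct_circ f r -> exists M : R, forall z, normc z = r -> normc (f z) <= M.
Proof.
move=> cf; have [r0|rn] := leP 0 r; last first.
  by exists 0 => z zr; have := normc_ge0 z; rewrite zr leNgt rn.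
have : (fun a b => exists M : R, forall x, a <= x <= b -> normc (f (r%:C * expi x)) <= M) 0 (2 * pi).
  apply: (@interval_cousin R (fun a b => exists M : R, forall x, a <= x <= b ->
    normc (f (r%:C * expi x)) <= M) 0 (2 * pi) twopi_gt0).
  - move=> s c t sc ct0 [M1 h1] [M2 h2]; exists (Num.max M1 M2) => x /andP[sx xt].
    have [xc|/ltW cx] := leP x c; rewrite le_max; first by rewrite h1// sx.
    by rewrite h2 ?orbT// cx.
  - move=> x _; have cx : cct f (r%:C * expi x) by apply: cf; exact: normc_circle.
    have [d d0 h] := ct_comp (@ct_circle r x) cx ltr01.
    exists d => // s t _ _ /andP[sx xt] ts; exists (normc (f (r%:C * expi x)) + 1) => y /andP[sy yt].
    have yx : `|y - x| < d by rewrite ltr_norml; apply/andP; split; lra.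
    rewrite -[f _](subrK (f (r%:C * expi x))) addrC; apply: le_trans (normcD _ _) _.
    by rewrite lerD2l; apply/ltW/h.
move=> [M h]; exists M => z zr; have [t tb ->] := polar z.
by rewrite zr; exact: h.
Qed.

End CircleIntegral.

(** * Cauchy's formula, Taylor expansion and principal parts at 0 *)

Section Laurent.
Context {R : realType}.
Implicit Types (f g h : R[i] -> R[i]) (z w u v : R[i]) (rho : R).

(** The centre is left out: the functions of interest come from the inverse of [D (a + z)], where
    [op_inv] takes a default value at z = 0. What happens at 0 is recorded by [bdd0] instead. *)
Definition hol f rho : Prop := forall z, 0 < normc z <= rho -> dif f z.

Definition bdd0 f : Prop := exists M eta : R, 0 < eta /\
  forall z, 0 < normc z < eta -> normc (f z) <= M.

Lemma hol_circ f rho : 0 < rho -> hol f rho -> cct_circ f rho.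
Proof. by move=> r0 hf z zr; apply/dif_cct/hf; rewrite zr r0 lexx. Qed.

Lemma dif_local f h z (eta : R) : 0 < eta -> (forall w, normc (w - z) < eta -> f w = h w) ->
  dif f z -> dif h z.
Proof.
move=> eta0 fh [u fu]; exists u => e e0; have [d d0 D] := fu e e0.
exists (Num.min d eta); first by rewrite lt_min d0.
move=> w; rewrite lt_min => /andP[/D wd we].
by rewrite -(fh w we) -(fh z) ?subrr ?normc0.
Qed.

Lemma bdd0_ext f g : (forall z, z != 0 -> f z = g z) -> bdd0 f -> bdd0 g.
Proof.
move=> fg [M [eta [e0 h]]]; exists M, eta; split => // z /andP[z0 ze].
by rewrite -fg; [apply: h; rewrite z0|rewrite -normc_gt0].
Qed.

Lemma bdd0_cst u : bdd0 (fun=> u).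
Proof. by exists (normc u), 1. Qed.

Lemma bdd0D f g : bdd0 f -> bdd0 g -> bdd0 (fun z => f z + g z).
Proof.
move=> [M [a [a0 hf]]] [N [b [b0 hg]]]; exists (M + N), (Num.min a b).
split=> [|z]; first by rewrite lt_min a0.
rewrite lt_min => /and3P[z0 za zb]; apply: le_trans (normcD _ _) _.
by apply: lerD; [apply: hf|apply: hg]; rewrite z0.
Qed.

Lemma bdd0M f g : bdd0 f -> bdd0 g -> bdd0 (fun z => f z * g z).
Proof.
move=> [M [a [a0 hf]]] [N [b [b0 hg]]]; exists (M * N), (Num.min a b).
split=> [|z]; first by rewrite lt_min a0.
rewrite lt_min => /and3P[z0 za zb]; rewrite normcM.
by apply: ler_pM; rewrite ?normc_ge0//; [apply: hf|apply: hg]; rewrite z0.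
Qed.

Lemma bdd0_sum (I : finType) (F : I -> R[i] -> R[i]) : (forall i, bdd0 (F i)) ->
  bdd0 (fun z => \sum_i F i z).
Proof.
move=> bF; rewrite (_ : (fun z => _) = (\sum_i F i)); last first.
  by apply/funext => z; rewrite fct_sumE.
elim/big_ind: _ => //; first exact: bdd0_cst.
by move=> x y; exact: bdd0D.
Qed.

Lemma bdd0_exp n : bdd0 (fun z => z ^+ n).
Proof.
exists 1, 1; split=> // z /andP[z0 z1]; rewrite normcX.
by apply: exprn_ile1; [exact: ltW|exact: ltW].
Qed.

Lemma J_invr rho : 0 < rho -> J (fun z => z^-1) rho = (2 * pi)%:C.
Proof.
move=> r0; rewrite /J (@cI_ext _ _ _ _ (fun=> 1)); last first.
  by move=> x _; rewrite mulVf// circle_neq0.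
by rewrite cI_cst ?(ltW twopi_gt0)// subr0 mulr1.
Qed.

Lemma dif_subinv z w : z != w -> dif (fun x => (x - w)^-1) z.
Proof.
move=> zw; apply: dif_inv; last by rewrite subr_eq0.
by apply: difB; [exact: dif_id|exact: dif_cst].
Qed.

Lemma normc_neq z w : normc z != normc w -> z != w.
Proof. by apply: contra => /eqP ->. Qed.

Lemma normc_subr_ge z w : normc z - normc w <= normc (z - w).
Proof. by rewrite lerBlDr -[in leLHS](subrK w z) normcD. Qed.

(** On a large circle (z - w)^-1 differs from z^-1 by w / (z (z - w)), whose integral tends to 0
    with growing radius, and by [J_const] the radius does not matter. *)
Lemma J_subinv rho w : normc w < rho -> J (fun z => (z - w)^-1) rho = (2 * pi)%:C.
Proof.
move=> wr; have w0 := normc_ge0 w; have r0 := le_lt_trans w0 wr.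
apply/eqP; rewrite -subr_eq0 -normc_eq0 eq_le normc_ge0 andbT.
apply/ler_addgt0Pl => e e0; rewrite addr0.
have p0 := @twopi_gt0 R.
pose k := 2 * pi * normc w; have k0 : 0 <= k by rewrite mulr_ge0// ltW.
(* The integral of the difference is at most k / (r - |w|), and r - |w| exceeds k / e because |w| <
   rho. *)
pose r := rho + k / e.
have rr : rho <= r by rewrite lerDl divr_ge0// ltW.
have r'0 : 0 < r := lt_le_trans r0 rr.
have rw : k / e < r - normc w by rewrite /r; lra.
have rw0 : 0 < r - normc w by apply: le_lt_trans rw; rewrite divr_ge0// ltW.
have d1 (z : R[i]) : rho <= normc z -> dif (fun z => (z - w)^-1) z.
  by move=> zr; apply/dif_subinv/normc_neq; rewrite gt_eqF// (lt_le_trans wr).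
have d2 (z : R[i]) : 0 < normc z -> dif (fun z => z^-1) z.
  by rewrite normc_gt0 => z0; apply: dif_inv => //; exact: dif_id.
rewrite (@J_const _ _ rho r)//; last by move=> z /andP[? _]; exact: d1.
have c1 : cct_circ (fun z => (z - w)^-1) r by move=> z zr; apply/dif_cct/d1; rewrite zr.
have c2 : cct_circ (fun z => z^-1) r by move=> z zr; apply/dif_cct/d2; rewrite zr.
rewrite -(J_invr r'0) -JB//; last exact: ltW.
rewrite (@J_ext _ _ (fun z => w * (z^-1 * (z - w)^-1))); last 2 first.
- exact: ltW.
- move=> z zr; have z0 : z != 0 by rewrite -normc_gt0 zr.
  have zw : z - w != 0 by rewrite subr_eq0 normc_neq// zr gt_eqF// -subr_gt0.
  by field; rewrite zw z0.
apply: le_trans (@J_bound _ _ _ (normc w * (r^-1 * (r - normc w)^-1)) (ltW r'0) _ _) _.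
- move=> z zr; apply: dif_cct; apply: dif_mul; first exact: dif_cst.
  by apply: dif_mul; [apply: d2; rewrite zr|apply: d1; rewrite zr].
- move=> z zr; rewrite !normcM !normcV zr ler_wpM2l// ler_wpM2l ?invr_ge0 ?(ltW r'0)//.
  by rewrite lef_pV2 ?posrE// -?zr ?normc_subr_ge// normc_gt0 subr_eq0 normc_neq// zr gt_eqF// -subr_gt0.
rewrite (_ : _ * _ = k / (r - normc w)); last by rewrite /k; field; rewrite !gt_eqF.
by rewrite ler_pdivrMr// mulrC -ler_pdivrMr// ltW.
Qed.

(** Subtracting [g w] leaves the difference quotient [G], whose integral is 0 for radii below |w| by
    [J_small], constant for radii above |w| by [J_const], and continuous at |w| by [J_ct]. *)
Lemma cauchy_formula g rho w : hol g rho -> bdd0 g -> 0 < normc w < rho ->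
  J (fun z => g z * (z - w)^-1) rho = (2 * pi)%:C * g w.
Proof.
move=> hg [M [eta [eta0 bg]]] /andP[w0 wr]; have r0 := lt_trans w0 wr.
have [g' dg'] : dif g w by apply: hg; rewrite w0 ltW.
pose G z := if z == w then g' else (g z - g w) * (z - w)^-1.
have dG z : 0 < normc z <= rho -> z != w -> dif G z.
  move=> zr zw.
  apply: (@dif_local (fun z => (g z - g w) * (z - w)^-1) _ _ (normc (z - w))).
  - by rewrite normc_gt0 subr_eq0.
  - move=> x xz; rewrite /G; case: eqP xz => // ->.
    by rewrite normc_distrC ltxx.
  - apply: dif_mul; last exact: dif_subinv.
    by apply: difB; [exact: hg|exact: dif_cst].
have cG : cct G w.
  move=> e e0; have [d d0 D] := dg' (e / 2) (ltac:(by rewrite divr_gt0)).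
  exists d => // z zd; rewrite /G eqxx; case: eqP => [_|/eqP zw]; first by rewrite subrr normc0.
  have zw0 : 0 < normc (z - w) by rewrite normc_gt0 subr_eq0.
  have zw1 : z - w != 0 by rewrite subr_eq0.
  have -> : (g z - g w) * (z - w)^-1 - g' = (g z - g w - (z - w) * g') / (z - w).
    by field.
  rewrite normcM normcV ltr_pdivrMr//.
  apply: le_lt_trans (D z zd) _; rewrite ltr_pM2r//; lra.
have Gs s : 0 < s -> s < normc w -> J G s = 0.
  move=> s0 sw; apply: (@J_small _ _ _ ((M + normc (g w)) * (normc w / 2)^-1) (Num.min eta (normc w / 2))) => //.
  - by rewrite lt_min eta0 divr_gt0.
  - move=> z /andP[z0 zs]; have zw : normc z < normc w := le_lt_trans zs sw.
    apply: dG; first by rewrite z0 (ltW (lt_trans zw wr)).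
    by apply: normc_neq; rewrite lt_eqF.
  - move=> z; rewrite lt_min => /and3P[z0 ze zw].
    have zw' : z != w by apply: normc_neq; rewrite lt_eqF//; apply: lt_trans zw _; lra.
    rewrite /G (negPf zw') normcM normcV.
    have a1 : normc w / 2 <= normc (z - w).
      by have := normc_subr_ge w z; rewrite normc_distrC; lra.
    apply: ler_pM; rewrite ?invr_ge0 ?normc_ge0//.
      by apply: le_trans (normcB _ _) _; rewrite lerD2r; apply: bg; rewrite z0.
    by rewrite lef_pV2// posrE ?divr_gt0//; apply: lt_le_trans a1; rewrite divr_gt0.
have Gr s : normc w < s -> s <= rho -> J G s = J G rho.
  move=> ws sr; apply: J_const => //; first exact: lt_trans ws.
  move=> z /andP[sz zr]; have wz := lt_le_trans ws sz.
  apply: dG; first by rewrite zr (lt_trans w0 wz).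
  by apply: normc_neq; rewrite gt_eqF.
have cG' z : z != 0 -> `|normc z - normc w| < rho - normc w -> cct G z.
  move=> z0 zr; have [->//|zw] := eqVneq z w.
  apply: dif_cct; apply: dG => //; rewrite normc_gt0 z0.
  by move: zr; rewrite ltr_norml => /andP[_ ?]; lra.
have JG0 : J G rho = 0.
  apply/eqP; rewrite -normc_eq0 eq_le normc_ge0 andbT.
  apply/ler_addgt0Pl => e e0; rewrite addr0.
  have rw0 : 0 < rho - normc w by rewrite subr_gt0.
  have [d d0 D] := J_ct w0 rw0 cG' (ltac:(by rewrite divr_gt0) : 0 < e / 2).
  (* The radii |w| - k and |w| + k stay positive and within rho; the integral of [G] is 0 on the
     first and [J G rho] on the second. *)
  pose k := Num.min (d / 2) (Num.min ((rho - normc w) / 2) (normc w / 2)).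
  have k0 : 0 < k by rewrite !lt_min !divr_gt0.
  have kd : k <= d / 2 by rewrite ge_min lexx.
  have kr : k <= (rho - normc w) / 2 by rewrite ge_min; apply/orP; right; rewrite ge_min lexx.
  have kw : k <= normc w / 2 by rewrite ge_min; apply/orP; right; rewrite ge_min lexx orbT.
  have := D (normc w + k); have := D (normc w - k).
  rewrite (Gs (normc w - k)) ?(Gr (normc w + k)); try lra.
  rewrite (_ : normc w - k - normc w = - k); last by ring.
  rewrite (_ : normc w + k - normc w = k); last by ring.
  rewrite normrN (ger0_norm (ltW k0)) sub0r normcN => D1 D2.
  rewrite -[J G rho](subrK (J G (normc w))); apply: le_trans (normcD _ _) _.
  rewrite (splitr e); apply: lerD; [apply: D2|apply: D1]; lra.
have rg : cct_circ g rho by exact: hol_circ.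
have dif_i : cct_circ (fun z => (z - w)^-1) rho.
  by move=> z zr; apply/dif_cct/dif_subinv/normc_neq; rewrite zr gt_eqF.
have dG' : cct_circ G rho.
  by move=> z zr; apply/dif_cct/dG; rewrite ?zr ?r0 ?lexx//; apply: normc_neq; rewrite zr gt_eqF.
rewrite (@J_ext _ _ (fun z => g w * (z - w)^-1 + G z)); last 2 first.
- exact: ltW.
- move=> z zr; have zw : z != w by apply: normc_neq; rewrite zr gt_eqF.
  by rewrite /G (negPf zw); ring.
by rewrite J_lin ?JG0 ?J_subinv ?addr0 1?mulrC// ltW.
Qed.

(** The factor rho / (rho - |w|) comes from estimating the Cauchy kernel directly. It is at most 2
    on the half disk, which suffices for boundedness near 0. *)
Lemma cauchy_bound g rho w (M : R) : hol g rho -> bdd0 g -> 0 < normc w < rho ->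
  (forall z, normc z = rho -> normc (g z) <= M) -> normc (g w) <= M * rho / (rho - normc w).
Proof.
move=> hg bg wr gM; have E := cauchy_formula hg bg wr; have /andP[w0 wr'] := wr.
have r0 := lt_trans w0 wr'; have p0 := @twopi_gt0 R.
have rw0 : 0 < rho - normc w by rewrite subr_gt0.
rewrite -(ler_pM2l p0).
have -> : 2 * pi * normc (g w) = normc ((2 * pi)%:C * g w) by rewrite normcM normcR ger0_norm// ltW.
rewrite -E; apply: le_trans (@J_bound _ _ _ (M * (rho - normc w)^-1) (ltW r0) _ _) _.
- move=> z zr; apply: dif_cct; apply: dif_mul; first by apply: hg; rewrite zr r0 lexx.
  by apply/dif_subinv/normc_neq; rewrite zr gt_eqF.
- move=> z zr; rewrite normcM normcV; apply: ler_pM; rewrite ?invr_ge0 ?normc_ge0 ?gM//.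
  rewrite lef_pV2 ?posrE// -?zr ?normc_subr_ge// normc_gt0 subr_eq0 normc_neq// zr gt_eqF//.
have -> : rho * (M * (rho - normc w)^-1) = M * rho / (rho - normc w) by ring.
exact: lexx.
Qed.

(** The constant is Cauchy's integral taken at 0; subtracting it from the formula at [w] leaves a
    factor [w] times a bounded integral. The quotient is again holomorphic off 0 and bounded there,
    so that the lemma can be iterated. *)
Lemma removable g rho : 0 < rho -> hol g rho -> bdd0 g ->
  exists c : R[i], bdd0 (fun z => (g z - c) / z).
Proof.
move=> r0 hg bg; have [M gM] := circle_bounded (hol_circ r0 hg).
have p0 := @twopi_gt0 R.
have p1 : (2 * pi)%:C != 0 :> R[i] by rewrite rC_eq0 gt_eqF.
exists ((2 * pi)%:C^-1 * J (fun z => g z * z^-1) rho).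
exists (M * 2 / rho), (rho / 2); split=> [|w /andP[w0 wr]]; first by rewrite divr_gt0.
have wr' : normc w < rho by lra.
have wn0 : w != 0 by rewrite -normc_gt0.
have E := cauchy_formula hg bg (ltac:(by rewrite w0 wr') : 0 < normc w < rho).
have cc : cct_circ (fun z => g z * (z - w)^-1) rho.
  move=> z zr; apply: dif_cct; apply: dif_mul; first by apply: hg; rewrite zr r0 lexx.
  by apply/dif_subinv/normc_neq; rewrite zr gt_eqF.
have cc' : cct_circ (fun z => g z * z^-1) rho.
  move=> z zr; apply: dif_cct; apply: dif_mul; first by apply: hg; rewrite zr r0 lexx.
  by apply: dif_inv; [exact: dif_id|rewrite -normc_gt0 zr].
have {}E : (2 * pi)%:C * (g w - (2 * pi)%:C^-1 * J (fun z => g z * z^-1) rho) =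
    w * J (fun z => g z * (z^-1 * (z - w)^-1)) rho.
  rewrite mulrBr mulVKf// -E -JB//; last exact: ltW.
  rewrite -J_scale; last 2 first.
  - exact: ltW.
  - move=> z zr; apply: dif_cct; apply: dif_mul; first by apply: hg; rewrite zr r0 lexx.
    apply: dif_mul; first by apply: dif_inv; [exact: dif_id|rewrite -normc_gt0 zr].
    by apply/dif_subinv/normc_neq; rewrite zr gt_eqF.
  apply: J_ext; first exact: ltW.
  move=> z zr; have z0 : z != 0 by rewrite -normc_gt0 zr.
  have zw : z - w != 0 by rewrite subr_eq0 normc_neq// zr gt_eqF.
  by field; rewrite zw z0.
rewrite -(ler_pM2l p0).
have -> : forall y : R[i], 2 * pi * normc y = normc ((2 * pi)%:C * y).
  by move=> y; rewrite normcM normcR (ger0_norm (ltW p0)).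
rewrite mulrA E mulrAC divff// mul1r.
apply: le_trans (@J_bound _ _ _ (M * (rho^-1 * (rho / 2)^-1)) (ltW r0) _ _) _.
- move=> z zr; apply: dif_cct; apply: dif_mul; first by apply: hg; rewrite zr r0 lexx.
  apply: dif_mul; first by apply: dif_inv; [exact: dif_id|rewrite -normc_gt0 zr].
  by apply/dif_subinv/normc_neq; rewrite zr gt_eqF.
- move=> z zr; rewrite !normcM !normcV zr.
  have a1 : rho / 2 <= normc (z - w) by have := normc_subr_ge z w; lra.
  apply: ler_pM; rewrite ?normc_ge0 ?gM ?mulr_ge0 ?invr_ge0 ?normc_ge0 ?(ltW r0)//.
  rewrite ler_wpM2l ?invr_ge0 ?(ltW r0)// lef_pV2// posrE ?divr_gt0//.
  by apply: lt_le_trans a1; rewrite divr_gt0.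
rewrite le_eqVlt; apply/orP; left; apply/eqP; field.
by rewrite gt_eqF.
Qed.

(** Each application of [removable] to the current quotient produces the next coefficient and
    divides by one more power of [z]. *)
Lemma taylor g rho N : 0 < rho -> hol g rho -> bdd0 g ->
  exists al : nat -> R[i], bdd0 (fun z => (g z - \sum_(s < N) al s * z ^+ s) / z ^+ N).
Proof.
move=> r0 hg bg; elim: N => [|N [al IH]].
  by exists (fun=> 0); apply: bdd0_ext bg => z _; rewrite big_ord0 subr0 expr0 divr1.
have [|c bc] := removable r0 _ IH.
  move=> z /andP[z0 zr]; apply: dif_mul.
    apply: difB; first by apply: hg; rewrite z0.
    by apply: dif_sum => s; apply: dif_mul; [exact: dif_cst|apply: dif_exp; exact: dif_id].
  apply: dif_inv; first by apply: dif_exp; exact: dif_id.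
  by rewrite expf_neq0// -normc_gt0.
exists (fun s => if s == N then c else al s).
apply: bdd0_ext bc => z z0; rewrite big_ord_recr/= eqxx.
have -> : \sum_(i < N) (if (i : nat) == N then c else al i) * z ^+ i = \sum_(i < N) al i * z ^+ i.
  by apply: eq_bigr => i _; rewrite ltn_eqF.
by rewrite exprS; field; rewrite z0 expf_neq0.
Qed.

(** Without antiderivatives: for e <= l the integrand is bounded at 0, for e > l + 1 it decays fast
    enough for the circle to be sent to infinity, and e = l + 1 is the case z^-1. *)
Lemma J_monomial rho (e l : nat) : 0 < rho ->
  J (fun z => (z ^+ e)^-1 * z ^+ l) rho = if e == l.+1 then (2 * pi)%:C else 0.
Proof.
move=> r0; have p0 := @twopi_gt0 R.
have [el|le] := leqP e l.
  rewrite ltn_eqF//; apply: (@J_small _ _ _ 1 1) => // z.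
    move=> /andP[z0 _]; apply: dif_mul; last by apply: dif_exp; exact: dif_id.
    apply: dif_inv; first by apply: dif_exp; exact: dif_id.
    by rewrite expf_neq0// -normc_gt0.
  move=> /andP[z0 z1]; have zn0 : z != 0 by rewrite -normc_gt0.
  rewrite -(subnK el) exprD mulrC mulfK ?expf_neq0// normcX.
  by apply: exprn_ile1; exact: ltW.
have E z : z != 0 -> (z ^+ e)^-1 * z ^+ l = (z ^+ (e - l))^-1.
  by move=> z0; rewrite -{1}(subnK (ltnW le)) exprD invfM mulfVK// expf_neq0.
rewrite (@J_ext _ _ (fun z => (z ^+ (e - l))^-1)); last 2 first.
- exact: ltW.
- by move=> z zr; rewrite E// -normc_gt0 zr.
have [->|el] := eqVneq e l.+1.
  by rewrite subSn// subnn; exact: J_invr.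
have {}le : (l.+1 < e)%N by rewrite ltn_neqAle eq_sym el.
have [m Em] : exists m, (e - l = m.+2)%N.
  by exists (e - l.+2)%N; rewrite -[in LHS](subnK le) !addnS -!addSn addnK.
rewrite Em; apply/eqP; rewrite -normc_eq0 eq_le normc_ge0 andbT.
apply/ler_addgt0Pl => d d0; rewrite addr0.
(* The integral on radius r is at most 2 pi / r^(m + 1), and r >= 1 reduces this to 2 pi / r <=
   d. *)
pose r := Num.max rho (Num.max 1 (2 * pi / d)).
have rr : rho <= r by rewrite le_max lexx.
have r'0 : 0 < r := lt_le_trans r0 rr.
have r1 : 1 <= r by rewrite le_max; apply/orP; right; rewrite le_max lexx.
have rd : 2 * pi / d <= r by rewrite le_max; apply/orP; right; rewrite le_max lexx orbT.
have dm z : rho <= normc z -> dif (fun z => (z ^+ m.+2)^-1) z.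
  move=> zr; apply: dif_inv; first by apply: dif_exp; exact: dif_id.
  by rewrite expf_neq0// -normc_gt0 (lt_le_trans r0).
rewrite (@J_const _ _ rho r)//; last by move=> z /andP[? _]; exact: dm.
apply: le_trans (@J_bound _ _ _ (r ^+ m.+2)^-1 (ltW r'0) _ _) _.
- by move=> z zr; apply/dif_cct/dm; rewrite zr.
- by move=> z zr; rewrite normcV normcX zr.
rewrite exprS invfM mulVKf ?gt_eqF// ler_pdivrMr ?exprn_gt0//.
apply: (@le_trans _ _ (d * r)); first by rewrite (mulrC d) -ler_pdivrMr.
by rewrite ler_pM2l// exprS ler_peMr ?(ltW r'0)// exprn_ege1.
Qed.

(* the principal part at 0, of order at most [N] *)
Definition ppart N rho f z : R[i] :=
  \sum_(l < N) (z ^+ l.+1)^-1 * ((2 * pi)%:C^-1 * J (fun x => f x * x ^+ l) rho).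

(** Integrating against x^l extracts the coefficient of x^-(l + 1) and kills the bounded part [h].
    So the integrals in [ppart] recover any finite polar expansion of [f], whatever form it is given
    in. *)
Lemma ppart_sum N rho f h (I : finType) (a : I -> R[i]) (e : I -> nat) z : 0 < rho ->
  hol f rho -> bdd0 h -> (forall q, 0 < e q <= N)%N ->
  (forall x, x != 0 -> f x = \sum_q a q * (x ^+ e q)^-1 + h x) ->
  ppart N rho f z = \sum_q a q * (z ^+ e q)^-1.
Proof.
move=> r0 hf bh eN fE.
have de n x : 0 < normc x -> dif (fun x => (x ^+ n)^-1) x.
  move=> x0; apply: dif_inv; first by apply: dif_exp; exact: dif_id.
  by rewrite expf_neq0// -normc_gt0.
have dl n x : dif (fun x => x ^+ n) x by apply: dif_exp; exact: dif_id.
have hh : hol h rho.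
  move=> x xr; have /andP[x0 _] := xr.
  have d1 : dif (fun x => f x - \sum_q a q * (x ^+ e q)^-1) x.
    apply: difB; first exact: hf.
    by apply: dif_sum => q; apply: dif_mul; [exact: dif_cst|exact: de].
  apply: dif_local d1 => [|w wx]; first exact: x0.
  rewrite fE; first by rewrite addrAC subrr add0r.
  by apply: contraTneq wx => ->; rewrite sub0r normcN ltxx.
have p1 : (2 * pi)%:C != 0 :> R[i] by rewrite rC_eq0 gt_eqF// twopi_gt0.
have JE l : (2 * pi)%:C^-1 * J (fun x => f x * x ^+ l) rho = \sum_q a q * (e q == l.+1)%:R.
  rewrite (@J_ext _ _ (fun x => \sum_q a q * ((x ^+ e q)^-1 * x ^+ l) + h x * x ^+ l)); last 2 first.
  - exact: ltW.
  - move=> x xr; rewrite fE -?normc_gt0 ?xr// mulrDl mulr_suml; congr (_ + _).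
    by apply: eq_bigr => q _; rewrite mulrA.
  have cq q : cct_circ (fun x => a q * ((x ^+ e q)^-1 * x ^+ l)) rho.
    move=> x xr; apply: dif_cct; apply: dif_mul; first exact: dif_cst.
    by apply: dif_mul; [apply: de; rewrite xr|exact: dl].
  have cq' q : cct_circ (fun x => (x ^+ e q)^-1 * x ^+ l) rho.
    by move=> x xr; apply: dif_cct; apply: dif_mul; [apply: de; rewrite xr|exact: dl].
  have ch : cct_circ (fun x => h x * x ^+ l) rho.
    by move=> x xr; apply: dif_cct; apply: dif_mul; [apply: hh; rewrite xr r0 lexx|exact: dl].
  rewrite JD//; [|exact: ltW|]; last first.
    move=> x xr; apply: dif_cct; apply: dif_sum => q; apply: dif_mul; first exact: dif_cst.
    by apply: dif_mul; [apply: de; rewrite xr|exact: dl].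
  rewrite J_sum//; last exact: ltW.
  have -> : J (fun x => h x * x ^+ l) rho = 0.
    have [M [eta [eta0 b]]] := bdd0M bh (bdd0_exp l).
    apply: J_small r0 eta0 _ b => x xr; apply: dif_mul; [exact: hh|exact: dl].
  rewrite addr0 mulr_sumr; apply: eq_bigr => q _.
  rewrite J_scale ?(ltW r0)// J_monomial//; case: eqP => _; last by rewrite !mulr0.
  by rewrite mulr1 mulrCA mulVf// mulr1.
rewrite /ppart; under eq_bigr do rewrite JE mulr_sumr.
rewrite exchange_big/=; apply: eq_bigr => q _.
have /andP[e0 eN'] := eN q.
(* The summand of index l carries the exponent l + 1, so the pole of order [e q] sits at index
   [e q - 1]. *)
have lt : ((e q).-1 < N)%N by rewrite prednK.
rewrite (bigD1 (Ordinal lt))//= big1 ?addr0.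
  by rewrite prednK// eqxx mulr1 mulrC.
move=> l lq; rewrite (_ : (e q == l.+1) = false) ?mulr0//.
by apply: contraNF lq => /eqP E; apply/eqP/val_inj; rewrite /= E.
Qed.

End Laurent.

(** * Inner products, norms and dual bases *)

Record inner_product_norm (R : realType) (V : lmodType R[i]) (ip : V -> V -> R[i])
    (nrm : V -> R) : Prop := InnerProductNorm {
  ip_linear : forall (a : R[i]) u v w, ip (a *: u + v) w = a * ip u w + ip v w;
  ip_conjC : forall u v, ip u v = conjc (ip v u);
  ip_ge0 : forall u, 0 <= Re (ip u u);
  ip_nrm : forall u, nrm u = Num.sqrt (Re (ip u u));
  ip_definite : forall u, nrm u = 0 -> u = 0 }.

Section Conjugate.
Context {R : realType}.
Implicit Types x y : R[i].

Lemma conjcD x y : conjc (x + y) = conjc x + conjc y.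
Proof. exact: rmorphD. Qed.
Lemma conjcM x y : conjc (x * y) = conjc x * conjc y.
Proof. exact: rmorphM. Qed.
Lemma conjcN x : conjc (- x) = - conjc x.
Proof. exact: rmorphN. Qed.
Lemma conjcV x : conjc x^-1 = (conjc x)^-1.
Proof. exact: fmorphV. Qed.
Lemma conjc0 : conjc (0 : R[i]) = 0.
Proof. exact: rmorph0. Qed.
Lemma conjcR (a : R) : conjc (a%:C : R[i]) = a%:C.
Proof. by apply/eqP; rewrite eq_complex /= oppr0 !eqxx. Qed.
Lemma conjc_sum (I : Type) (s : seq I) (F : I -> R[i]) :
  conjc (\sum_(i <- s) F i) = \sum_(i <- s) conjc (F i).
Proof. exact: rmorph_sum. Qed.

End Conjugate.

Section InnerProduct.
Context {R : realType} {V : lmodType R[i]} {ip : V -> V -> R[i]} {nrm : V -> R}.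
Hypothesis H : inner_product_norm ip nrm.
Implicit Types (u v w : V) (a : R[i]).

Lemma nrm_ge0 u : 0 <= nrm u.
Proof. by rewrite (ip_nrm H) sqrtr_ge0. Qed.

Lemma ipDl u v w : ip (u + v) w = ip u w + ip v w.
Proof. by rewrite -[u]scale1r (ip_linear H) mul1r scale1r. Qed.

Lemma ip0l w : ip 0 w = 0.
Proof. by have /eqP := ipDl 0 0 w; rewrite addr0 -subr_eq0 opprD addrA subrr add0r oppr_eq0 => /eqP. Qed.

Lemma ipZl a u w : ip (a *: u) w = a * ip u w.
Proof. by rewrite -[a *: u]addr0 (ip_linear H) ip0l addr0. Qed.

Lemma ipDr u v w : ip w (u + v) = ip w u + ip w v.
Proof. by rewrite (ip_conjC H) ipDl conjcD -!(ip_conjC H). Qed.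

Lemma ipZr a u w : ip w (a *: u) = conjc a * ip w u.
Proof. by rewrite (ip_conjC H) ipZl conjcM -(ip_conjC H). Qed.

Lemma ip_sumr (I : Type) (s : seq I) (F : I -> V) w : ip w (\sum_(i <- s) F i) = \sum_(i <- s) ip w (F i).
Proof.
elim: s => [|i s IH]; last by rewrite !big_cons ipDr IH.
by rewrite !big_nil (ip_conjC H) ip0l conjc0.
Qed.

Lemma ip_sqr u : ip u u = (nrm u ^+ 2)%:C.
Proof.
rewrite (ip_nrm H) sqr_sqrtr ?(ip_ge0 H)//; have := ip_conjC H u u.
case: (ip u u) => x y /= [yy]; apply/eqP; rewrite eq_complex /= eqxx /=.
by apply/eqP; move: yy; lra.
Qed.

Lemma nrmZ a u : nrm (a *: u) = normc a * nrm u.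
Proof.
apply/eqP; rewrite -(@eqrXn2 _ 2) ?nrm_ge0 ?mulr_ge0 ?normc_ge0 ?nrm_ge0//.
have : ((nrm (a *: u) ^+ 2)%:C : R[i]) = ((normc a * nrm u) ^+ 2)%:C.
  by rewrite -ip_sqr ipZl ipZr mulrA mulc_conj ip_sqr exprMn; exact: esym (rCM _ _).
by move=> /(congr1 (@complex.Re R))/= ->.
Qed.

Lemma nrm0 : nrm 0 = 0.
Proof. by rewrite -(scale0r (0 : V)) nrmZ normc0 mul0r. Qed.

Lemma nrm_gt0 u : u != 0 -> 0 < nrm u.
Proof.
move=> u0; rewrite lt_neqAle nrm_ge0 andbT eq_sym; apply: contra u0 => /eqP nu.
by rewrite (ip_definite H nu).
Qed.

Lemma cauchy_schwarz u v : normc (ip u v) <= nrm u * nrm v.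
Proof.
have [->|v0] := eqVneq v 0.
  by rewrite (ip_conjC H) ip0l conjc0 normc0 nrm0 mulr0.
have nv0 := nrm_gt0 v0; have nv2 : 0 < nrm v ^+ 2 by rewrite exprn_gt0.
(* [x] is the component of [u] orthogonal to [v]; its squared norm is nonnegative. *)
pose c := ip u v; pose x := (- (c / (nrm v ^+ 2)%:C)) *: v + u.
have vn : (nrm v ^+ 2)%:C != 0 :> R[i] by rewrite rC_eq0 gt_eqF.
have E : ip x x = ((nrm u ^+ 2 - normc c ^+ 2 / nrm v ^+ 2)%:C : R[i]).
  have cv : ip v u = conjc c by rewrite /c -(ip_conjC H).
  have cr := conjcR (nrm v ^+ 2).
  rewrite /x !(ipDl, ipDr, ipZl, ipZr) !ip_sqr cv -/c conjcN conjcM conjcV cr.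
  rewrite rCB (_ : (normc c ^+ 2 / nrm v ^+ 2)%:C = (normc c ^+ 2)%:C / (nrm v ^+ 2)%:C); last first.
    by rewrite rCM; congr (_ * _); rewrite -fmorphV.
  rewrite -mulc_conj; move: (conjc c) vn => d; move: ((nrm v ^+ 2)%:C) => N N0.
  by field.
have : 0 <= nrm u ^+ 2 - normc c ^+ 2 / nrm v ^+ 2.
  by have := ip_ge0 H x; rewrite E.
rewrite subr_ge0 ler_pdivrMr// -exprMn.
by rewrite ler_pXn2r ?nnegrE ?normc_ge0 ?mulr_ge0 ?nrm_ge0.
Qed.

Lemma nrmD u v : nrm (u + v) <= nrm u + nrm v.
Proof.
rewrite -(@ler_pXn2r _ 2)// ?nnegrE ?addr_ge0 ?nrm_ge0//.
have E : (nrm (u + v) ^+ 2) = nrm u ^+ 2 + nrm v ^+ 2 + 2 * Re (ip u v).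
  have : ((nrm (u + v) ^+ 2)%:C : R[i]) = (nrm u ^+ 2)%:C + (nrm v ^+ 2)%:C + (ip u v + conjc (ip u v)).
    by rewrite -!ip_sqr !(ipDl, ipDr) (ip_conjC H v u); ring.
  move=> /(congr1 (@complex.Re R)); rewrite !ReD /= => ->; congr (_ + _).
  by case: (ip u v) => p q /=; ring.
rewrite E sqrrD; have := cauchy_schwarz u v; have := normc_Re (ip u v).
by have := ler_norm (Re (ip u v)); rewrite mulr2n; lra.
Qed.

Lemma nrmN u : nrm (- u) = nrm u.
Proof. by rewrite -scaleN1r nrmZ normcN normc1 mul1r. Qed.

Lemma nrmB u v : nrm (u - v) <= nrm u + nrm v.
Proof. by rewrite -(nrmN v) nrmD. Qed.

(** A row annihilated by the Gram matrix gives a combination of the [b k] orthogonal to every [b j],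
    hence to itself, hence zero. With [g] the inverse matrix, the functionals \sum_j ip v (b j) g_ji
    are dual to [b] and defined and bounded on the whole space. *)
Lemma gram_dual_basis n (b : 'I_n -> V) : lin_indep b ->
  exists g : 'M[R[i]]_n, forall k i, \sum_j ip (b k) (b j) * g j i = (k == i)%:R.
Proof.
move=> lb; pose G := \matrix_(i, j) ip (b i) (b j).
have GE k j : G k j = ip (b k) (b j) by rewrite mxE.
have uG : G \in unitmx.
  rewrite -row_free_unit -kermx_eq0; apply/eqP/row_matrixP => i; rewrite row0.
  have : row i (kermx G) *m G = 0 by apply/sub_kermxP; exact: row_sub.
  move: (row i _) => x xG.
  pose v := \sum_k x 0 k *: b k.
  have vj j : ip v (b j) = 0.
    have : (x *m G) 0 j = 0 by rewrite xG mxE.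
    rewrite mxE => <-; rewrite /v (ip_conjC H) ip_sumr conjc_sum.
    by apply: eq_bigr => k _; rewrite ipZr conjcM conjcK -(ip_conjC H) GE.
  have v0 : v = 0.
    apply: (ip_definite H); apply/eqP; rewrite -sqrf_eq0 -rC_eq0 -ip_sqr.
    by rewrite {2}/v ip_sumr big1// => l _; rewrite ipZr vj mulr0.
  by apply/rowP => k; rewrite [RHS]mxE; exact: lb v0 k.
exists (invmx G) => k i; have := mulmxV uG; move=> /matrixP/(_ k i).
by rewrite !mxE => <-; apply: eq_bigr => j _; rewrite mxE.
Qed.

End InnerProduct.

(** * Traces of matrices as sums of eigenvalues *)

Section FiniteRankTrace.
Context {F : closedFieldType}.

Lemma mxtrace_eigenvalues m (A : 'M[F]_m) :
  exists s : seq F, [/\ size s = m, \tr A = \sum_(x <- s) x & forall x, x \in s -> eigenvalue A x].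
Proof.
(* The empty matrix is treated apart: the trace is read off a coefficient of the characteristic
   polynomial in positive size. *)
case: m A => [|m] A; first by exists [::]; rewrite big_nil; split => //; rewrite /mxtrace big_ord0.
have [s sE] := closed_field_poly_normal (char_poly A).
rewrite (monicP (char_poly_monic A)) scale1r in sE.
have ss : size s = m.+1.
  by have := size_char_poly A; rewrite sE size_prod_XsubC => -[].
exists s; split => // [|x xs].
  have := char_poly_trace A (ltn0Sn m); rewrite sE -[X in X.-1]ss coefPn_prod_XsubC ?ss//.
  by move=> /oppr_inj ->.
by rewrite eigenvalue_root_char sE root_prod_XsubC.
Qed.

(* Sylvester: the nonzero eigenvalues of [B *m A] are eigenvalues of [A *m B]. *)
Lemma mxtrace_mul_eigenvalues n m (A : 'M[F]_(n, m)) (B : 'M[F]_(m, n)) :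
  exists s : seq F, [/\ size s = m, \tr (A *m B) = \sum_(x <- s) x &
    forall x, x \in s -> x != 0 -> exists2 y : 'rV[F]_n, y != 0 & y *m (A *m B) = x *: y].
Proof.
have [s [ss sE sP]] := mxtrace_eigenvalues (B *m A).
exists s; split => //; first by rewrite mxtrace_mulC.
move=> x xs x0; have /eigenvalueP[v vE v0] := sP x xs.
exists (v *m B); last by rewrite mulmxA -(mulmxA v) vE scalemxAl.
apply: contra_neq v0 => vB; move: vE; rewrite mulmxA vB mul0mx => /esym/eqP.
by rewrite scaler_eq0 (negPf x0) => /eqP.
Qed.

End FiniteRankTrace.

(** * Differentiable families of operators and of functionals *)

Section Operators.
Context {R : realType} {V : lmodType R[i]} {ip : V -> V -> R[i]} {nrm : V -> R}.
Hypothesis H : inner_product_norm ip nrm.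
Implicit Types (u v w : V) (a z x : R[i]) (T : V -> V) (F G : R[i] -> V -> V)
  (phi : V -> R[i]) (psi : R[i] -> V -> R[i]) (c e d : R).

Lemma bounded_linear_bound T : bounded_linear nrm T ->
  exists2 c, 0 <= c & forall v, nrm (T v) <= c * nrm v.
Proof.
move=> [_ [c h]]; exists `|c| => // v; apply: le_trans (h v) _.
by apply: ler_wpM2r; [exact: nrm_ge0 H v|exact: ler_norm].
Qed.

Lemma bounded_linearD T (bT : bounded_linear nrm T) u v : T (u + v) = T u + T v.
Proof. by have [lT _] := bT; have := lT 1 u v; rewrite !scale1r. Qed.

Lemma bounded_linear0 T (bT : bounded_linear nrm T) : T 0 = 0.
Proof.
have /eqP := bounded_linearD bT 0 0.
by rewrite addr0 -{1}[T 0]addr0 (inj_eq (addrI _)) eq_sym => /eqP.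
Qed.

Lemma bounded_linearZ T (bT : bounded_linear nrm T) a u : T (a *: u) = a *: T u.
Proof. by have [lT _] := bT; have := lT a u 0; rewrite (bounded_linear0 bT) !addr0. Qed.

Lemma bounded_linearB T (bT : bounded_linear nrm T) u v : T (u - v) = T u - T v.
Proof. by rewrite (bounded_linearD bT) -scaleN1r (bounded_linearZ bT) scaleN1r. Qed.

Lemma bounded_linear_comp T T' : bounded_linear nrm T -> bounded_linear nrm T' ->
  bounded_linear nrm (fun v => T (T' v)).
Proof.
move=> bT bT'; have [c c0 h] := bounded_linear_bound bT.
have [c' c'0 h'] := bounded_linear_bound bT'; split.
  by move=> a u v; rewrite (bounded_linearD bT') (bounded_linearZ bT') (bounded_linearD bT) (bounded_linearZ bT).
exists (c * c') => v; apply: le_trans (h _) _; rewrite -mulrA; exact: ler_wpM2l.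
Qed.

Lemma opnorm_le T c : 0 <= c -> (forall v, nrm (T v) <= c * nrm v) -> opnorm nrm T <= c.
Proof.
move=> c0 h; apply: ge_sup.
  by exists (nrm (T 0)), 0; rewrite //= (nrm0 H).
move=> _ [v /= v1 <-]; apply: le_trans (h v) _.
by rewrite ler_piMr.
Qed.

Lemma opnormP T v : bounded_linear nrm T -> nrm (T v) <= opnorm nrm T * nrm v.
Proof.
move=> bT; have [c c0 h] := bounded_linear_bound bT.
have [v0|v0] := eqVneq (nrm v) 0.
  by rewrite v0 mulr0; have := h v; rewrite v0 mulr0.
have nv : 0 < nrm v by rewrite lt_neqAle eq_sym v0 (nrm_ge0 H).
rewrite -ler_pdivrMr//.
have -> : nrm (T v) / nrm v = nrm (T ((nrm v)^-1%:C *: v)).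
  by rewrite (bounded_linearZ bT) (nrmZ H) normcR ger0_norm ?invr_ge0 ?(ltW nv)// mulrC.
apply: ub_le_sup.
  exists c => _ [u /= u1 <-]; apply: le_trans (h u) _.
  by rewrite ler_piMr.
exists ((nrm v)^-1%:C *: v) => //=.
by rewrite (nrmZ H) normcR ger0_norm ?invr_ge0 ?(ltW nv)// mulVf.
Qed.

Lemma opnorm_ge0 T : bounded_linear nrm T -> 0 <= opnorm nrm T.
Proof.
move=> bT; have [c c0 h] := bounded_linear_bound bT.
apply: ub_le_sup.
  exists c => _ [u /= u1 <-]; apply: le_trans (h u) _.
  by rewrite ler_piMr.
by exists 0; rewrite /= ?(bounded_linear0 bT) (nrm0 H).
Qed.

Definition op_dif F z : Prop :=
  (exists2 d, 0 < d & forall x, normc (x - z) < d -> bounded_linear nrm (F x)) /\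
  exists2 T, bounded_linear nrm T & forall e, 0 < e -> exists2 d, 0 < d &
    forall x, normc (x - z) < d -> forall v,
      nrm (F x v - F z v - (x - z) *: T v) <= e * normc (x - z) * nrm v.

Lemma op_dif_bounded F z : op_dif F z -> bounded_linear nrm (F z).
Proof. by move=> [[d d0 h] _]; apply: h; rewrite subrr normc0. Qed.

Lemma holomorphic_op_dif (K : set R[i]) F z : holomorphic_on nrm K F -> K z -> op_dif F z.
Proof.
move=> hF Kz; have [r r0 h] := hF z Kz; split.
  by exists r => // x /h[].
have [_ [T [bT hT]]] := h z (ltac:(by rewrite subrr normc0)).
exists T => // e e0; have [d d0 h'] := hT e e0; exists d => // x xd v.
have [->|xz] := eqVneq x z.
  by rewrite !subrr scale0r subr0 normc0 mulr0 mul0r (nrm0 H).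
have xz0 : x - z != 0 by rewrite subr_eq0.
have n0 : 0 < normc (x - z) by rewrite normc_gt0.
have -> : F x v - F z v - (x - z) *: T v = (x - z) *: ((x - z)^-1 *: (F x v - F z v) - T v).
  by rewrite scalerBr scalerA divff// scale1r.
rewrite (nrmZ H) mulrAC mulrC; apply: ler_wpM2r; first exact: ltW.
by apply: h'; rewrite n0.
Qed.

Lemma op_dif_shift F z a : op_dif F (a + z) -> op_dif (fun x => F (a + x)) z.
Proof.
have E x : a + x - (a + z) = x - z by ring.
move=> [[d d0 h] [T bT hT]]; split; first by exists d => // x xd; apply: h; rewrite E.
exists T => // e e0; have [d' d'0 h'] := hT e e0; exists d' => // x xd v.
by have := h' (a + x); rewrite E => /(_ xd v).
Qed.

Lemma op_dif_ct F z : op_dif F z -> forall e, 0 < e -> exists2 d, 0 < d &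
  forall x, normc (x - z) < d -> forall v, nrm (F x v - F z v) <= e * nrm v.
Proof.
move=> [_ [T bT hT]] e e0; have [c c0 hc] := bounded_linear_bound bT.
have [d d0 h] := hT 1 ltr01.
exists (Num.min d (e / (1 + c))); first by rewrite lt_min d0 divr_gt0// ltr_wpDr.
move=> x; rewrite lt_min => /andP[xd xe] v.
have -> : F x v - F z v = (F x v - F z v - (x - z) *: T v) + (x - z) *: T v by rewrite subrK.
apply: le_trans (nrmD H _ _) _; rewrite (nrmZ H).
have n0 := normc_ge0 (x - z); have v0 := nrm_ge0 H v.
apply: (@le_trans _ _ (normc (x - z) * (1 + c) * nrm v)).
  rewrite mulrDr mulr1 mulrDl; apply: lerD; first by rewrite -[normc _]mul1r; exact: h.
  by rewrite -mulrA; apply: ler_wpM2l.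
apply: ler_wpM2r => //; rewrite -ler_pdivlMr ?ltr_wpDr//; exact: ltW.
Qed.

(** With T the derivative of [F] at [z], the derivative of the inverse [G] is - G T G. The inverses
    near [z] are given; only a common bound for them has to be found first. *)
Lemma op_dif_inv F G z : op_dif F z ->
  (exists2 d, 0 < d & forall x, normc (x - z) < d -> is_inverse nrm (F x) (G x)) ->
  op_dif G z.
Proof.
move=> dF [d0 d00 iG]; split; first by exists d0 => // x /iG[].
have bF := op_dif_bounded dF.
have [bG GF FG] : is_inverse nrm (F z) (G z) by apply: iG; rewrite subrr normc0.
have [c0 c00 hc0] := bounded_linear_bound bG.
pose c := 1 + c0; have c1 : 0 < c by rewrite ltr_wpDr.
have hc v : nrm (G z v) <= c * nrm v.
  by apply: le_trans (hc0 v) _; rewrite ler_wpM2r ?(nrm_ge0 H)// lerDr.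
have [[dF0 dF00 bFx] [T bT hT]] := dF.
have [t0 t00 ht0] := bounded_linear_bound bT.
exists (fun v => - G z (T (G z v))).
  have [lG _] := bounded_linear_comp bG (bounded_linear_comp bT bG).
  split; first by move=> a u v /=; rewrite lG opprD scalerN.
  have [k k0 hk] := bounded_linear_bound (bounded_linear_comp bG (bounded_linear_comp bT bG)).
  by exists k => v; rewrite (nrmN H).
move=> e e0.
pose k := 1 + c ^+ 3 * t0; have k0 : 0 <= c ^+ 3 * t0 by rewrite mulr_ge0// exprn_ge0// ltW.
have kp : 0 < k by rewrite ltr_wpDr.
pose e1 := Num.min (2^-1 / c) (e / 4 / k).
have e10 : 0 < e1 by rewrite lt_min; apply/andP; split; rewrite !divr_gt0// invr_gt0.
pose e2 := e / 4 / c ^+ 2.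
have e20 : 0 < e2 by rewrite !divr_gt0// exprn_gt0.
have [d1 d10 h1] := op_dif_ct dF e10.
have [d2 d20 h2] := hT e2 e20.
exists (Num.min (Num.min d0 dF0) (Num.min d1 d2)).
  by rewrite lt_min; apply/andP; split; rewrite lt_min ?d00 ?dF00 ?d10.
move=> x; rewrite lt_min [_ < Num.min d0 _]lt_min [_ < Num.min d1 _]lt_min.
move=> /andP[/andP[x0 x3] /andP[x1 x2]] v.
have [bGx GFx FGx] := iG x x0; have bF' := bFx x x3.
(* For y = G x u the identity F z y = u - (F x y - F z y) gives |y| <= c (|u| + e1 |y|); since c e1
   <= 1/2, the last term is absorbed on the left. *)
have Gx u : nrm (G x u) <= 2 * c * nrm u.
  set y := G x u; have uE : u = F x y by rewrite FGx.
  have : nrm y <= c * (nrm u + e1 * nrm y).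
    rewrite -{1}(GF y); apply: le_trans (hc _) _; apply: ler_wpM2l; first exact: ltW.
    have -> : F z y = u - (F x y - F z y) by rewrite uE opprB addrC subrK.
    by apply: le_trans (nrmB H _ _) _; rewrite lerD2l; exact: h1.
  have : c * e1 * nrm y <= 2^-1 * nrm y.
    apply: ler_wpM2r; first exact: nrm_ge0 H y.
    by rewrite mulrC -ler_pdivlMr// ge_min lexx.
  by rewrite mulrDr mulrA; lra.
(* The resolvent identity, which turns increments of [G] into increments of [F]. *)
have Dx u : G x u - G z u = - G x (F x (G z u) - F z (G z u)).
  by rewrite (bounded_linearB bGx) GFx FG opprB.
pose y := G z v; pose q := F x y - F z y - (x - z) *: T y.
have -> : G x v - G z v - (x - z) *: - G z (T (G z v)) =
    - G x q - (x - z) *: (G x (T y) - G z (T y)).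
  rewrite Dx /q -/y [G x (_ - _ - _)](bounded_linearB bGx) (bounded_linearZ bGx (x - z) (T y)).
  rewrite scalerN scalerBr opprK opprB opprB.
  move: (G x _) => g; move: ((x - z) *: G x (T y)) ((x - z) *: G z (T y)) => g1 g2.
  by rewrite [RHS]addrC addrA subrK addrC.
have n0 := normc_ge0 (x - z); have v0 := nrm_ge0 H v.
apply: le_trans (nrmB H _ _) _; rewrite (nrmN H) (nrmZ H).
have b1 : nrm (G x q) <= e / 2 * normc (x - z) * nrm v.
  apply: le_trans (Gx q) _; apply: (@le_trans _ _ (2 * c * (e2 * normc (x - z) * (c * nrm v)))).
    apply: ler_wpM2l; first by rewrite mulr_ge0// ltW.
    apply: le_trans (h2 x x2 y) _; apply: ler_wpM2l; last exact: hc.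
    by rewrite mulr_ge0// ltW.
  rewrite le_eqVlt; apply/orP; left; apply/eqP; rewrite /e2; field.
  by rewrite gt_eqF.
have b2 : nrm (G x (T y) - G z (T y)) <= e / 2 * nrm v.
  rewrite Dx (nrmN H); apply: le_trans (Gx _) _.
  apply: (@le_trans _ _ (2 * c * (e1 * (c * (t0 * (c * nrm v)))))).
    apply: ler_wpM2l; first by rewrite mulr_ge0// ltW.
    apply: le_trans (h1 x x1 _) _; apply: ler_wpM2l; first exact: ltW.
    apply: le_trans (hc _) _; apply: ler_wpM2l; first exact: ltW.
    by apply: le_trans (ht0 _) _; apply: ler_wpM2l => //; exact: hc.
  have -> : 2 * c * (e1 * (c * (t0 * (c * nrm v)))) = 2 * (e1 * (c ^+ 3 * t0)) * nrm v by ring.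
  apply: ler_wpM2r => //.
  have : e1 * (c ^+ 3 * t0) <= e / 4 / k * (c ^+ 3 * t0).
    by apply: ler_wpM2r => //; rewrite ge_min lexx orbT.
  have := ler_mul_div1D k0 (ltac:(by rewrite divr_ge0// ltW) : 0 <= e / 4).
  by rewrite mulrC -/k; lra.
apply: (@le_trans _ _ (e / 2 * normc (x - z) * nrm v + normc (x - z) * (e / 2 * nrm v))).
  by apply: lerD => //; apply: ler_wpM2l.
by rewrite le_eqVlt; apply/orP; left; apply/eqP; field.
Qed.

Lemma op_invP T : op_invertible nrm T -> is_inverse nrm T (op_inv nrm T).
Proof. by move=> [T' hT]; rewrite /op_inv; exact: (xgetPex (fun=> 0) (ex_intro _ T' hT)). Qed.

(** The bound is carried as a parameter because the later estimates track how it changes under the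
    operations on functionals. *)
Definition bfun c phi : Prop :=
  (forall a u v, phi (a *: u + v) = a * phi u + phi v) /\ forall v, normc (phi v) <= c * nrm v.

Lemma bfunD c phi (b : bfun c phi) u v : phi (u + v) = phi u + phi v.
Proof. by have [l _] := b; have := l 1 u v; rewrite scale1r mul1r. Qed.

Lemma bfun0 c phi (b : bfun c phi) : phi 0 = 0.
Proof.
have /eqP := bfunD b 0 0.
by rewrite addr0 -{1}[phi 0]addr0 (inj_eq (addrI _)) eq_sym => /eqP.
Qed.

Lemma bfunZ c phi (b : bfun c phi) a u : phi (a *: u) = a * phi u.
Proof. by have [l _] := b; have := l a u 0; rewrite (bfun0 b) !addr0. Qed.

Lemma bfunB c phi (b : bfun c phi) u v : phi (u - v) = phi u - phi v.
Proof. by rewrite (bfunD b) -scaleN1r (bfunZ b) mulN1r. Qed.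

Lemma bfun_sum c phi (b : bfun c phi) (I : Type) (s : seq I) (f : I -> V) :
  phi (\sum_(i <- s) f i) = \sum_(i <- s) phi (f i).
Proof.
elim: s => [|i s IH]; first by rewrite !big_nil (bfun0 b).
by rewrite !big_cons (bfunD b) IH.
Qed.

Lemma bfun_le c d phi : c <= d -> bfun c phi -> bfun d phi.
Proof.
move=> cd [l b]; split => // v; apply: le_trans (b v) _.
by apply: ler_wpM2r => //; exact: nrm_ge0 H v.
Qed.

Lemma bfun_lin c d phi phi' a : bfun c phi -> bfun d phi' ->
  bfun (normc a * c + d) (fun v => a * phi v + phi' v).
Proof.
move=> [l b] [l' b']; split=> [x u v|v]; first by rewrite l l'; ring.
apply: le_trans (normcD _ _) _; rewrite normcM mulrDl -mulrA.
by apply: lerD => //; apply: ler_wpM2l; rewrite ?normc_ge0.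
Qed.

Lemma bfun_comp c d phi T : 0 <= c -> bounded_linear nrm T -> (forall v, nrm (T v) <= d * nrm v) ->
  bfun c phi -> bfun (c * d) (fun v => phi (T v)).
Proof.
move=> c0 bT Td [l b]; split=> [x u v|v]; first by rewrite (bounded_linearD bT) (bounded_linearZ bT) l.
by apply: le_trans (b _) _; rewrite -mulrA; apply: ler_wpM2l.
Qed.

Lemma bfun_bound c phi : bfun c phi -> exists2 d, 0 <= d & bfun d phi.
Proof. by move=> b; exists `|c| => //; apply: bfun_le b; exact: ler_norm. Qed.

(** The counterpart of [op_dif] for families of functionals, with errors measured in the dual norm.
    This uniformity in [v] is what permits composing with a family of operators in [vdif_op]. *)
Definition vdif psi z : Prop :=
  (exists2 d, 0 < d & forall x, normc (x - z) < d -> exists c, bfun c (psi x)) /\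
  exists phi, (exists c, bfun c phi) /\ forall e, 0 < e -> exists2 d, 0 < d &
    forall x, normc (x - z) < d -> forall v,
      normc (psi x v - psi z v - (x - z) * phi v) <= e * normc (x - z) * nrm v.

Lemma vdif_bfun psi z : vdif psi z -> exists c, bfun c (psi z).
Proof. by move=> [[d d0 h] _]; apply: h; rewrite subrr normc0. Qed.

Lemma vdif_cst c phi z : bfun c phi -> vdif (fun=> phi) z.
Proof.
move=> b; split; first by exists 1 => // x _; exists c.
exists (fun=> 0); split.
  exists 0; split=> [a u v|v]; first by rewrite mulr0 addr0.
  by rewrite normc0 mul0r.
move=> e e0; exists 1 => // x _ v; rewrite subrr mulr0 subr0 normc0.
by rewrite !mulr_ge0 ?normc_ge0 ?(nrm_ge0 H)// ltW.
Qed.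

Lemma vdif_dif psi z v : vdif psi z -> dif (psi^~ v) z.
Proof.
move=> [_ [phi [_ h]]]; exists (phi v) => e e0.
have v0 := nrm_ge0 H v.
have [d d0 hd] := h (e / (1 + nrm v)) (ltac:(by rewrite divr_gt0// ltr_wpDr)).
exists d => // x xd; apply: le_trans (hd x xd v) _.
rewrite mulrAC; apply: ler_wpM2r; first exact: normc_ge0.
by rewrite mulrC; apply: ler_mul_div1D => //; exact: ltW.
Qed.

(** Product rule: the derivative is phi composed with [F z] plus [psi z] composed with the
    derivative of [F]. The three error terms receive a third of [e] each. *)
Lemma vdif_op psi F z : vdif psi z -> op_dif F z -> vdif (fun x v => psi x (F x v)) z.
Proof.
move=> vp dF; have [[d1 d10 h1] [phi [[b bphi] hphi]]] := vp.
have [[d2 d20 h2] [T bT hT]] := dF.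
split.
  exists (Num.min d1 d2); first by rewrite lt_min d10.
  move=> x; rewrite lt_min => /andP[x1 x2]; have [c bc] := h1 x x1.
  have [c' c'0 bc'] := bfun_bound bc; have [k k0 hk] := bounded_linear_bound (h2 x x2).
  by exists (c' * k); apply: bfun_comp => //; exact: h2.
have [c0 bc0] := vdif_bfun vp; have [c c_0 bc] := bfun_bound bc0.
have bF := op_dif_bounded dF; have [k k0 hk] := bounded_linear_bound bF.
have [t t0 ht] := bounded_linear_bound bT.
have [q q0 bq] := bfun_bound bphi.
exists (fun v => 1 * phi (F z v) + psi z (T v)); split.
  by eexists; apply: bfun_lin; [apply: bfun_comp hk bq|apply: bfun_comp ht bc].
move=> e e0.
pose e1 := e / 3 / (2 + k); have e10 : 0 < e1 by rewrite !divr_gt0// ltr_wpDr.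
pose e2 := Num.min 1 (e / 3 / (1 + q)).
have e20 : 0 < e2 by rewrite lt_min ltr01 !divr_gt0// ltr_wpDr.
pose e3 := e / 3 / (1 + c); have e30 : 0 < e3 by rewrite !divr_gt0// ltr_wpDr.
have [r1 r10 g1] := hphi e1 e10.
have [r2 r20 g2] := op_dif_ct dF e20.
have [r3 r30 g3] := hT e3 e30.
exists (Num.min r1 (Num.min r2 r3)); first by rewrite lt_min r10 lt_min r20.
move=> x; rewrite !lt_min => /and3P[x1 x2 x3] v.
have n0 := normc_ge0 (x - z); have v0 := nrm_ge0 H v.
have -> : psi x (F x v) - psi z (F z v) - (x - z) * (1 * phi (F z v) + psi z (T v)) =
  (psi x (F x v) - psi z (F x v) - (x - z) * phi (F x v)) + (x - z) * phi (F x v - F z v)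
  + psi z (F x v - F z v - (x - z) *: T v).
  by rewrite (bfunB bphi) !(bfunB bc) (bfunZ bc); ring.
apply: le_trans (normcD _ _) _; apply: le_trans (lerD (normcD _ _) (lexx _)) _.
have Fx : nrm (F x v) <= (1 + k) * nrm v.
  rewrite -(subrK (F z v) (F x v)) mulrDl; apply: le_trans (nrmD H _ _) _.
  apply: lerD => //; apply: le_trans (g2 x x2 v) _; apply: ler_wpM2r => //.
  by rewrite ge_min lexx.
have -> : e * normc (x - z) * nrm v = e / 3 * normc (x - z) * nrm v + e / 3 * normc (x - z) * nrm v + e / 3 * normc (x - z) * nrm v by field.
apply: lerD; first apply: lerD.
- apply: le_trans (g1 x x1 _) _.
  apply: (@le_trans _ _ (e1 * normc (x - z) * ((1 + k) * nrm v))).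
    by apply: ler_wpM2l => //; rewrite mulr_ge0// ltW.
  rewrite (_ : e1 * _ * _ = e1 * (1 + k) * (normc (x - z) * nrm v)); last by ring.
  rewrite -[e / 3 * _ * _]mulrA; apply: ler_wpM2r; first by rewrite mulr_ge0.
  rewrite /e1 mulrAC ler_pdivrMr ?ltr_wpDr//; apply: ler_wpM2l; [by rewrite divr_ge0// ltW|lra].
- rewrite normcM; apply: (@le_trans _ _ (normc (x - z) * (q * (e2 * nrm v)))).
    apply: ler_wpM2l => //; apply: le_trans (bq.2 _) _; apply: ler_wpM2l => //; exact: g2.
  rewrite (_ : normc (x - z) * (q * (e2 * nrm v)) = q * e2 * (normc (x - z) * nrm v)); last by ring.
  rewrite -[e / 3 * _ * _]mulrA; apply: ler_wpM2r; first by rewrite mulr_ge0.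
  apply: (@le_trans _ _ (q * (e / 3 / (1 + q)))).
    by apply: ler_wpM2l => //; rewrite ge_min lexx orbT.
  by apply: ler_mul_div1D => //; rewrite divr_ge0// ltW.
- apply: le_trans (bc.2 _) _; apply: (@le_trans _ _ (c * (e3 * normc (x - z) * nrm v))).
    by apply: ler_wpM2l => //; exact: g3.
  rewrite (_ : c * _ = c * e3 * normc (x - z) * nrm v); last by ring.
  apply: ler_wpM2r => //; apply: ler_wpM2r => //.
  by rewrite /e3; apply: ler_mul_div1D => //; rewrite divr_ge0// ltW.
Qed.

Lemma vdifD psi psi' z : vdif psi z -> vdif psi' z ->
  vdif (fun x v => psi x v + psi' x v) z.
Proof.
move=> [[d1 d10 h1] [phi [[b bphi] hphi]]] [[d2 d20 h2] [phi' [[b' bphi'] hphi']]].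
have bD c c' f f' : bfun c f -> bfun c' f' -> exists k, bfun k (fun v => f v + f' v).
  move=> bf bf'; eexists; have := bfun_lin 1 bf bf'.
  by rewrite (_ : (fun v => _) = (fun v => f v + f' v)) => [b2|]; [exact: b2|apply/funext => v; rewrite mul1r].
split.
  exists (Num.min d1 d2); first by rewrite lt_min d10.
  by move=> x; rewrite lt_min => /andP[/h1[c bc] /h2[c' bc']]; exact: bD bc bc'.
exists (fun v => phi v + phi' v); split; first exact: bD bphi bphi'.
move=> e e0.
have [r1 r10 g1] := hphi (e / 2) (ltac:(by rewrite divr_gt0)).
have [r2 r20 g2] := hphi' (e / 2) (ltac:(by rewrite divr_gt0)).
exists (Num.min r1 r2); first by rewrite lt_min r10.
move=> x; rewrite lt_min => /andP[x1 x2] v.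
rewrite (_ : _ - _ - _ = (psi x v - psi z v - (x - z) * phi v) + (psi' x v - psi' z v - (x - z) * phi' v)); last by ring.
apply: le_trans (normcD _ _) _.
have -> : e * normc (x - z) * nrm v = e / 2 * normc (x - z) * nrm v + e / 2 * normc (x - z) * nrm v by field.
by apply: lerD; [exact: g1|exact: g2].
Qed.

Lemma vdif_scale (f : R[i] -> R[i]) psi z : dif f z -> vdif psi z ->
  vdif (fun x v => f x * psi x v) z.
Proof.
move=> df [[d1 d10 h1] [phi [[b0 bphi0] hphi]]]; have [b b_0 bphi] := bfun_bound bphi0.
have cf := dif_cct df; have [f' df'] := df.
have bZ a c g : bfun c g -> exists k, bfun k (fun v => a * g v).
  move=> [l bg]; exists (normc a * c); split=> [x u v|v]; first by rewrite l; ring.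
  by rewrite normcM -mulrA; apply: ler_wpM2l => //; exact: normc_ge0.
split; first by exists d1 => // x /h1[c]; exact: bZ.
have [c0 bc0] : exists c, bfun c (psi z) by apply: h1; rewrite subrr normc0.
have [c c_0 bc] := bfun_bound bc0.
exists (fun v => f' * psi z v + f z * phi v); split.
  have [k bk] := bZ (f z) _ _ bphi; eexists; exact: bfun_lin bc bk.
move=> e e0; have fz0 := normc_ge0 (f z).
pose e1 := Num.min 1 (e / 3 / (1 + b)); pose e2 := e / 3 / (2 + normc (f z)); pose e3 := e / 3 / (1 + c).
have e10 : 0 < e1 by rewrite lt_min ltr01 !divr_gt0// ltr_wpDr.
have e20 : 0 < e2 by rewrite !divr_gt0// ltr_wpDr.
have e30 : 0 < e3 by rewrite !divr_gt0// ltr_wpDr.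
have [r1 r10 g1] := cf e1 e10.
have [r2 r20 g2] := hphi e2 e20.
have [r3 r30 g3] := df' e3 e30.
exists (Num.min r1 (Num.min r2 r3)); first by rewrite lt_min r10 lt_min r20.
move=> x; rewrite !lt_min => /and3P[x1 x2 x3] v.
have n0 := normc_ge0 (x - z); have v0 := nrm_ge0 H v.
rewrite (_ : _ - _ - _ = f x * (psi x v - psi z v - (x - z) * phi v)
  + (f x - f z) * ((x - z) * phi v) + (f x - f z - (x - z) * f') * psi z v); last by ring.
apply: le_trans (normcD _ _) _; apply: le_trans (lerD (normcD _ _) (lexx _)) _.
have -> : e * normc (x - z) * nrm v = e / 3 * (normc (x - z) * nrm v) + e / 3 * (normc (x - z) * nrm v) + e / 3 * (normc (x - z) * nrm v) by field.
have fx : normc (f x) <= 1 + normc (f z).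
  rewrite -(subrK (f z) (f x)); apply: le_trans (normcD _ _) _.
  by rewrite lerD2r; apply: le_trans (ltW (g1 x x1)) _; rewrite ge_min lexx.
rewrite !normcM; have N0 : 0 <= normc (x - z) * nrm v by rewrite mulr_ge0.
apply: lerD; first apply: lerD.
- apply: (@le_trans _ _ ((1 + normc (f z)) * (e2 * normc (x - z) * nrm v))).
    by apply: ler_pM => //; [exact: normc_ge0|exact: normc_ge0|exact: g2].
  rewrite (_ : _ * _ = (1 + normc (f z)) * e2 * (normc (x - z) * nrm v)); last by ring.
  apply: ler_wpM2r => //; rewrite /e2 mulrA ler_pdivrMr ?ltr_wpDr// mulrC.
  by apply: ler_wpM2l; [rewrite divr_ge0// ltW|lra].
- apply: (@le_trans _ _ (e1 * (normc (x - z) * (b * nrm v)))).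
    apply: ler_pM => //; [exact: normc_ge0|by rewrite mulr_ge0 ?normc_ge0|by apply/ltW/g1|].
    by apply: ler_wpM2l => //; exact: bphi.2.
  rewrite (_ : e1 * (normc (x - z) * (b * nrm v)) = b * e1 * (normc (x - z) * nrm v)); last by ring.
  apply: ler_wpM2r => //; apply: (@le_trans _ _ (b * (e / 3 / (1 + b)))).
    by apply: ler_wpM2l => //; rewrite ge_min lexx orbT.
  by apply: ler_mul_div1D => //; rewrite divr_ge0// ltW.
- apply: (@le_trans _ _ (e3 * normc (x - z) * (c * nrm v))).
    by apply: ler_pM; [exact: normc_ge0|exact: normc_ge0|exact: g3|exact: bc.2].
  rewrite (_ : e3 * normc (x - z) * (c * nrm v) = c * e3 * (normc (x - z) * nrm v)); last by ring.
  by apply: ler_wpM2r => //; rewrite /e3; apply: ler_mul_div1D => //; rewrite divr_ge0// ltW.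
Qed.

Lemma vdif_sum (I : Type) (s : seq I) (f : I -> R[i] -> V -> R[i]) z :
  (forall i, vdif (f i) z) -> vdif (fun x v => \sum_(i <- s) f i x v) z.
Proof.
move=> df; elim: s => [|i s IH].
  rewrite (_ : (fun x v => _) = (fun _ _ => 0)); last first.
    by apply/funext => x; apply/funext => v; rewrite big_nil.
  by apply: (@vdif_cst 0); split=> [a u v|v]; rewrite ?mulr0 ?addr0 ?normc0 ?mul0r.
rewrite (_ : (fun x v => _) = (fun x v => f i x v + \sum_(j <- s) f j x v)); first exact: vdifD.
by apply/funext => x; apply/funext => v; rewrite big_cons.
Qed.

End Operators.

Arguments bfun {R V} nrm c phi.
Arguments op_dif {R V} nrm F z.
Arguments vdif {R V} nrm psi z.

(** * Traces of finite-rank operations on functionals *)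

Section TraceBound.
Context {R : realType} {V : lmodType R[i]} {ip : V -> V -> R[i]} {nrm : V -> R}.
Hypothesis H : inner_product_norm ip nrm.
Implicit Types (phi : V -> R[i]) (X : (V -> R[i]) -> V -> R[i]) (c y : R).

(** The transpose of an operator of norm at most [y], without an operator on [V] behind it: this is
    the only form in which [K z] and [A z] exist. *)
Definition functional_op X y : Prop :=
  (forall c phi, 0 <= c -> bfun nrm c phi -> bfun nrm (y * c) (X phi)) /\
  forall a phi phi' c c', bfun nrm c phi -> bfun nrm c' phi' ->
    X (fun v => a * phi v + phi' v) = fun v => a * X phi v + X phi' v.

Lemma functional_op_sum X y n (f : 'I_n -> V -> R[i]) (a : 'I_n -> R[i]) :
  functional_op X y -> (forall i, exists c, bfun nrm c (f i)) ->
  X (fun v => \sum_i a i * f i v) = fun v => \sum_i a i * X (f i) v.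
Proof.
move=> [bX lX] bf.
have X0 : X (fun=> 0) = fun=> 0.
  have b0 : bfun nrm 0 (fun _ : V => 0 : R[i]).
    by split=> [b u v|v]; rewrite ?mulr0 ?addr0 ?normc0 ?mul0r.
  have [_ h] := bX 0 _ (lexx 0) b0; apply/funext => v.
  have := h v; rewrite mulr0 mul0r => h'.
  by apply/eqP; rewrite -normc_eq0 eq_le h' normc_ge0.
suff : forall s : seq 'I_n, (exists c, bfun nrm c (fun v => \sum_(i <- s) a i * f i v)) /\
    X (fun v => \sum_(i <- s) a i * f i v) = fun v => \sum_(i <- s) a i * X (f i) v.
  by move=> /(_ (index_enum 'I_n))[].
elim=> [|i s [[c bs] IH]].
  have E (g : 'I_n -> V -> R[i]) : (fun v => \sum_(i <- [::]) a i * g i v) = (fun=> 0).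
    by apply/funext => v; rewrite big_nil.
  rewrite !E X0; split => //; exists 0.
  by split=> [b u v|v]; rewrite ?mulr0 ?addr0 ?normc0 ?mul0r.
have E (g : 'I_n -> V -> R[i]) : (fun v => \sum_(j <- i :: s) a j * g j v) =
    (fun v => a i * g i v + \sum_(j <- s) a j * g j v).
  by apply/funext => v; rewrite big_cons.
have [ci bi] := bf i.
rewrite (E f) (E (fun i => X (f i))); split; first by exists (normc (a i) * ci + c); exact: (bfun_lin (a i) bi bs).
by rewrite (lX _ _ _ _ _ bi bs) IH.
Qed.

(* A rank-|I| operator has at most |I| nonzero eigenvalues, all bounded by its
   norm; its eigenvectors are the functionals [v |-> ip v w], whose norm is
   attained at [w], a vector of the span of [b]. *)
Lemma trace_le X y (I : finType) n (b : 'I_n -> V) (f : 'I_n -> V -> R[i]) (g : 'M[R[i]]_n)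
    (A : 'I_n -> I -> R[i]) (B : I -> V -> R[i]) :
  (forall i v, f i v = \sum_j ip v (b j) * g j i) ->
  (forall i k, f i (b k) = (k == i)%:R) ->
  (forall i k, X (f i) (b k) = \sum_q A i q * B q (b k)) ->
  functional_op X y -> 0 <= y ->
  normc (\sum_i X (f i) (b i)) <= #|I|%:R * y.
Proof.
move=> fE fb XE oX y0.
pose Am := \matrix_(i < n, j < #|I|) A i (enum_val j).
pose Bm := \matrix_(j < #|I|, k < n) B (enum_val j) (b k).
(* The matrix of [X] between [f] and [b] factors through #|I| dimensions, so the trace is a sum of
   #|I| numbers whose nonzero members are eigenvalues. *)
have GE i k : (Am *m Bm) i k = X (f i) (b k).
  rewrite XE mxE [RHS](reindex _ (onW_bij _ (@enum_val_bij I)))/=.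
  by apply: eq_bigr => j _; rewrite !mxE.
have [s [ss sE sP]] := mxtrace_mul_eigenvalues Am Bm.
have -> : \sum_i X (f i) (b i) = \sum_(x <- s) x.
  by rewrite -sE; apply: eq_bigr => i _; rewrite GE.
have ipf w : bfun nrm (nrm w) (fun v => ip v w).
  split=> [a u v|v]; first exact: (ip_linear H).
  by rewrite mulrC; exact: (cauchy_schwarz H).
have sle x : x \in s -> normc x <= y.
  move=> xs; have [->|x0] := eqVneq x 0; first by rewrite normc0.
  have [c c0 cE] := sP x xs x0.
  (* [w] will represent [phi] as an inner product and lies in the span of [b]. The eigenvalue
     equation X phi = x phi is known on [b] only, but may thus be evaluated at [w], where phi w =
     |w|^2. *)
  pose d j := \sum_i g j i * c 0 i.
  pose w := \sum_j conjc (d j) *: b j.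
  pose phi v := \sum_i c 0 i * f i v.
  have phiE v : phi v = ip v w.
    rewrite /phi /w (ip_sumr H).
    under [RHS]eq_bigr do rewrite (ipZr H) conjcK mulr_suml.
    rewrite exchange_big/=; apply: eq_bigr => i _; rewrite fE mulr_sumr.
    by apply: eq_bigr => j _; ring.
  have phib k : phi (b k) = c 0 k.
    rewrite /phi (bigD1 k)//= fb eqxx mulr1 big1 ?addr0// => i ik.
    by rewrite fb eq_sym (negPf ik) mulr0.
  have w0 : w != 0.
    apply: contraNneq c0 => w0; apply/eqP/rowP => k; rewrite [RHS]mxE -phib phiE w0.
    by rewrite (ip_conjC H) (ip0l H) conjc0.
  have bphi : bfun nrm (nrm w) phi.
    by rewrite (_ : phi = fun v => ip v w)//; apply/funext.
  have bX := oX.1 _ _ (nrm_ge0 H w) bphi.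
  have bf i : exists c, bfun nrm c (f i).
    pose u := \sum_j conjc (g j i) *: b j.
    exists (nrm u); rewrite (_ : f i = fun v => ip v u)//; apply/funext => v.
    rewrite fE /u (ip_sumr H); apply: eq_bigr => j _.
    by rewrite (ipZr H) conjcK mulrC.
  have Xb k : X phi (b k) = x * phi (b k).
    have := functional_op_sum (fun i => c 0 i) oX bf; rewrite -/phi => ->.
    have /matrixP/(_ 0 k) := cE; rewrite !mxE phib => <-.
    by apply: eq_bigr => i _; rewrite GE.
  have Xw : X phi w = x * (nrm w ^+ 2)%:C.
    rewrite -(ip_sqr H) -phiE /w (bfun_sum bX) (bfun_sum bphi) mulr_sumr.
    by apply: eq_bigr => j _; rewrite (bfunZ bX) (bfunZ bphi) Xb mulrCA.
  have nw := nrm_gt0 H w0.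
  have := bX.2 w; rewrite Xw normcM normcR ger0_norm ?exprn_ge0 ?(ltW nw)//.
  by rewrite -mulrA -expr2 ler_pM2r// exprn_gt0.
have : normc (\sum_(x <- s) x) <= (size s)%:R * y.
  elim: s sle {ss sE sP} => [|x s IH] sle; first by rewrite big_nil normc0 mul0r.
  rewrite big_cons /= -natr1 mulrDl mul1r [leRHS]addrC; apply: le_trans (normcD _ _) _.
  apply: lerD; first by apply: sle; rewrite mem_head.
  by apply: IH => z zs; apply: sle; rewrite in_cons zs orbT.
by rewrite ss.
Qed.

End TraceBound.

Arguments functional_op {R V} nrm X y.

(** * Principal and regular part of the inverse *)

Section Resolvent.
Context {R : realType} {V : lmodType R[i]} {ip : V -> V -> R[i]} {nrm : V -> R}.
Hypothesis H : inner_product_norm ip nrm.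
Variables (Rw : R[i] -> V -> V) (rho C : R) (N : nat) (I : finType).
Hypotheses (rho0 : 0 < rho) (C0 : 0 <= C).
Hypothesis dR : forall z, 0 < normc z <= rho -> op_dif nrm Rw z.
Hypothesis bR : forall z, normc z = rho -> forall v, nrm (Rw z v) <= C * nrm v.
(** In each polar coefficient the dependence on [phi] and on [v] is separated, with #|I| terms: this
    is the finite rank of the principal part. *)
Hypothesis sing : exists (al : (V -> R[i]) -> I -> R[i]) (be : V -> I -> 'I_N -> R[i]),
  forall c phi v, bfun nrm c phi -> bdd0 (fun x => phi (Rw x v) -
    \sum_q \sum_(l < N) al phi q * be v q l * (x ^+ l.+1)^-1).
Implicit Types (phi : V -> R[i]) (psi : R[i] -> V -> R[i]) (c d : R) (a x z : R[i]).

(** The Laurent coefficient of index -(l + 1) of the inverse, in transposed form. *)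
Definition kap l phi v : R[i] := (2 * pi)%:C^-1 * J (fun x => phi (Rw x v) * x ^+ l) rho.

(* Acting on functionals, the principal part of the resolvent at 0 and the
   remaining regular part. *)
Definition KK z phi v : R[i] := ppart N rho (fun x => phi (Rw x v)) z.
Definition AA z phi v : R[i] := phi (Rw z v) - KK z phi v.

Lemma KKE z phi v : KK z phi v = \sum_(l < N) (z ^+ l.+1)^-1 * kap l phi v.
Proof. by []. Qed.

Lemma hol_pairing c phi v : bfun nrm c phi -> hol (fun x => phi (Rw x v)) rho.
Proof.
move=> b z zr.
exact: (vdif_dif H v (vdif_op H (vdif_cst H z b) (dR zr))).
Qed.

Lemma pairing_circ c phi v l : bfun nrm c phi -> cct_circ (fun x => phi (Rw x v) * x ^+ l) rho.
Proof.
move=> b z zr; apply: dif_cct; apply: dif_mul; last by apply: dif_exp; exact: dif_id.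
by apply: (hol_pairing v b); rewrite zr rho0 lexx.
Qed.

Lemma kap_lin l a phi phi' c c' : bfun nrm c phi -> bfun nrm c' phi' ->
  kap l (fun v => a * phi v + phi' v) = fun v => a * kap l phi v + kap l phi' v.
Proof.
move=> b b'; apply/funext => v; rewrite /kap mulrCA -mulrDr; congr (_ * _).
rewrite -J_lin; [|exact: ltW|exact: pairing_circ b|exact: pairing_circ b'].
by apply: J_ext => [|x xr]; [exact: ltW|ring].
Qed.

Lemma bR_circ z : normc z = rho -> bounded_linear nrm (Rw z).
Proof. by move=> zr; apply/op_dif_bounded/dR; rewrite zr rho0 lexx. Qed.

(** Cauchy estimate: on the circle x^l contributes rho^l, dx another rho, and the pairing at most C
    c |v|. *)
Lemma bfun_kap l c phi : 0 <= c -> bfun nrm c phi ->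
  bfun nrm (rho ^+ l.+1 * C * c) (kap l phi).
Proof.
move=> c0 b; split=> [a u v|v].
  rewrite /kap mulrCA -mulrDr; congr (_ * _).
  rewrite -J_lin; [|exact: ltW|exact: pairing_circ b|exact: pairing_circ b].
  apply: J_ext => [|x xr]; first exact: ltW.
  rewrite (bounded_linearD (bR_circ xr)) (bounded_linearZ (bR_circ xr)) (bfunD b) (bfunZ b); ring.
rewrite /kap normcM normcV normcR (ger0_norm (ltW (twopi_gt0)))//.
rewrite mulrC ler_pdivrMr ?twopi_gt0//.
have -> : rho ^+ l.+1 * C * c * nrm v * (2 * pi) = 2 * pi * (rho * (c * (C * nrm v) * rho ^+ l)).
  by rewrite exprS; ring.
apply: J_bound; [exact: ltW|exact: pairing_circ b|].
move=> z zr; rewrite normcM normcX zr; apply: ler_wpM2r; first by rewrite exprn_ge0// ltW.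
by apply: le_trans (b.2 _) _; apply: ler_wpM2l => //; exact: bR.
Qed.

(** [kap l] is linear and bounded in the functional. Applied to the first-order remainder [q] of
    [psi], it therefore gives an equally small remainder. *)
Lemma vdif_kap l psi z : vdif nrm psi z -> vdif nrm (fun x => kap l (psi x)) z.
Proof.
move=> [[d d0 h] [phi [[c0 b0] hphi]]]; split.
  exists d => // x /h[c bc]; have [c' c'0 bc'] := bfun_bound H bc.
  by exists (rho ^+ l.+1 * C * c'); exact: bfun_kap.
have [c c_0 b] := bfun_bound H b0.
exists (kap l phi); split; first by exists (rho ^+ l.+1 * C * c); exact: bfun_kap.
have [cz bz] : exists c, bfun nrm c (psi z) by apply: h; rewrite subrr normc0.
move=> e e0; pose k := rho ^+ l.+1 * C.
have k0 : 0 <= k by rewrite mulr_ge0// exprn_ge0// ltW.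
have [r r0 hr] := hphi (e / (1 + k)) (ltac:(by rewrite divr_gt0// ltr_wpDr)).
exists (Num.min d r); first by rewrite lt_min d0.
move=> x; rewrite lt_min => /andP[/h[cx bx] /hr xr] v.
have n0 := normc_ge0 (x - z); have v0 := nrm_ge0 H v.
pose q u := - (x - z) * phi u + ((-1) * psi z u + psi x u).
have qE u : q u = psi x u - psi z u - (x - z) * phi u by rewrite /q; ring.
have bq : bfun nrm (e / (1 + k) * normc (x - z)) q.
  split; last by move=> u; rewrite qE; exact: xr.
  exact: (bfun_lin (- (x - z)) b (bfun_lin (-1) bz bx)).1.
have -> : kap l (psi x) v - kap l (psi z) v - (x - z) * kap l phi v = kap l q v.
  rewrite /q (kap_lin l (- (x - z)) b (bfun_lin (-1) bz bx)) (kap_lin l (-1) bz bx); ring.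
have e'0 : 0 <= e / (1 + k) * normc (x - z) by rewrite mulr_ge0// divr_ge0// ?addr_ge0// ltW.
apply: le_trans ((bfun_kap l e'0 bq).2 v) _; apply: ler_wpM2r => //.
by rewrite mulrA; apply: ler_wpM2r => //; apply: ler_mul_div1D => //; exact: ltW.
Qed.

Lemma vdif_AA psi z : 0 < normc z <= rho -> vdif nrm psi z ->
  vdif nrm (fun x => AA x (psi x)) z.
Proof.
move=> zr dpsi; have z0 : z != 0 by rewrite -normc_gt0; case/andP: zr.
have d1 := vdif_op H dpsi (dR zr).
have d2 : vdif nrm (fun x v => \sum_(l < N) (x ^+ l.+1)^-1 * kap l (psi x) v) z.
  apply: (vdif_sum H) => l; apply: (vdif_scale H); last exact: vdif_kap.
  by apply: dif_inv; [apply: dif_exp; exact: dif_id|rewrite expf_neq0].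
have d3 := vdifD d1 (vdif_scale H (dif_cst (-1) z) d2).
rewrite (_ : (fun x => _) = fun x v => psi x (Rw x v) + -1 *
  \sum_(l < N) (x ^+ l.+1)^-1 * kap l (psi x) v)//.
by apply/funext => x; apply/funext => v; rewrite mulN1r.
Qed.

(** On the circle the weight rho^-(l + 1) cancels the factor of [bfun_kap], so each of the [N]
    coefficients contributes [C]. *)
Lemma functional_op_KK z : normc z = rho -> functional_op nrm (KK z) (N%:R * C).
Proof.
move=> zr; split=> [c phi c0 b|a phi phi' c c' b b'].
  have bk l := bfun_kap l c0 b.
  split=> [a u v|v].
    rewrite !KKE mulr_sumr -big_split/=; apply: eq_bigr => l _.
    by rewrite (bk l).1; ring.
  rewrite KKE; apply: le_trans (normc_sum _) _.
  have -> : N%:R * C * c * nrm v = \sum_(l < N) C * c * nrm v.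
    by rewrite sumr_const card_ord -[RHS]mulr_natl !mulrA.
  apply: ler_sum => l _; rewrite normcM normcV normcX zr mulrC ler_pdivrMr ?exprn_gt0//.
  by apply: le_trans ((bk l).2 v) _; rewrite le_eqVlt; apply/orP; left; apply/eqP; ring.
apply/funext => v; rewrite !KKE mulr_sumr -big_split/=; apply: eq_bigr => l _.
by rewrite (kap_lin l a b b'); ring.
Qed.

Lemma functional_op_AA z : normc z = rho -> functional_op nrm (AA z) ((1 + N%:R) * C).
Proof.
move=> zr; have [bK lK] := functional_op_KK zr; have bz := bR_circ zr.
split=> [c phi c0 b|a phi phi' c c' b b'].
  have := bfun_lin (-1) (bK c phi c0 b) (bfun_comp c0 bz (bR zr) b).
  rewrite normcN normc1 mul1r (_ : N%:R * C * c + c * C = (1 + N%:R) * C * c); last by ring.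
  rewrite (_ : (fun v => _) = AA z phi)//; apply/funext => v.
  by rewrite mulN1r addrC.
by apply/funext => v; rewrite /AA (lK _ _ _ _ _ b b'); ring.
Qed.

(** [ppart_sum] identifies the integrals defining [KK] with the expansion given by [sing];
    subtracting it leaves the bounded remainder. Here the bound may still depend on [phi] and
    [v]. *)
Lemma KK_finite_rank : exists (al : (V -> R[i]) -> I -> R[i]) (be : V -> I -> 'I_N -> R[i]),
  forall c phi v, bfun nrm c phi ->
    (forall z, KK z phi v = \sum_q al phi q * \sum_(l < N) be v q l * (z ^+ l.+1)^-1) /\
    bdd0 (fun x => AA x phi v).
Proof.
have [al [be h]] := sing; exists al, be => c phi v b.
have bh := h c phi v b.
pose A (p : I * 'I_N) := al phi p.1 * be v p.1 p.2.
pose h' x := phi (Rw x v) - \sum_q \sum_(l < N) al phi q * be v q l * (x ^+ l.+1)^-1.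
have E x : \sum_(p : I * 'I_N) A p * (x ^+ p.2.+1)^-1 =
    \sum_q \sum_(l < N) al phi q * be v q l * (x ^+ l.+1)^-1.
  by rewrite pair_bigA.
have KE z : KK z phi v = \sum_q \sum_(l < N) al phi q * be v q l * (z ^+ l.+1)^-1.
  rewrite -E /KK.
  apply: (@ppart_sum R N rho (fun x => phi (Rw x v)) h' (I * 'I_N)%type A (fun p => p.2.+1) z rho0) => //.
  - exact: hol_pairing b.
  - by move=> [q l] /=.
  - by move=> x x0; rewrite E /h' addrC subrK.
split=> [z|].
  rewrite KE; apply: eq_bigr => q _; rewrite mulr_sumr; apply: eq_bigr => l _.
  by rewrite mulrA.
by apply: bdd0_ext bh => x x0; rewrite /AA KE.
Qed.

(** Makes the bound near 0 uniform in [phi] and [v]: [cauchy_bound] transports the estimate of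
    [functional_op_AA] from the circle inwards, at the cost of a factor 2 on the half disk. *)
Lemma bfun_AA_near z c phi : 0 < normc z <= rho / 2 -> 0 <= c -> bfun nrm c phi ->
  bfun nrm (2 * ((1 + N%:R) * C * c)) (AA z phi).
Proof.
move=> /andP[z0 zr] c0 b; have zr' : normc z < rho by lra.
have zr2 : 0 < normc z <= rho by rewrite z0 ltW.
have dA x : 0 < normc x <= rho -> vdif nrm (fun x => AA x phi) x.
  by move=> xr; apply: (@vdif_AA (fun=> phi)) => //; exact: (vdif_cst H x b).
split; first by have [k [l _]] := vdif_bfun (dA z zr2).
move=> v.
have [al [be KP]] := KK_finite_rank; have [_ bA] := KP c phi v b.
have hA : hol (fun x => AA x phi v) rho by move=> x xr; exact: (vdif_dif H v (dA x xr)).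
have v0 := nrm_ge0 H v.
have := @cauchy_bound R _ rho z ((1 + N%:R) * C * c * nrm v) hA bA.
rewrite z0 zr' => /(_ isT) cb.
apply: le_trans (cb _) _.
  by move=> x xr; exact: (((functional_op_AA xr).1 c phi c0 b).2 v).
have M0 : 0 <= (1 + N%:R) * C * c * nrm v by rewrite !mulr_ge0// addr_ge0.
rewrite ler_pdivrMr ?subr_gt0//.
have : (1 + N%:R) * C * c * nrm v * rho <= (1 + N%:R) * C * c * nrm v * (2 * (rho - normc z)).
  by apply: ler_wpM2l => //; lra.
by move=> /le_trans; apply; rewrite le_eqVlt; apply/orP; left; apply/eqP; ring.
Qed.

(** * Replacing the factors of the product one by one *)

Section Chain.
Variables (T : Type) (S : T -> R[i] -> V -> V).

(** The product of the A S_j applied to [phi]. Since [AA] acts on functionals, the product is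
    absorbed into the functional starting from its leftmost factor. *)
Fixpoint chainA (s : seq T) z phi : V -> R[i] :=
  if s is j :: s' then chainA s' z (fun v => AA z phi (S j z v)) else phi.

Fixpoint prodR (s : seq T) z v : V :=
  if s is j :: s' then Rw z (S j z (prodR s' z v)) else v.

Hypothesis dS : forall j z, normc z <= rho -> op_dif nrm (S j) z.

Lemma prodR_bound s z : normc z = rho -> bounded_linear nrm (prodR s z) /\
  forall v, nrm (prodR s z v) <= C ^+ size s * \prod_(j <- s) opnorm nrm (S j z) * nrm v.
Proof.
move=> zr; elim: s => [|j s [bI hI]] /=.
  split; last by move=> v; rewrite expr0 big_nil !mul1r.
  by split; [move=> a u v|exists 1 => v; rewrite mul1r].
have bS : bounded_linear nrm (S j z) by apply/op_dif_bounded/dS; rewrite zr.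
split.
  exact: (bounded_linear_comp H (bR_circ zr) (bounded_linear_comp H bS bI)).
move=> v; apply: le_trans (bR zr _) _; rewrite big_cons exprS.
rewrite [leRHS](_ : _ = C * (opnorm nrm (S j z) * (C ^+ size s * \prod_(j0 <- s) opnorm nrm (S j0 z) * nrm v))); last by ring.
apply: ler_wpM2l => //; apply: le_trans (opnormP H _ bS) _.
by apply: ler_wpM2l => //; exact: (opnorm_ge0 H bS).
Qed.

Lemma vdif_chainA s z psi : 0 < normc z <= rho -> vdif nrm psi z ->
  vdif nrm (fun x => chainA s x (psi x)) z.
Proof.
move=> zr; elim: s psi => [|j s IH] psi dpsi //=.
apply: (IH (fun x v => AA x (psi x) (S j x v))).
apply: (vdif_op H (vdif_AA zr dpsi)); apply: dS; by case/andP: zr.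
Qed.

Lemma vdif_prodR s z psi : 0 < normc z <= rho -> vdif nrm psi z ->
  vdif nrm (fun x v => psi x (prodR s x v)) z.
Proof.
move=> zr; elim: s psi => [|j s IH] psi dpsi //=.
apply: (IH (fun x v => psi x (Rw x (S j x v)))).
apply: (@vdif_op _ _ _ _ H (fun x v => psi x (Rw x v))); last by apply: dS; case/andP: zr.
exact: (vdif_op H dpsi (dR zr)).
Qed.

(** Each factor is bounded near 0, [AA] by [bfun_AA_near] and [S j] by continuity at 0. [M] depends
    neither on the functional nor on [z], as the induction applies it to functionals that vary with
    [z]. *)
Lemma chainA_near s : exists M eta : R, [/\ 0 <= M, 0 < eta & forall z c phi, 0 < normc z < eta -> 0 <= c ->
  bfun nrm c phi -> bfun nrm (M * c) (chainA s z phi)].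
Proof.
elim: s => [|j s [M [eta [M0 eta0 h]]]].
  by exists 1, 1; split => // z c phi _ _; rewrite mul1r.
have dS0 : op_dif nrm (S j) 0 by apply: dS; rewrite normc0 ltW.
have [k k0 hk] := bounded_linear_bound H (op_dif_bounded dS0).
have [d d0 hd] := op_dif_ct H dS0 ltr01.
exists (M * (2 * ((1 + N%:R) * C)) * (1 + k)), (Num.min eta (Num.min d (rho / 2))); split.
- by rewrite !mulr_ge0// addr_ge0.
- by rewrite lt_min eta0 lt_min d0 divr_gt0.
move=> z c phi; rewrite !lt_min => /and4P[z0 ze zd zr] c0 b /=.
have bA := @bfun_AA_near z c phi (ltac:(by rewrite z0 ltW)) c0 b.
have bSz : bounded_linear nrm (S j z) by apply/op_dif_bounded/dS; lra.
have A0 : 0 <= 2 * ((1 + N%:R) * C * c) by rewrite !mulr_ge0// addr_ge0.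
have hS v : nrm (S j z v) <= (1 + k) * nrm v.
  rewrite -(subrK (S j 0 v) (S j z v)) mulrDl; apply: le_trans (nrmD H _ _) _.
  by apply: lerD => //; apply: hd; rewrite subr0.
have := h z _ _ (ltac:(by rewrite z0 ze)) _ (bfun_comp A0 bSz hS bA).
by rewrite (_ : M * _ = M * (2 * ((1 + N%:R) * C)) * (1 + k) * c); [apply; rewrite mulr_ge0// addr_ge0|ring].
Qed.

Variables (n : nat) (b : 'I_n -> V) (f : 'I_n -> V -> R[i]) (g : 'M[R[i]]_n).
Hypothesis fE : forall i v, f i v = \sum_j ip v (b j) * g j i.
Hypothesis fb : forall i k, f i (b k) = (k == i)%:R.

Lemma dual_bfun i : exists c, bfun nrm c (f i).
Proof.
pose u := \sum_j conjc (g j i) *: b j.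
exists (nrm u); rewrite (_ : f i = fun v => ip v u).
  split=> [a v w|v]; first exact: (ip_linear H).
  by rewrite mulrC; exact: (cauchy_schwarz H).
apply/funext => v; rewrite fE /u (ip_sumr H); apply: eq_bigr => j _.
by rewrite (ipZr H) conjcK mulrC.
Qed.

(** [W] collects the factors already replaced. The next factor R = K + A yields a term with K,
    estimated by [trace_le], and a term with A, which goes into [W] for the induction. *)
Lemma chainA_error s z W y : normc z = rho -> functional_op nrm W y -> 0 <= y ->
  normc (\sum_i W (f i) (prodR s z (b i)) - \sum_i chainA s z (W (f i)) (b i)) <=
  #|I|%:R * (y * (((1 + N%:R) ^+ size s - 1) * C ^+ size s * \prod_(j <- s) opnorm nrm (S j z))).
Proof.
move=> zr; elim: s W y => [|j s IH] W y oW y0 /=.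
  by rewrite subrr normc0 expr0 subrr !mul0r !mulr0.
have bS : bounded_linear nrm (S j z) by apply/op_dif_bounded/dS; rewrite zr.
have s0 := opnorm_ge0 H bS.
set sg := opnorm nrm (S j z) in s0.
have [bP hP] := prodR_bound s zr.
set P := C ^+ size s * \prod_(j <- s) opnorm nrm (S j z) in hP.
have P0 : 0 <= P.
  rewrite mulr_ge0 ?exprn_ge0// prodr_ge0// => j' _.
  by apply: (opnorm_ge0 H); apply/op_dif_bounded/dS; rewrite zr.
pose W' phi v := AA z (W phi) (S j z v).
have oW' : functional_op nrm W' ((1 + N%:R) * C * sg * y).
  have [bA lA] := functional_op_AA zr; have [bW lW] := oW.
  split=> [c phi c0 bphi|a phi phi' c c' bphi bphi'].
    have := bfun_comp _ bS (fun v => opnormP H v bS) (bA _ _ (mulr_ge0 y0 c0) (bW _ _ c0 bphi)).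
    rewrite -/sg (_ : (1 + N%:R) * C * (y * c) * sg = (1 + N%:R) * C * sg * y * c); last by ring.
    by apply; rewrite !mulr_ge0// addr_ge0.
  have [k k0 bk] := bfun_bound H bphi; have [k' k'0 bk'] := bfun_bound H bphi'.
  by apply/funext => v; rewrite /W' (lW _ _ _ _ _ bphi bphi') (lA _ _ _ _ _ (bW _ _ k0 bk) (bW _ _ k'0 bk')).
(* Replaced factors on the left, one factor K, untouched factors on the right; the factor K limits
   the rank to #|I|. *)
pose X phi v := KK z (W phi) (S j z (prodR s z v)).
have oX : functional_op nrm X (N%:R * C * sg * P * y).
  have [bK lK] := functional_op_KK zr; have [bW lW] := oW.
  have bSP := bounded_linear_comp H bS bP.
  have hSP v : nrm (S j z (prodR s z v)) <= sg * P * nrm v.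
    apply: le_trans (opnormP H _ bS) _; rewrite -mulrA; apply: ler_wpM2l => //; exact: hP.
  split=> [c phi c0 bphi|a phi phi' c c' bphi bphi'].
    have := bfun_comp _ bSP hSP (bK _ _ (mulr_ge0 y0 c0) (bW _ _ c0 bphi)).
    rewrite (_ : N%:R * C * (y * c) * (sg * P) = N%:R * C * sg * P * y * c); last by ring.
    by apply; rewrite !mulr_ge0.
  have [k k0 bk] := bfun_bound H bphi; have [k' k'0 bk'] := bfun_bound H bphi'.
  by apply/funext => v; rewrite /X (lW _ _ _ _ _ bphi bphi') (lK _ _ _ _ _ (bW _ _ k0 bk) (bW _ _ k'0 bk')).
have [al [be KP]] := KK_finite_rank.
have X0 : 0 <= N%:R * C * sg * P * y by do 3 apply: mulr_ge0 => //; exact: mulr_ge0.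
have tX : normc (\sum_i X (f i) (b i)) <= #|I|%:R * (N%:R * C * sg * P * y).
  apply: (trace_le H (A := fun i q => al (W (f i)) q)
    (B := fun q v => \sum_(l < N) be (S j z (prodR s z v)) q l * (z ^+ l.+1)^-1) fE fb _ oX X0).
  move=> i k; have [c0 bf0] := dual_bfun i; have [c cc bf] := bfun_bound H bf0.
  exact: (KP _ _ _ (oW.1 _ _ cc bf)).1.
have W'0 : 0 <= (1 + N%:R) * C * sg * y by rewrite !mulr_ge0// addr_ge0.
have := IH W' _ oW' W'0.
rewrite -/P => IH'.
have E : \sum_i W (f i) (Rw z (S j z (prodR s z (b i)))) =
    \sum_i X (f i) (b i) + \sum_i W' (f i) (prodR s z (b i)).
  by rewrite -big_split/=; apply: eq_bigr => i _; rewrite /X /W' /AA addrC subrK.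
rewrite E -addrA; apply: le_trans (normcD _ _) _; apply: le_trans (lerD tX IH') _.
(* The bounds add up because N + (1 + N) ((1 + N)^s - 1) = (1 + N)^(s + 1) - 1. *)
rewrite big_cons -/sg le_eqVlt; apply/orP; left; apply/eqP.
rewrite !exprS /P; ring.
Qed.

(** The integrand is holomorphic off 0 and, by [chainA_near], bounded there, so [J_small]
    applies. *)
Lemma J_chainA_eq0 s : J (fun z => \sum_i chainA s z (f i) (b i)) rho = 0.
Proof.
have [M [eta [M0 eta0 h]]] := chainA_near s.
have [c [c0 bc]] : exists c : 'I_n -> R, (forall i, 0 <= c i) /\ forall i, bfun nrm (c i) (f i).
  have [c cP] := choice (fun i => let: ex_intro c0 bc := dual_bfun i in
    let: ex_intro2 d d0 bd := bfun_bound H bc in ex_intro (fun d => 0 <= d /\ bfun nrm d (f i)) d (conj d0 bd)).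
  by exists c; split => i; have [] := cP i.
apply: (@J_small _ _ _ (\sum_i M * c i * nrm (b i)) eta) => //.
  move=> z zr; apply: dif_sum => i.
  exact: (vdif_dif H (b i) (@vdif_chainA s z (fun=> f i) zr (vdif_cst H z (bc i)))).
move=> z zr; apply: le_trans (normc_sum _) _; apply: ler_sum => i _.
exact: (h z (c i) (f i) zr (c0 i) (bc i)).2.
Qed.

(** As the chain of the [AA] integrates to 0, it may be subtracted under the integral, and
    [chainA_error] with [W] the identity bounds the difference on the circle. *)
Lemma J_trace_bound s (sg : T -> R) :
  (forall j z, normc z = rho -> opnorm nrm (S j z) <= sg j) ->
  normc (J (fun z => \sum_i f i (prodR s z (b i))) rho) <=
  2 * pi * (rho * (#|I|%:R * (((1 + N%:R) ^+ size s - 1) * C ^+ size s * \prod_(j <- s) sg j))).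
Proof.
move=> hsg.
have dp z : 0 < normc z <= rho -> dif (fun z => \sum_i f i (prodR s z (b i))) z.
  move=> zr; apply: dif_sum => i; have [c bc] := dual_bfun i.
  exact: (vdif_dif H (b i) (@vdif_prodR s z (fun=> f i) zr (vdif_cst H z bc))).
have dc z : 0 < normc z <= rho -> dif (fun z => \sum_i chainA s z (f i) (b i)) z.
  move=> zr; apply: dif_sum => i; have [c bc] := dual_bfun i.
  exact: (vdif_dif H (b i) (@vdif_chainA s z (fun=> f i) zr (vdif_cst H z bc))).
have circ F : (forall z, 0 < normc z <= rho -> dif F z) -> cct_circ F rho.
  by move=> dF z zr; apply/dif_cct/dF; rewrite zr rho0 lexx.
have -> : J (fun z => \sum_i f i (prodR s z (b i))) rho =
    J (fun z => \sum_i f i (prodR s z (b i)) - \sum_i chainA s z (f i) (b i)) rho.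
  by rewrite JB ?J_chainA_eq0 ?subr0//; [exact: ltW|exact: (circ _ dp)|exact: (circ _ dc)].
apply: J_bound; first exact: ltW.
  by apply: circ => z zr; apply: difB; [exact: dp|exact: dc].
move=> z zr.
have oid : functional_op nrm (fun phi => phi) 1.
  by split=> // c phi c0; rewrite mul1r.
apply: le_trans (chainA_error s zr oid ler01) _; apply: ler_wpM2l => //.
rewrite mul1r; apply: ler_wpM2l.
  by rewrite mulr_ge0 ?exprn_ge0// subr_ge0 exprn_ege1// lerDl.
elim: s {dp dc} => [|j s IH]; first by rewrite !big_nil.
rewrite !big_cons; apply: ler_pM => //; last exact: hsg.
  by apply: (opnorm_ge0 H); apply/op_dif_bounded/dS; rewrite zr.
by apply: prodr_ge0 => j' _; apply: (opnorm_ge0 H); apply/op_dif_bounded/dS; rewrite zr.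
Qed.

End Chain.
End Resolvent.

(** * Polar expansion of a quotient *)

Section PoleExpansion.
Context {R : realType}.
Implicit Types (g : R[i] -> R[i]) (z : R[i]) (rho : R).

Lemma expf_div z s M : z != 0 -> (s <= M)%N -> z ^+ s / z ^+ M = (z ^+ (M - s))^-1.
Proof. by move=> z0 sM; rewrite -{1}(subnK sM) exprD invfM mulrCA divff ?mulr1// expf_neq0. Qed.

(** In g / z^M the Taylor coefficient of index M - l - 1 belongs to z^-(l + 1). Zeros pad the list
    up to [N], so that poles of different orders share one index range. *)
Lemma pole_expansion g rho M N : 0 < rho -> hol g rho -> bdd0 g -> (M <= N)%N ->
  exists be : 'I_N -> R[i], bdd0 (fun z => g z / z ^+ M - \sum_(l < N) be l * (z ^+ l.+1)^-1).
Proof.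
move=> r0 hg bg MN; have [al bt] := taylor M r0 hg bg.
exists (fun l : 'I_N => if (l < M)%N then al (M - l.+1)%N else 0).
apply: bdd0_ext bt => z z0; rewrite mulrBl; congr (_ - _).
rewrite mulr_suml (reindex_inj rev_ord_inj)/=.
rewrite (big_ord_widen_cond N xpredT (fun l => al (M - l.+1)%N * z ^+ (M - l.+1) / z ^+ M) MN)/=.
rewrite big_mkcond/=; apply: eq_bigr => l _; case: ltnP => lM; last by rewrite mul0r.
by rewrite -mulrA expf_div ?leq_subr// subKn.
Qed.

Lemma cct0_bdd0 g : cct g 0 -> bdd0 g.
Proof.
move=> cg; have [d d0 h] := cg 1 ltr01; exists (1 + normc (g 0)), d; split=> // z /andP[_ zd].
rewrite -(subrK (g 0) (g z)); apply: le_trans (normcD _ _) _.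
by rewrite lerD2r; apply/ltW/h; rewrite subr0.
Qed.

End PoleExpansion.

(** * The trace estimate for an operator family with a local factorization *)

Section OperatorTrace.
Context {R : realType} {V : lmodType R[i]} {ip : V -> V -> R[i]} {nrm : V -> R}.
Hypothesis H : inner_product_norm ip nrm.

Lemma rank_one_functional (T : V -> V) : bounded_linear nrm T -> rank_one T ->
  exists x xi c, bfun nrm c xi /\ forall v, T v = xi v *: x.
Proof.
move=> bT [b [lb sb]]; pose x := b ord0.
have x0 : x != 0.
  apply/eqP => x0; have := lb (fun=> 1); rewrite big_ord1 scale1r -/x x0 => /(_ erefl ord0) /eqP.
  by rewrite oner_eq0.
have h v : exists c : R[i], T v = c *: x.
  have : range T (T v) by exists v.
  by rewrite sb => -[c ->]; exists (c ord0); rewrite big_ord1.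
have [xi xiE] := choice h.
have nx := nrm_gt0 H x0.
have [c c0 hc] := bounded_linear_bound H bT.
exists x, xi, (c / nrm x); split => //; split=> [a u v|v].
  apply/eqP; rewrite -subr_eq0; have : (xi (a *: u + v) - (a * xi u + xi v)) *: x == 0.
    rewrite scalerBl scalerDl -scalerA -!xiE (bounded_linearD bT) (bounded_linearZ bT).
    by rewrite subrr.
  by rewrite scaler_eq0 (negPf x0) orbF.
by rewrite mulrAC ler_pdivlMr// -(nrmZ H) -xiE.
Qed.

(** The factorization inverts to F^-1 (Pran + \sum_i w^-(r i) Pker_i) E^-1. With Pker_i v = xi_i(v)
    x_i, the i-th singular term is phi(F^-1 x_i) xi_i(E^-1 v) / w^(r i). Expanding only the first
    factor, up to order r_i, gives one product for each pair (i, s) with s < r_i, a number depending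
    on [phi] times a function depending on [v]. This is where the rank \sum_i r_i comes from. *)
Lemma singular_expansion (D : R[i] -> V -> V) a rho n (r : 'I_n.+1 -> nat) E F Pran Pker :
  0 < rho -> local_factorization nrm D a rho r E F Pran Pker ->
  (forall z, 0 < normc z < rho -> op_invertible nrm (D (a + z))) ->
  exists (al : (V -> R[i]) -> {i : 'I_n.+1 & 'I_(r i)} -> R[i])
      (be : V -> {i : 'I_n.+1 & 'I_(r i)} -> 'I_(r ord0) -> R[i]),
    forall c phi v, bfun nrm c phi ->
      bdd0 (fun x => phi (op_inv nrm (D (a + x)) v) -
        \sum_q \sum_(l < r ord0) al phi q * be v q l * (x ^+ l.+1)^-1).
Proof.
move=> rho0 lf Dinv.
pose Fi w := op_inv nrm (F (a + w)); pose Ei w := op_inv nrm (E (a + w)).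
have odz w : normc w < rho -> odisk a rho (a + w) by move=> wr; rewrite /odisk /= addrAC subrr add0r.
have iF w : normc w < rho -> is_inverse nrm (F (a + w)) (Fi w).
  by move=> wr; apply/op_invP/(lf_invF lf)/odz.
have iE w : normc w < rho -> is_inverse nrm (E (a + w)) (Ei w).
  by move=> wr; apply/op_invP/(lf_invE lf)/odz.
have near w : normc w < rho -> exists2 d, 0 < d & forall x, normc (x - w) < d -> normc x < rho.
  move=> wr; exists (rho - normc w); first by rewrite subr_gt0.
  by move=> x xw; have := normcD (x - w) w; rewrite subrK; lra.
have dFi w : normc w < rho -> op_dif nrm Fi w.
  move=> wr; apply: (op_dif_inv H (op_dif_shift (holomorphic_op_dif H (lf_holF lf) (odz w wr)))).
  by have [d d0 h] := near w wr; exists d => // x /h; exact: iF.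
have dEi w : normc w < rho -> op_dif nrm Ei w.
  move=> wr; apply: (op_dif_inv H (op_dif_shift (holomorphic_op_dif H (lf_holE lf) (odz w wr)))).
  by have [d d0 h] := near w wr; exists d => // x /h; exact: iE.
have [x /choice[xi rk]] := @choice _ _ (fun i x => exists xi c, bfun nrm c xi /\
  forall v, Pker i v = xi v *: x) (fun i => rank_one_functional (lf_projK lf i).1 (lf_rank1 lf i)).
have bPr := (lf_projR lf).1; have bPk i := (lf_projK lf i).1.
have PrPr v : Pran (Pran v) = Pran v by exact: (lf_projR lf).2.
have PkPk i v : Pker i (Pker i v) = Pker i v by exact: (lf_projK lf i).2.
(* The candidate is checked by applying [D (a + w)] to it: the projections are disjoint, so the
   powers of w cancel and [lf_sum] restores the vector. *)
have RE w v : 0 < normc w < rho -> op_inv nrm (D (a + w)) v =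
    Fi w (Pran (Ei w v) + \sum_i (w ^+ r i)^-1 *: Pker i (Ei w v)).
  move=> /andP[w0 wr]; have wn0 : w != 0 by rewrite -normc_gt0.
  have [bD DK KD] := op_invP (Dinv w (ltac:(by rewrite w0 wr))).
  have [bF FK KF] := iF w wr; have [bE EK KE] := iE w wr.
  set y := Fi w _; rewrite -[RHS]DK; congr (op_inv nrm (D (a + w)) _).
  rewrite (lf_eq lf (odz w wr)) /y KF addrAC subrr add0r; set u := Ei w v.
  have sumP (T : V -> V) : bounded_linear nrm T ->
      T (\sum_i (w ^+ r i)^-1 *: Pker i u) = \sum_i (w ^+ r i)^-1 *: T (Pker i u).
    move=> bT; elim/big_ind2: _ => [|p q p' q' hp hq|i _].
    - exact: bounded_linear0 bT.
    - by rewrite (bounded_linearD bT) hp hq.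
    - exact: bounded_linearZ bT _ _.
  rewrite (bounded_linearD bPr) PrPr (sumP _ bPr) [X in _ + X + _]big1; last first.
    by move=> i _; rewrite (lf_disjRK lf i u).1 scaler0.
  rewrite addr0 (eq_bigr (fun i => Pker i u)) ?(lf_sum lf) ?KE// => i _.
  rewrite (bounded_linearD (bPk i)) (lf_disjRK lf i u).2 add0r (sumP _ (bPk i)).
  rewrite (bigD1 i)//= big1 ?addr0; first by rewrite PkPk scalerA divff ?scale1r// expf_neq0.
  by move=> i' i'i; rewrite (lf_disjKK lf) 1?eq_sym// scaler0.
have rho2 : 0 < rho / 2 by rewrite divr_gt0.
have lt2 z : normc z <= rho / 2 -> normc z < rho by lra.
have norm00 : normc (0 : R[i]) < rho by rewrite normc0.
have hphi phi c i : bfun nrm c phi -> hol (fun w => phi (Fi w (x i))) (rho / 2) /\ bdd0 (fun w => phi (Fi w (x i))).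
  move=> b; have h z : normc z < rho -> dif (fun w => phi (Fi w (x i))) z.
    by move=> zr; exact: (vdif_dif H (x i) (vdif_op H (vdif_cst H z b) (dFi z zr))).
  split; last by apply/cct0_bdd0/dif_cct/h.
  by move=> z /andP[_ /lt2]; exact: h.
have hxi i v : hol (fun w => xi i (Ei w v)) (rho / 2) /\ bdd0 (fun w => xi i (Ei w v)).
  have [c [b _]] := rk i; have h z : normc z < rho -> dif (fun w => xi i (Ei w v)) z.
    by move=> zr; exact: (vdif_dif H v (vdif_op H (vdif_cst H z b) (dEi z zr))).
  split; last by apply/cct0_bdd0/dif_cct/h.
  by move=> z /andP[_ /lt2]; exact: h.
(* The coefficients are chosen for all functionals at once, as [al] must be defined on every one; an
   unbounded functional receives 0. *)
have /choice[al alP] : forall p : (V -> R[i]) * 'I_n.+1, exists al : nat -> R[i], forall c, bfun nrm c p.1 ->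
    bdd0 (fun w => (p.1 (Fi w (x p.2)) - \sum_(s < r p.2) al s * w ^+ s) / w ^+ r p.2).
  move=> [phi i] /=.
  have [[c b]|nb] := pselect (exists c, bfun nrm c phi); last first.
    by exists (fun=> 0) => c b; exfalso; apply: nb; exists c.
  have [h1 h2] := hphi phi c i b.
  by have [al h] := taylor (r i) rho2 h1 h2; exists al.
(* The pole order r_i - s is at most [r ord0], since the orders are sorted decreasingly. *)
have /choice[be beP] : forall p : V * {i : 'I_n.+1 & 'I_(r i)}, exists be : 'I_(r ord0) -> R[i],
    bdd0 (fun w => xi (tag p.2) (Ei w p.1) / w ^+ (r (tag p.2) - tagged p.2) -
      \sum_(l < r ord0) be l * (w ^+ l.+1)^-1).
  move=> [v [i s]] /=.
  have [h1 h2] := hxi i v; apply: (pole_expansion rho2 h1 h2).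
  by apply: leq_trans (leq_subr _ _) _; exact: (lf_sorted lf).
exists (fun phi (q : {i : 'I_n.+1 & 'I_(r i)}) => al (phi, tag q) (tagged q)), (fun v q l => be (v, q) l) => c phi v b.
(* The three bounded remainders: the part on the range of [Pran], the Taylor remainders of the first
   factors divided by w^(r i), and the regular parts of the second factors. *)
pose B1 w := phi (Fi w (Pran (Ei w v))).
pose B2 w := \sum_i ((phi (Fi w (x i)) - \sum_(s < r i) al (phi, i) s * w ^+ s) / w ^+ r i) * xi i (Ei w v).
pose B3 w := \sum_(q : {i : 'I_n.+1 & 'I_(r i)}) al (phi, tag q) (tagged q) * (xi (tag q) (Ei w v) / w ^+ (r (tag q) - tagged q) -
      \sum_(l < r ord0) be (v, q) l * (w ^+ l.+1)^-1).
have bB : bdd0 (fun w => B1 w + B2 w + B3 w).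
  apply: bdd0D; first apply: bdd0D.
  - apply/cct0_bdd0/dif_cct.
    have dPr : op_dif nrm (fun=> Pran) 0.
      split; first by exists 1 => // y _.
      exists (fun=> 0).
        by split=> [k u w|]; [rewrite scaler0 addr0|exists 0 => w; rewrite mul0r (nrm0 H)].
      move=> e e0; exists 1 => // y _ w; rewrite subrr scaler0 subr0 (nrm0 H).
      by rewrite !mulr_ge0 ?normc_ge0 ?(nrm_ge0 H)// ltW.
    have d1 := vdif_op H (vdif_cst H 0 b) (dFi 0 norm00).
    exact: (vdif_dif H v (vdif_op H (vdif_op H d1 dPr) (dEi 0 norm00))).
  - apply: bdd0_sum => i; apply: bdd0M; first exact: (alP (phi, i) c b).
    exact: (hxi i v).2.
  - by apply: bdd0_sum => q; apply: bdd0M; [exact: bdd0_cst|exact: (beP (v, q))].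
have [M [eta [eta0 hB]]] := bB.
exists M, (Num.min eta rho); split; first by rewrite lt_min eta0.
move=> w; rewrite lt_min => /and3P[w0 we wr]; have wn0 : w != 0 by rewrite -normc_gt0.
have := hB w (ltac:(by rewrite w0 we)); congr (normc _ <= _).
rewrite RE ?w0//; have [bF _ _] := iF w wr.
rewrite (bounded_linearD bF) (bfunD b) -[B1 w + _ + _]addrA -[RHS]addrA; congr (_ + _).
have -> : phi (Fi w (\sum_i (w ^+ r i)^-1 *: Pker i (Ei w v))) =
    \sum_i (w ^+ r i)^-1 * (xi i (Ei w v) * phi (Fi w (x i))).
  have lF : forall s : seq 'I_n.+1, Fi w (\sum_(i <- s) (w ^+ r i)^-1 *: Pker i (Ei w v)) =
      \sum_(i <- s) (w ^+ r i)^-1 *: (xi i (Ei w v) *: Fi w (x i)).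
    elim=> [|i s IH]; first by rewrite !big_nil (bounded_linear0 bF).
    rewrite !big_cons (bounded_linearD bF) IH (bounded_linearZ bF); have [ci [_ ->]] := rk i.
    by rewrite (bounded_linearZ bF).
  by rewrite lF (bfun_sum b); apply: eq_bigr => i _; rewrite !(bfunZ b).
have -> : B3 w = \sum_i \sum_(s < r i) al (phi, i) s * (xi i (Ei w v) / w ^+ (r i - s)) -
   \sum_(q : {i : 'I_n.+1 & 'I_(r i)}) \sum_(l < r ord0) al (phi, tag q) (tagged q) * be (v, q) l * (w ^+ l.+1)^-1.
  rewrite sig_big_dep/= -sumrB; apply: eq_bigr => q _; rewrite mulrBr; congr (_ - _).
  by rewrite mulr_sumr; apply: eq_bigr => l _; rewrite mulrA.
rewrite addrA; congr (_ - _); rewrite -big_split/=; apply: eq_bigr => i _.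
have -> : \sum_(s < r i) al (phi, i) s * (xi i (Ei w v) / w ^+ (r i - s)) =
    (\sum_(s < r i) al (phi, i) s * w ^+ s) * (xi i (Ei w v) / w ^+ r i).
  rewrite mulr_suml; apply: eq_bigr => s _.
  by rewrite -(expf_div wn0 (ltnW (ltn_ord s))); ring.
by ring.
Qed.

(** A [sup] dominates the elements of its set when that set is bounded above, which follows here
    from continuity of the operator norm on the circle. *)
Lemma opnorm_bounded_circle (F : R[i] -> V -> V) a rho :
  (forall z, normc z = rho -> op_dif nrm (fun x => F (a + x)) z) ->
  forall z, normc z = rho -> opnorm nrm (F (a + z)) <= max_circle nrm F a rho.
Proof.
move=> dF z zr.
(* The norm is viewed as a complex function to make [circle_bounded] applicable. *)
have c : cct_circ (fun z => (opnorm nrm (F (a + z)))%:C) rho.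
  move=> w wr e e0; have dFw := dF w wr.
  have [d1 d10 h1] := op_dif_ct H dFw (ltac:(by rewrite divr_gt0) : 0 < e / 2).
  have [[d2 d20 h2] _] := dFw; have bw := op_dif_bounded dFw.
  exists (Num.min d1 d2); first by rewrite lt_min d10.
  move=> y; rewrite lt_min => /andP[y1 y2]; have by_ := h2 y y2.
  rewrite -rCB normcR ltr_norml; apply/andP; split.
    have : opnorm nrm (F (a + w)) <= opnorm nrm (F (a + y)) + e / 2; last by lra.
    apply: (opnorm_le H).
      by rewrite addr_ge0 ?(opnorm_ge0 H)// divr_ge0// ltW.
    move=> v; rewrite -(subKr (F (a + y) v) (F (a + w) v)) mulrDl.
    apply: le_trans (nrmB H _ _) _; apply: lerD; first exact: (opnormP H).
    exact: h1.
  have : opnorm nrm (F (a + y)) <= opnorm nrm (F (a + w)) + e / 2; last by lra.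
  apply: (opnorm_le H).
    by rewrite addr_ge0 ?(opnorm_ge0 H)// divr_ge0// ltW.
  move=> v; rewrite -(subrK (F (a + w) v) (F (a + y) v)) mulrDl addrC.
  apply: le_trans (nrmD H _ _) _; apply: lerD; first exact: (opnormP H).
  exact: h1.
have [M hM] := circle_bounded c.
apply: ub_le_sup; last first.
  by exists (a + z) => //; rewrite /circle /= addrAC subrr add0r.
exists M => _ [y /= yr <-]; have := hM (y - a) yr.
by rewrite addrC subrK normcR; apply: le_trans; exact: ler_norm.
Qed.

(** [is_circle_integral] constrains the operator through fine partitions only, so one of every mesh
    has to be exhibited. *)
Lemma partition_exists (d : R) : 0 < d -> exists N t, tagged_partition N t t d.
Proof.
move=> d0; have p0 := @twopi_gt0 R.
have [N Nd] : exists N : nat, 2 * pi / d < N%:R.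
  exists (Num.truncn (2 * pi / d)).+1; exact: truncnS_gt.
have N0 : 0 < N%:R :> R by apply: le_lt_trans Nd; rewrite divr_ge0// ltW.
exists N, (fun i => 2 * pi * i%:R / N%:R); split.
- by rewrite mulr0 mul0r.
- by rewrite mulfK// gt_eqF.
- move=> i iN; rewrite lexx /=; split.
    by apply: ler_wpM2r; rewrite ?invr_ge0 ?ler0n//; apply: ler_wpM2l; rewrite ?(ltW p0)// ler_nat.
  have e1 : i.+1%:R - i%:R = 1 :> R by rewrite -[i.+1]addn1 natrD addrAC subrr add0r.
  rewrite -mulrBl -mulrBr e1 mulr1.
  by rewrite ltr_pdivrMr// (mulrC d) -ltr_pdivrMr.
Qed.

(** Both sides are limits of the same Riemann sums; the factor i is the one that [J] leaves out of
    dz. It reduces the operator integral to the scalar theory. *)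
Lemma functional_circle_integral (F : R[i] -> V -> V) a rho T c phi v : 0 < rho ->
  bfun nrm c phi -> cct_circ (fun z => phi (F (a + z) v)) rho ->
  is_circle_integral nrm F a rho T ->
  phi (T v) = (0 +i* 1) * J (fun z => phi (F (a + z) v)) rho.
Proof.
move=> r0 b0 cF [bT hT]; have [k k0 b] := bfun_bound H b0.
apply/eqP; rewrite -subr_eq0 -normc_eq0 eq_le normc_ge0 andbT.
apply/ler_addgt0Pl => e e0; rewrite addr0.
pose h s := phi (F (a + rho%:C * expi s) v) * (rho%:C * expi s).
have ch : ct_on 0 (2 * pi) h by apply: (J_ct_on (ltW r0) cF).
have v0 := nrm_ge0 H v.
pose m := k * nrm v; have m0 : 0 <= m by rewrite mulr_ge0.
have [d1 d10 h1] := cI_Riemann ch (ltac:(by rewrite divr_gt0) : 0 < e / 2).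
have [d2 d20 h2] := hT (e / 2 / (1 + m)) (ltac:(by rewrite !divr_gt0// ltr_wpDr)).
have [N [t tP]] := partition_exists (ltac:(by rewrite lt_min d10) : 0 < Num.min d1 d2).
have tP1 : tagged_partition N t t d1.
  case: tP => t0 tN ti; split => // i iN; have [? lt] := ti i iN; split => //.
  by apply: lt_le_trans lt _; rewrite ge_min lexx.
have tP2 : tagged_partition N t t d2.
  case: tP => t0 tN ti; split => // i iN; have [? lt] := ti i iN; split => //.
  by apply: lt_le_trans lt _; rewrite ge_min lexx orbT.
have g1 := h1 _ _ _ tP1; have g2 := h2 _ _ _ tP2 v.
have E : phi (circle_sum F a rho N t t v) = (0 +i* 1) * \sum_(i < N) (t i.+1 - t i)%:C * h (t i).
  rewrite /circle_sum (bfun_sum b) mulr_sumr; apply: eq_bigr => i _.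
  by rewrite (bfunZ b) /h; ring.
rewrite (_ : phi (T v) - _ = - phi (circle_sum F a rho N t t v - T v) + (0 +i* 1) *
  (\sum_(i < N) (t i.+1 - t i)%:C * h (t i) - cI 0 (2 * pi) h)); last first.
  by rewrite (bfunB b) E /J; ring.
apply: le_trans (normcD _ _) _; rewrite normcN normcM normc_i mul1r (splitr e).
apply: lerD => //; apply: le_trans (b.2 _) _.
apply: le_trans (ler_wpM2l k0 g2) _.
by rewrite mulrCA -/m mulrC; apply: ler_mul_div1D => //; rewrite divr_ge0// ltW.
Qed.

Theorem operator_trace_bound (D : R[i] -> V -> V) (a : R[i]) (delta rho : R) :
  0 < rho < delta -> holomorphic_on nrm (cdisk a delta) D ->
  (forall z, cdisk a delta z -> z <> a -> op_invertible nrm (D z)) ->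
  forall (ds : R) n (r : 'I_n.+1 -> nat) E F Pran Pker, 0 < ds < delta ->
  local_factorization nrm D a ds r E F Pran Pker ->
  forall p (S : 'I_p -> R[i] -> V -> V) (C : R), (0 < p)%N ->
  (forall i, holomorphic_on nrm (cdisk a rho) (S i)) ->
  max_circle nrm (fun z => op_inv nrm (D z)) a rho <= C ->
  normc ((2%:R * (@pi R)%:C * (0 +i* 1))^-1 *
     op_trace (circle_integral nrm (Hprod nrm D S) a rho))
  <= 2%:R^-1 * (\sum_i r i)%N%:R * rho * (2%:R ^+ (r ord0 + 2) * C) ^+ p *
     \prod_i max_circle nrm (S i) a rho.
Proof.
move=> /andP[rho0 rd] hD iD ds n r E F Pran Pker /andP[ds0 dsd] lf p S C p0 hS hC.
pose Rw w := op_inv nrm (D (a + w)).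
have cd z : normc z <= delta -> cdisk a delta (a + z).
  by rewrite /cdisk /= addrAC subrr add0r.
have iDz z : 0 < normc z -> normc z <= delta -> op_invertible nrm (D (a + z)).
  move=> z0 zd; apply: iD; first exact: cd.
  move=> /eqP; rewrite -[X in _ == X]addr0 (inj_eq (addrI a)) => /eqP zE.
  by move: z0; rewrite zE normc0 ltxx.
have dR z : 0 < normc z <= rho -> op_dif nrm Rw z.
  move=> /andP[z0 zr]; have zd : normc z <= delta by lra.
  apply: (op_dif_inv H (op_dif_shift (holomorphic_op_dif H hD (cd z zd)))).
  (* Closer to z than |z|, the point x is not 0; closer than delta - rho, it stays within the disk
     of radius delta. *)
  exists (Num.min (normc z) (delta - rho)); first by rewrite lt_min z0 subr_gt0.
  move=> x; rewrite lt_min => /andP[x1 x2]; apply: op_invP; apply: iDz.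
    rewrite normc_gt0; apply: contraTneq x1 => ->.
    by rewrite sub0r normcN ltxx.
  by have := normcD (x - z) z; rewrite subrK; lra.
have dS j z : normc z <= rho -> op_dif nrm (fun x => S j (a + x)) z.
  move=> zr; apply: op_dif_shift; apply: (holomorphic_op_dif H (hS j)).
  by rewrite /cdisk /= addrAC subrr add0r.
have maxR z : normc z = rho -> opnorm nrm (Rw z) <= C.
  move=> zr; apply: le_trans hC.
  apply: (opnorm_bounded_circle (F := fun z => op_inv nrm (D z)) _ zr) => w wr.
  by apply: dR; rewrite wr rho0 lexx.
have maxS j z : normc z = rho -> opnorm nrm (S j (a + z)) <= max_circle nrm (S j) a rho.
  by apply: opnorm_bounded_circle => w wr; apply: dS; rewrite wr.
have rr : normc (rho%:C : R[i]) = rho by rewrite normcR ger0_norm// ltW.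
have C0 : 0 <= C.
  apply: le_trans (maxR _ rr); apply: (opnorm_ge0 H); apply/op_dif_bounded/dR.
  by rewrite rr rho0 lexx.
have S0 j : 0 <= max_circle nrm (S j) a rho.
  apply: le_trans (maxS j _ rr); apply: (opnorm_ge0 H).
  by apply: (@op_dif_bounded _ _ _ (fun x => S j (a + x))); apply: dS; rewrite rr.
have PS0 : 0 <= \prod_i max_circle nrm (S i) a rho by rewrite prodr_ge0.
have RHS0 : 0 <= 2%:R^-1 * (\sum_i r i)%N%:R * rho * (2%:R ^+ (r ord0 + 2) * C) ^+ p *
     \prod_i max_circle nrm (S i) a rho.
  by rewrite !mulr_ge0 ?invr_ge0 ?exprn_ge0 ?mulr_ge0 ?exprn_ge0 ?ler0n// ltW.
(* Covers the default value 0 of a trace or an integral that does not exist. *)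
have triv (t : R[i]) : t = 0 -> normc ((2%:R * (@pi R)%:C * (0 +i* 1))^-1 * t) <=
    2%:R^-1 * (\sum_i r i)%N%:R * rho * (2%:R ^+ (r ord0 + 2) * C) ^+ p *
     \prod_i max_circle nrm (S i) a rho.
  by move=> ->; rewrite mulr0 normc0.
rewrite /op_trace; case: xgetP => [t _ /= ht|_]; last exact: triv.
have {ht} [n' [b [Cs [W [A [lb sb _ TA tA]]]]]] := ht.
have [g gP] := gram_dual_basis H lb.
pose f i v := \sum_j ip v (b j) * g j i.
have fb i k : f i (b k) = (k == i)%:R by exact: gP.
have bf i := dual_bfun H (fun i v => erefl (f i v)) i.
(* The trace read off with the dual functionals, so that only values of T on the basis [b] enter. *)
have tE T : (forall j, T (b j) = \sum_i A i j *: b i) -> t = \sum_i f i (T (b i)).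
  move=> TA'; rewrite tA; apply: eq_bigr => i _; rewrite TA'; have [c bc] := bf i.
  rewrite (bfun_sum bc) (bigD1 i)//= (bfunZ bc) fb eqxx mulr1 big1 ?addr0// => k ki.
  by rewrite (bfunZ bc) fb (negPf ki) mulr0.
move: TA; rewrite /circle_integral; case: xgetP => [T _ /= hT|_] TA; last first.
  apply: triv; apply: (etrans (tE (fun=> 0) TA)); rewrite big1// => i _; have [c bc] := bf i; exact: bfun0 bc.
have HE z v : Hprod nrm D S (a + z) v =
    prodR Rw (fun j x => S j (a + x)) (index_enum 'I_p) z v.
  rewrite /Hprod; elim: (index_enum 'I_p) v => [|j s IH] v; first by rewrite big_nil.
  by rewrite big_cons /= IH.
(* The factorization holds on the disk of radius [ds], which may be smaller than [rho]; this is
   enough, as [sing] concerns behaviour near 0. *)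
have [al [be sing]] := singular_expansion ds0 lf (fun z zr =>
   iDz z (proj1 (andP zr)) (ltW (lt_trans (proj2 (andP zr)) dsd))).
pose I : finType := {i : 'I_n.+1 & 'I_(r i)}.
have cI : #|I| = (\sum_i r i)%N.
  by rewrite card_tagged sumnE big_map big_enum; apply: eq_bigr => i _; rewrite card_ord.
pose N := r ord0; pose sg j := max_circle nrm (S j) a rho.
have bR z : normc z = rho -> forall v, nrm (Rw z v) <= C * nrm v.
  move=> zr v; have bRz : bounded_linear nrm (Rw z) by apply/op_dif_bounded/dR; rewrite zr rho0 lexx.
  apply: le_trans (opnormP H v bRz) _; apply: ler_wpM2r; first exact: nrm_ge0 H v.
  exact: maxR.
have := @J_trace_bound R V ip nrm H Rw rho C N I rho0 C0 dR bR
  (ex_intro _ al (ex_intro _ be sing)) 'I_p (fun j x => S j (a + x)) dS n' b f g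
  (fun i v => erefl (f i v)) fb (index_enum 'I_p) sg maxS.
set P := fun z => \sum_i _ => JP.
have tJ : t = (0 +i* 1) * J P rho.
  apply: (etrans (tE _ TA)).
  have cf i : cct_circ (fun z => f i (Hprod nrm D S (a + z) (b i))) rho.
    move=> z zr; have [c bc] := bf i; apply: dif_cct.
    rewrite (_ : (fun z => _) = fun z => f i (prodR Rw (fun j x => S j (a + x)) (index_enum 'I_p) z (b i))); last first.
      by apply/funext => y; rewrite HE.
    have zr' : 0 < normc z <= rho by rewrite zr rho0 lexx.
    exact: (vdif_dif H (b i) (@vdif_prodR _ _ _ _ H _ _ dR _ _ dS (index_enum 'I_p) z (fun=> f i) zr' (vdif_cst H z bc))).
  rewrite (eq_bigr (fun i => (0 +i* 1) * J (fun z => f i (Hprod nrm D S (a + z) (b i))) rho)); last first.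
    by move=> i _; have [c bc] := bf i; exact: (functional_circle_integral rho0 bc (cf i) hT).
  rewrite -mulr_sumr -J_sum//; last exact: ltW.
  congr (_ * _); apply: J_ext; first exact: ltW.
  by move=> z zr; apply: eq_bigr => i _; rewrite HE.
rewrite tJ normcM normcV !normcM normc_i mul1r mulr1.
have -> : normc (2%:R : R[i]) = 2.
  by rewrite (_ : 2%:R = (2 : R)%:C) ?normcR ?ger0_norm// rmorph_nat.
have p0' := @pi_gt0 R; have tp0 := @twopi_gt0 R.
rewrite normcR (ger0_norm (ltW p0')) mulrC ler_pdivrMr//.
apply: le_trans JP _; rewrite cI [leRHS]mulrC; apply: ler_wpM2l; first exact: ltW.
have -> : size (index_enum 'I_p) = p by rewrite [index_enum _]unlock -enumT size_enum_ord.
rewrite -[X in _ <= X * _](_ : (\sum_i r i)%N%:R * rho * (2^-1 * (2 ^+ (N + 2)) ^+ p * C ^+ p) = _); last first.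
  by rewrite exprMn; ring.
have m0 : 0 <= (\sum_i r i)%N%:R * rho :> R by rewrite mulr_ge0// ltW.
rewrite [leLHS](_ : _ = (\sum_i r i)%N%:R * rho * ((((1 + N%:R) ^+ p - 1) * C ^+ p) * \prod_i sg i)); last by ring.
rewrite -[leRHS]mulrA; apply: ler_wpM2l => //; apply: ler_wpM2r => //.
apply: ler_wpM2r; first by rewrite exprn_ge0.
(* Here 1 + N <= 2^N. It remains that (2^N)^p is at most half of (2^N)^p 4^p, which holds because p
   > 0 gives 4 <= 4^p. *)
have a1 : (1 + N%:R) ^+ p <= (2 ^+ N) ^+ p :> R.
  rewrite lerXn2r ?nnegrE ?addr_ge0 ?exprn_ge0// addrC natr1 -natrX ler_nat.
  by rewrite ltn_expl.
have a2 : 1 <= (2 ^+ N) ^+ p :> R by rewrite !exprn_ege1// ler1n.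
have a3 : 4 <= 4 ^+ p :> R.
  by rewrite -(prednK p0) exprS ler_peMr// exprn_ege1// ler1n.
rewrite exprD exprMn (_ : 2 ^+ 2 = 4 :> R); last by rewrite expr2; ring.
have : (2 ^+ N) ^+ p * 4 <= (2 ^+ N) ^+ p * 4 ^+ p :> R by apply: ler_wpM2l => //; lra.
lra.
Qed.

End OperatorTrace.

(** * Traces of null functions vanish *)

Section NullTrace.
Context {R : realType}.
Let plane := (measurableTypeR R * measurableTypeR R)%type.
Implicit Types (f : R * R -> R) (t s h : R).

Lemma ge0_integral_mrestr d (T : measurableType d) (mu : {measure set T -> \bar R})
    (D : set T) (mD : measurable D) (f : T -> \bar R) : measurable_fun setT f -> (forall x : T, 0 <= f x)%E ->
  (\int[mrestr mu mD]_x f x = \int[mu]_(x in D) f x)%E.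
Proof.
move=> mf f0; transitivity (\int[mrestr mu mD]_(x in D) f x)%E.
  rewrite [RHS]integral_mkcond; apply: ge0_ae_eq_integral => //.
  - exact/(measurable_restrictT _ mD).1/(measurable_funS measurableT).
  - by move=> x _; exact: erestrict_ge0.
  - exists (~` D); split; first exact: measurableC.
      by rewrite /= /mrestr setICl measure0.
    by move=> x /= nx Dx; apply: nx => _; rewrite patchE mem_set.
apply: eq_measure_integral => A mA AD; rewrite /= /mrestr; congr (mu _).
exact/setIidl.
Qed.

Lemma derivable_vertical f t s : derivable f (t, s) (0, 1) ->
  derivable (fun y => f (t, y)) s 1 /\ derive1 (fun y => f (t, y)) s = 'D_(0, 1) f (t, s).
Proof.
have E : (fun h : R => h^-1 *: (f (h *: (0, 1) + (t, s)) - f (t, s))) =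
    (fun h : R => h^-1 *: (f (t, h *: 1 + s) - f (t, s))).
  apply/funext => h; congr (_ *: (f _ - _)).
  by apply/pair_equal_spec; split; rewrite //= scaler0 add0r.
by rewrite derive1E /derivable /derive E.
Qed.

Lemma ftc_abs (phi phi' : R -> R) (x y : R) : x <= y -> (forall s, derivable phi s 1) ->
  (forall s, derive1 phi s = phi' s) -> continuous phi' ->
  (`|phi y - phi x|%:E <= \int[lebesgue_measure]_(s in `[x, y]) `|phi' s|%:E)%E.
Proof.
rewrite le_eqVlt => /predU1P[->|xy] dphi dE cphi'.
  by rewrite subrr normr0; apply: integral_ge0 => s _; rewrite lee_fin.
have cphi : continuous phi.
  by move=> s; apply: differentiable_continuous; apply/derivable1_diffP.
have E : (\int[lebesgue_measure]_(s in `[x, y]) (phi' s)%:E = (phi y)%:E - (phi x)%:E)%E.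
  apply: continuous_FTC2 => //.
  - exact: continuous_subspaceT.
  - split=> [s _||]; first exact: dphi.
    + exact/cvg_at_right_filter/cphi.
    + exact/cvg_at_left_filter/cphi.
have -> : (`|phi y - phi x|%:E = `| (phi y)%:E - (phi x)%:E |)%E by rewrite -EFinB.
rewrite -E; apply: le_abse_integral; first exact: measurable_itv.
apply/measurable_EFinP; apply: measurable_funS (continuous_measurable_fun cphi') => //.
Qed.

Variables (Lam H : R).
Hypothesis H0 : 0 < H.

Let IL : set R := `](- (Lam / 2)), (Lam / 2)[.
Let IH : set R := `](- H), H[.

(** Tonelli's theorem for the restricted measures, which integrate over the whole plane or line;
    indicator functions bring it back to Lebesgue measure. *)
Lemma cell_tonelli (g : R * R -> R) : measurable_fun setT (g : plane -> R) -> (forall z, 0 <= g z) ->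
  measurable_fun setT (fun t => \int[lebesgue_measure]_(s in IH) (g (t, s))%:E)%E /\
  (\int[mu_cell Lam H]_z (g z)%:E =
   \int[mu_h Lam]_t \int[lebesgue_measure]_(s in IH) (g (t, s))%:E)%E.
Proof.
move=> mg g0.
have mI : measurable (IL : set (measurableTypeR R)) by exact: measurable_itv.
have mJ : measurable (IH : set (measurableTypeR R)) by exact: measurable_itv.
have inX (A : set R) t s : ((t, s) \in A `*` IH) = (t \in A) && (s \in IH).
  by apply/idP/andP => [/set_mem[]/= a b|[/set_mem a /set_mem b]]; [split; exact: mem_set|exact: mem_set].
(* [g1] cuts down to the horizontal strip, which makes the inner integral measurable in t on the
   whole line; [g2] below cuts down to the cell. *)
pose g1 (z : plane) : \bar R := (g z * \1_([set: R] `*` IH) z)%:E.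
have mg1 : measurable_fun setT g1.
  apply/measurable_EFinP; apply: measurable_funM => //.
  by apply: measurable_indic; exact: measurableX.
have g10 z : (0 <= g1 z)%E by rewrite lee_fin mulr_ge0.
have FE t : (\int[lebesgue_measure]_(s in IH) (g (t, s))%:E = \int[lebesgue_measure]_s g1 (t, s))%E.
  rewrite integral_mkcond; apply: eq_integral => s _.
  by rewrite patchE /g1 /= indicE inX in_setT /=; case: (s \in _); rewrite ?mulr1 ?mulr0.
have mF := @measurable_fun_fubini_tonelli_F _ _ _ _ R (@lebesgue_measure R) g1 mg1 g10.
split; first by under eq_fun do rewrite FE.
under [in RHS]eq_integral do rewrite FE.
rewrite ge0_integral_mrestr; last 2 first.
- exact/measurable_EFinP.
- by move=> z; rewrite lee_fin.
rewrite ge0_integral_mrestr; last 2 first.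
- exact: mF.
- by move=> t; exact: integral_ge0.
pose g2 (z : plane) : \bar R := (g z * \1_(IL `*` IH) z)%:E.
have mg2 : measurable_fun setT g2.
  apply/measurable_EFinP; apply: measurable_funM => //.
  by apply: measurable_indic; exact: measurableX.
have g20 z : (0 <= g2 z)%E by rewrite lee_fin !mulr_ge0.
transitivity (\int[@leb2 R]_z g2 z)%E.
  rewrite integral_mkcond; apply: eq_integral => z _.
  by rewrite patchE /g2 /= indicE; case: (z \in _); rewrite ?mulr1 ?mulr0.
rewrite (fubini_tonelli1 _ mg2 g20) [RHS]integral_mkcond; apply: eq_integral => t _.
rewrite /fubini_F patchE; case: ifPn => tI.
  by apply: eq_integral => s _; rewrite /g2 /g1 /= !indicE !inX tI in_setT.
rewrite -[RHS](integral0 (@lebesgue_measure R) setT); apply: eq_integral => s _.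
by rewrite /g2 /= indicE inX (negPf tI) mulr0.
Qed.

(** On a vertical line |f(t, h)| <= |f(t, s)| + G for every s in (-H, H), where G integrates the
    modulus of the vertical derivative. Integrating over s, an interval of length 2H, and then over
    t gives the claim. *)
Lemma trace_ineq f h : Ck 1 f -> - H <= h <= H ->
  ((2 * H)%:E * \int[mu_h Lam]_t `|f (t, h)|%:E <=
   \int[mu_cell Lam H]_z `|f z|%:E + (2 * H)%:E * \int[mu_cell Lam H]_z `|'D_(0, 1) f z|%:E)%E.
Proof.
move=> [cf _ d2 _ cd2] /andP[Hh hH].
have mf := continuous_measurable2 cf; have md := continuous_measurable2 cd2.
have maf : measurable_fun setT ((fun z => `|f z|) : plane -> R) by exact: measurableT_comp.
have mad : measurable_fun setT ((fun z => `|'D_(0, 1) f z|) : plane -> R) by exact: measurableT_comp.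
have [mA EA] := cell_tonelli maf (fun z => normr_ge0 (f z)).
have [mG EG] := cell_tonelli mad (fun z => normr_ge0 ('D_(0, 1) f z)).
rewrite EA EG.
have H2 : 0 <= 2 * H by rewrite mulr_ge0// ltW.
have csec t : continuous (fun s : R => (t, s)) by move=> s; exact: (cvg_pair (cvg_cst t) cvg_id).
have csec' : continuous (fun t : R => (t, h)) by move=> t; exact: (cvg_pair cvg_id (cvg_cst h)).
have mfh : measurable_fun setT (fun t => `|f (t, h)|%:E).
  apply/measurable_EFinP; apply: measurableT_comp => //; apply: continuous_measurable_fun => t.
  exact: (@continuous_comp _ _ _ (fun t : R => (t, h)) f t (csec' t) (cf _)).
rewrite -ge0_integralZl ?lee_fin//.
rewrite -ge0_integralZl ?lee_fin//; last by move=> t _; exact: integral_ge0.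
rewrite -ge0_integralD//; last 2 first.
- by move=> t _; rewrite mule_ge0// ?lee_fin// integral_ge0.
- exact: measurable_funeM.
apply: ge0_le_integral => //.
- by move=> t _; rewrite mule_ge0// lee_fin.
- exact: measurable_funeM.
- by apply: emeasurable_funD => //; exact: measurable_funeM.
move=> t _.
have mJ : measurable (IH : set (measurableTypeR R)) by exact: measurable_itv.
have muJ : lebesgue_measure (IH : set (measurableTypeR R)) = (2 * H)%:E.
  rewrite lebesgue_measure_itv /= lte_fin gtrN//.
  by rewrite -EFinB; congr _%:E; ring.
set G := (\int[lebesgue_measure]_(s in IH) `|'D_(0, 1) f (t, s)|%:E)%E.
have G0 : (0 <= G)%E by exact: integral_ge0.
have cfs : continuous (fun s => f (t, s)).
  by move=> s; exact: (@continuous_comp _ _ _ (fun s : R => (t, s)) f s (csec t s) (cf _)).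
have cds : continuous (fun s => 'D_(0, 1) f (t, s)).
  by move=> s; exact: (@continuous_comp _ _ _ (fun s : R => (t, s)) (fun z => 'D_(0, 1) f z) s (csec t s) (cd2 _)).
have key s : - H < s < H -> (`|f (t, h)|%:E <= `|f (t, s)|%:E + G)%E.
  move=> /andP[Hs sH].
  have sub x y : - H <= x -> x <= y -> y <= H -> (`|f (t, y) - f (t, x)|%:E <= G)%E.
    move=> Hx xy yH.
    apply: le_trans (@ftc_abs (fun s => f (t, s)) (fun s => 'D_(0, 1) f (t, s)) x y xy _ _ cds) _.
    - by move=> u; have [] := derivable_vertical (d2 (t, u)).
    - by move=> u; have [] := derivable_vertical (d2 (t, u)).
    have mds (D : set (measurableTypeR R)) : measurable_fun D (fun s => `|'D_(0, 1) f (t, s)|%:E).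
      apply: measurable_funTS; apply/measurable_EFinP.
      by apply: measurableT_comp => //; exact: continuous_measurable_fun.
    rewrite /G integral_itv_bndoo; last exact: mds.
    have mxy : measurable (`]x, y[ : set (measurableTypeR R)) by exact: measurable_itv.
    apply: (@ge0_subset_integral _ _ _ _ _ _ mxy mJ) => //.
    by move=> u; rewrite /IH /= !in_itv/= => /andP[xu uy]; rewrite (le_lt_trans Hx xu) (lt_le_trans uy yH).
  have [sh|/ltW hs] := leP s h.
    apply: (@le_trans _ _ (`|f (t, s)|%:E + `|f (t, h) - f (t, s)|%:E)%E).
      rewrite -EFinD lee_fin; have := ler_normD (f (t, s)) (f (t, h) - f (t, s)).
      by rewrite addrC subrK.
    by apply: leeD => //; exact: (sub s h (ltW Hs) sh hH).
  apply: (@le_trans _ _ (`|f (t, s)|%:E + `|f (t, s) - f (t, h)|%:E)%E).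
    rewrite -EFinD lee_fin distrC; have := ler_normD (f (t, s)) (f (t, h) - f (t, s)).
    by rewrite addrC subrK.
  by apply: leeD => //; exact: (sub h s Hh hs (ltW sH)).
have cst_int (c : \bar R) : (0 <= c)%E -> (\int[lebesgue_measure]_(s in IH) c = (2 * H)%:E * c)%E.
  by move=> _; apply: (etrans (integral_cst _ mJ c)); rewrite muleC; congr (_ * _)%E; exact: muJ.
have f0 : (0 <= `|f (t, h)|%:E)%E by rewrite lee_fin.
have mfs : measurable_fun (IH : set (measurableTypeR R)) (fun s => `|f (t, s)|%:E).
  apply: measurable_funTS; apply/measurable_EFinP.
  by apply: measurableT_comp => //; exact: continuous_measurable_fun.
have E3 : (\int[lebesgue_measure]_(s in IH) (`|f (t, s)|%:E + G) =
    \int[lebesgue_measure]_(s in IH) `|f (t, s)|%:E + (2 * H)%:E * G)%E.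
  rewrite -(cst_int _ G0); apply: ge0_integralD; [exact: mJ| |exact: mfs| |].
  - by move=> s _; rewrite lee_fin.
  - by move=> s _; exact: G0.
  - exact: measurable_cst.
rewrite -(cst_int _ f0) -E3; apply: ge0_le_integral.
- exact: mJ.
- by move=> s _; exact: f0.
- exact: measurable_cst.
- by apply: emeasurable_funD; [exact: mfs|exact: measurable_cst].
- by move=> s; rewrite /IH /= in_itv/=; exact: key.
by move=> t _; apply: integral_ge0 => s _; rewrite lee_fin.
Qed.

Lemma integral_norm_ge0 d (T : measurableType d) (mu : {measure set T -> \bar R}) (F : T -> R) :
  (0 <= \int[mu]_x `|F x|%:E)%E.
Proof. by apply: integral_ge0 => x _; rewrite lee_fin. Qed.

(** Hoelder's inequality against the constant 1, whose norm is the square root of the total mass. *)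
Lemma L1_le_N2 d (T : measurableType d) (mu : {measure set T -> \bar R}) (c : R) :
  mu setT = c%:E -> exists2 K : R, 0 <= K & forall F : T -> R, measurable_fun setT F ->
    (\int[mu]_x `|F x|%:E <= K%:E * N2 mu F)%E.
Proof.
move=> muT; exists (c `^ 2^-1); first exact: powR_ge0.
move=> F mF; have half : (2 : R)^-1 + 2^-1 = 1 by field.
have := @hoelder _ T R mu F (cst 1) 2 2 mF (measurable_cst _) (ltr0n _ 2) (ltr0n _ 2) half.
have -> : 'N[mu]_2%:E[EFin \o (cst 1%R : T -> R)]%E = (c `^ 2^-1)%:E.
  by apply: (etrans (Lnorm_cst1 mu 2)); rewrite muT poweR_EFin.
rewrite Lnorm1 muleC; apply: le_trans.
by rewrite le_eqVlt; apply/orP; left; apply/eqP; apply: eq_integral => x _ /=; rewrite mulr1.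
Qed.

Lemma mu_cell_fin : exists c : R, mu_cell Lam H setT = c%:E.
Proof.
have mI : measurable (IL : set (measurableTypeR R)) by exact: measurable_itv.
have mJ : measurable (IH : set (measurableTypeR R)) by exact: measurable_itv.
have E : mu_cell Lam H setT = (@lebesgue_measure R IL * @lebesgue_measure R IH)%E.
  apply: (etrans (congr1 (@leb2 R) (setTI (cell Lam H)))).
  exact: product_measure1E.
have f1 : (lebesgue_measure IL : \bar R) \is a fin_num.
  by rewrite /IL lebesgue_measure_itv /=; case: ifP.
have f2 : (lebesgue_measure IH : \bar R) \is a fin_num.
  by rewrite /IH lebesgue_measure_itv /=; case: ifP.
by exists (fine (lebesgue_measure IL) * fine (lebesgue_measure IH)); rewrite E EFinM !fineK.
Qed.

Lemma mu_h_fin : exists c : R, mu_h Lam setT = c%:E.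
Proof.
have f1 : (lebesgue_measure IL : \bar R) \is a fin_num.
  by rewrite /IL lebesgue_measure_itv /=; case: ifP.
exists (fine (lebesgue_measure IL)); rewrite fineK//.
exact: (congr1 (@lebesgue_measure R) (setTI IL)).
Qed.

(** The smooth approximations and their vertical derivatives tend to 0, so by [trace_ineq] their
    restrictions tend to 0 in L^1. The same restrictions tend to [g], which is therefore null. *)
Lemma null_trace_real h (f : nat -> R * R -> R) (u d2 : R * R -> R) (g : R -> R) :
  - H <= h <= H -> (forall m, Ck 1 (f m)) ->
  measurable_fun setT (u : plane -> R) -> measurable_fun setT (d2 : plane -> R) ->
  measurable_fun setT (g : measurableTypeR R -> R) ->
  {ae mu_cell Lam H, forall z, u z = 0} -> {ae mu_cell Lam H, forall z, d2 z = 0} ->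
  (fun m => N2 (mu_cell Lam H) (fun z => f m z - u z)) @ \oo --> 0%E ->
  (fun m => N2 (mu_cell Lam H) (fun z => 'D_(0, 1) (f m) z - d2 z)) @ \oo --> 0%E ->
  (fun m => N2 (mu_h Lam) (fun t => f m (t, h) - g t)) @ \oo --> 0%E ->
  {ae mu_h Lam, forall t, g t = 0}.
Proof.
move=> hH cf mu_ md mg u0 d0 au ad ag.
have [c1 /L1_le_N2[K1 K10 hK1]] := mu_cell_fin.
have [c2 /L1_le_N2[K2 K20 hK2]] := mu_h_fin.
have H2 : 0 <= 2 * H by rewrite mulr_ge0// ltW.
have mfm m : measurable_fun setT (f m : plane -> R) by have [/continuous_measurable2] := cf m.
have mdm m : measurable_fun setT ((fun z => 'D_(0, 1) (f m) z) : plane -> R).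
  by have [_ _ _ _ /continuous_measurable2] := cf m.
have aeE (F v : plane -> R) : measurable_fun setT F -> measurable_fun setT v ->
    {ae mu_cell Lam H, forall z, v z = 0} ->
    (\int[mu_cell Lam H]_z `|F z|%:E <= K1%:E * N2 (mu_cell Lam H) (fun z => (F z - v z)%R))%E.
  move=> mF mv v0; have mFv : measurable_fun setT (fun z => F z - v z) by exact: measurable_funB.
  apply: le_trans (hK1 _ mFv); rewrite le_eqVlt; apply/orP; left; apply/eqP.
  apply: ge0_ae_eq_integral => //.
  - by apply/measurable_EFinP; exact: measurableT_comp.
  - by apply/measurable_EFinP; exact: measurableT_comp.
  - by apply: filterS v0 => z -> _; rewrite subr0.
have csec : continuous (fun t : R => (t, h)) by move=> t; exact: (cvg_pair cvg_id (cvg_cst h)).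
have mfh m : measurable_fun setT ((fun t => f m (t, h)) : measurableTypeR R -> R).
  have [cfm _ _ _ _] := cf m; apply: continuous_measurable_fun => t.
  exact: (@continuous_comp _ _ _ (fun t : R => (t, h)) (f m) t (csec t) (cfm _)).
have mae (v : measurableTypeR R -> R) : measurable_fun setT v -> measurable_fun setT (fun t => `|v t|%:E).
  by move=> mv; apply/measurable_EFinP; exact: measurableT_comp.
have mdiff m : measurable_fun setT ((fun t => f m (t, h) - g t) : measurableTypeR R -> R).
  exact: measurable_funB.
(* The coefficients are wrapped in absolute values, one of them being 1, to match the shape of
   [squeeze_lin]. *)
have key m : ((2 * H)%:E * \int[mu_h Lam]_t `|g t|%:E <=
   `|1|%:E * (`|K1|%:E * N2 (mu_cell Lam H) (fun z => (f m z - u z)%R) +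
   `|(2 * H * K1)%R|%:E * N2 (mu_cell Lam H) (fun z => ('D_(0, 1) (f m) z - d2 z)%R)) +
   `|(2 * H * K2)%R|%:E * N2 (mu_h Lam) (fun t => (f m (t, h) - g t)%R))%E.
  rewrite normr1 mul1e !ger0_norm ?(mulr_ge0 H2)//.
  apply: (@le_trans _ _ ((2 * H)%:E * \int[mu_h Lam]_t `|f m (t, h)|%:E +
    (2 * H)%:E * \int[mu_h Lam]_t `|(f m (t, h) - g t)%R|%:E)%E).
    rewrite -ge0_muleDr; [|by apply: integral_ge0 => ? _; rewrite lee_fin|by apply: integral_ge0 => ? _; rewrite lee_fin].
    apply: lee_wpmul2l; first by rewrite lee_fin.
    rewrite -ge0_integralD//; [|exact: mae|exact: mae].
    apply: ge0_le_integral => //; [exact: mae|apply: emeasurable_funD; exact: mae|].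
    move=> t _; rewrite -EFinD lee_fin.
    by have := ler_normB (f m (t, h)) (f m (t, h) - g t); rewrite subKr.
  apply: leeD.
    apply: le_trans (trace_ineq (cf m) hH) _; apply: leeD; first exact: aeE.
    rewrite (EFinM (2 * H) K1) -muleA; apply: lee_wpmul2l; first by rewrite lee_fin.
    exact: aeE.
  rewrite (EFinM (2 * H) K2) -muleA; apply: lee_wpmul2l; first by rewrite lee_fin.
  exact: hK2.
have a1 : (fun m => `|K1|%:E * N2 (mu_cell Lam H) (fun z => (f m z - u z)%R) +
   `|(2 * H * K1)%R|%:E * N2 (mu_cell Lam H) (fun z => ('D_(0, 1) (f m) z - d2 z)%R))%E @ \oo --> 0%E.
  apply: (squeeze_lin (a := K1) (b := 2 * H * K1)) au ad => m.
  by rewrite lexx andbT adde_ge0// mule_ge0// ?lee_fin// Lnorm_ge0.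
have I0 : (0 <= (2 * H)%:E * \int[mu_h Lam]_t `|g t|%:E)%E by apply: mule_ge0; [rewrite lee_fin|exact: integral_norm_ge0].
(* The integral of |g|, as a constant sequence, is squeezed to 0. *)
have a2 : (fun _ : nat => (2 * H)%:E * \int[mu_h Lam]_t `|g t|%:E)%E @ \oo --> 0%E.
  by apply: (squeeze_lin (a := 1) (b := 2 * H * K2)) a1 ag => m; rewrite I0 key.
have E0 : 0%E = ((2 * H)%:E * \int[mu_h Lam]_t `|g t|%:E)%E.
  by rewrite -(cvg_lim (@ereal_hausdorff R) a2); apply: (cvg_lim (@ereal_hausdorff R)); exact: cvg_cst.
move/eqP: E0.
rewrite eq_sym mule_eq0 eqe mulf_eq0 pnatr_eq0 /= gt_eqF//= => /eqP I1.
have mge : measurable_fun setT (EFin \o (g : measurableTypeR R -> R)) by exact/measurable_EFinP.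
have := (ae_eq_integral_abs (mu_h Lam) measurableT mge).1 I1.
by apply: filterS => t /(_ Logic.I) [].
Qed.

Lemma ae_ReIm d (T : measurableType d) (mu : {measure set T -> \bar R}) (f : T -> R[i]) :
  {ae mu, forall x, Re (f x) = 0} -> {ae mu, forall x, Im (f x) = 0} -> {ae mu, forall x, f x = 0}.
Proof.
move=> f1 f2; apply: filterS2 f1 f2 => x; case: (f x) => a b /= -> ->.
by apply/eqP; rewrite eq_complex /= !eqxx.
Qed.

Lemma null_trace h u d1 d2 g : - H <= h <= H ->
  memL2 (mu_cell Lam H) u -> memL2 (mu_cell Lam H) d2 ->
  {ae mu_cell Lam H, forall z, u z = 0} -> {ae mu_cell Lam H, forall z, d2 z = 0} ->
  is_trace Lam H (mu_h Lam) (fun t => (t, h)) u d1 d2 g -> {ae mu_h Lam, forall t, g t = 0}.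
Proof.
move=> hH /memL2_meas[mu1 mu2] /memL2_meas[md1 md2] u0 d0 [/memL2_meas[mg1 mg2] [w [sw [wu1 wu2] _ [wd1 wd2] [wg1 wg2]]]].
have ReB (x y : R[i]) : Re (x - y) = Re x - Re y by case: x y => [? ?] [].
have ImB (x y : R[i]) : Im (x - y) = Im x - Im y by case: x y => [? ?] [].
have g1 : {ae mu_h Lam, forall t, Re (g t) = 0}.
  apply: (@null_trace_real h (fun m z => Re (w m z)) (fun z => Re (u z)) (fun z => Re (d2 z))) => //.
  - by move=> m; exact: (sw m).1 1%N.
  - by apply: filterS u0 => z ->.
  - by apply: filterS d0 => z ->.
  - by under eq_fun do under eq_fun do rewrite -ReB; exact: wu1.
  - rewrite (_ : (fun m => _) = fun m => N2 (mu_cell Lam H) (fun x => Re (cderiv (0, 1) (w m) x - d2 x)))//.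
    by apply/funext => m; congr (N2 _ _); apply/funext => z; rewrite ReB.
  - suff -> : (fun m => N2 (mu_h Lam) (fun t => Re (w m (t, h)) - Re (g t))) =
        (fun m => N2 (mu_h Lam) (fun t => Re (w m (t, h) - g t))) by exact: wg1.
    by apply/funext => m; congr (N2 _ _); apply/funext => t; rewrite ReB.
have g2 : {ae mu_h Lam, forall t, Im (g t) = 0}.
  apply: (@null_trace_real h (fun m z => Im (w m z)) (fun z => Im (u z)) (fun z => Im (d2 z))) => //.
  - by move=> m; exact: (sw m).2 1%N.
  - by apply: filterS u0 => z ->.
  - by apply: filterS d0 => z ->.
  - by under eq_fun do under eq_fun do rewrite -ImB; exact: wu2.
  - rewrite (_ : (fun m => _) = fun m => N2 (mu_cell Lam H) (fun x => Im (cderiv (0, 1) (w m) x - d2 x)))//.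
    by apply/funext => m; congr (N2 _ _); apply/funext => z; rewrite ImB.
  - suff -> : (fun m => N2 (mu_h Lam) (fun t => Im (w m (t, h)) - Im (g t))) =
        (fun m => N2 (mu_h Lam) (fun t => Im (w m (t, h) - g t))) by exact: wg2.
    by apply/funext => m; congr (N2 _ _); apply/funext => t; rewrite ImB.
exact: ae_ReIm g1 g2.
Qed.

End NullTrace.

(** * Complex integrals and the L^2 pairing *)

Section ComplexIntegral.
Context {R : realType} d (T : measurableType d) (mu : {measure set T -> \bar R}).
Implicit Types (f g : T -> R[i]) (a : R[i]).

Definition cintegrable f : Prop :=
  mu.-integrable setT (EFin \o (fun x => Re (f x))) /\
  mu.-integrable setT (EFin \o (fun x => Im (f x))).

Let Lin (b c : R) (h k : T -> R) : mu.-integrable setT (EFin \o h) ->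
    mu.-integrable setT (EFin \o k) ->
  mu.-integrable setT (EFin \o (fun x => b * h x + c * k x)) /\
  (\int[mu]_x (b * h x + c * k x) = b * \int[mu]_x h x + c * \int[mu]_x k x)%R.
Proof.
move=> ih ik; have ih' := integrableZl measurableT b ih.
have ik' := integrableZl measurableT c ik.
split; first exact: (integrableD measurableT ih' ik').
by rewrite RintegralD// !RintegralZl.
Qed.

Lemma cintegrable_lin a f g : cintegrable f -> cintegrable g ->
  cintegrable (fun x => a * f x + g x) /\
  cint mu (fun x => a * f x + g x) = a * cint mu f + cint mu g.
Proof.
move=> [f1 f2] [g1 g2].
have [i1 E1] := Lin (Re a) (- Im a) f1 f2.
have [i2 E2] := Lin (Re a) (Im a) f2 f1.
have [i3 E3] := Lin 1 1 i1 g1.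
have [i4 E4] := Lin 1 1 i2 g2.
have ReE (z w : R[i]) : Re (a * z + w) = 1 * (Re a * Re z + (- Im a) * Im z) + 1 * Re w.
  by rewrite ReD ReM; ring.
have ImE (z w : R[i]) : Im (a * z + w) = 1 * (Re a * Im z + Im a * Re z) + 1 * Im w.
  by rewrite ImD ImM; ring.
split; first by split; [under eq_fun do rewrite ReE|under eq_fun do rewrite ImE].
rewrite /cint; under eq_Rintegral do rewrite ReE.
under [in X in _ +i* X]eq_Rintegral do rewrite ImE.
rewrite E3 E4 E1 E2; apply/eqP; rewrite eq_complex; apply/andP; split; apply/eqP.
- by rewrite ReD ReM /=; ring.
- by rewrite ImD ImM /=; ring.
Qed.

Lemma cint_conj f : cintegrable f -> cint mu (fun x => conjc (f x)) = conjc (cint mu f).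
Proof.
move=> [f1 f2]; rewrite /cint /=.
have ReE (z : R[i]) : Re (conjc z) = Re z by case: z.
have ImE (z : R[i]) : Im (conjc z) = (-1) * Im z by case: z => x y /=; rewrite mulN1r.
under eq_Rintegral do rewrite ReE; under [in X in _ +i* X]eq_Rintegral do rewrite ImE.
by rewrite RintegralZl// mulN1r.
Qed.

Lemma cint_ae f g : cmeas f -> cmeas g -> {ae mu, forall x, f x = g x} -> cint mu f = cint mu g.
Proof.
move=> [f1 f2] [g1 g2] fg; rewrite /cint /Rintegral; congr (fine _ +i* fine _);
  apply: ae_eq_integral => //; try exact/measurable_EFinP.
- by apply: filterS fg => x -> _.
- by apply: filterS fg => x -> _.
Qed.

Let RemulE (z w : R[i]) : Re (z * conjc w) = 1 * (Re z * Re w) + 1 * (Im z * Im w).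
Proof. by case: z w => [? ?] [? ?] /=; ring. Qed.
Let ImmulE (z w : R[i]) : Im (z * conjc w) = 1 * (Im z * Re w) + (-1) * (Re z * Im w).
Proof. by case: z w => [? ?] [? ?] /=; ring. Qed.

Lemma cintegrable_pair f g : memL2 mu f -> memL2 mu g -> cintegrable (fun x => f x * conjc (g x)).
Proof.
move=> [f1 f2] [g1 g2].
have P (h k : T -> R) : h \in Lfun mu 2%:E -> k \in Lfun mu 2%:E ->
    mu.-integrable setT (EFin \o (fun x => h x * k x)).
  by move=> lh lk; apply/Lfun1_integrable; exact: Lfun2_mul_Lfun1.
split.
- by under eq_fun do rewrite RemulE; have [] := Lin 1 1 (P _ _ f1 g1) (P _ _ f2 g2).
- by under eq_fun do rewrite ImmulE; have [] := Lin 1 (-1) (P _ _ f2 g1) (P _ _ f1 g2).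
Qed.

Lemma cmeas_integrable f : cintegrable f -> cmeas f.
Proof. by move=> [/measurable_int f1 /measurable_int f2]; split; exact/measurable_EFinP. Qed.

Lemma cint_pair_ae f f' g : memL2 mu f -> memL2 mu f' -> memL2 mu g ->
  {ae mu, forall x, f x = f' x} ->
  cint mu (fun x => f x * conjc (g x)) = cint mu (fun x => f' x * conjc (g x)).
Proof.
move=> Lf Lf' Lg ff'; apply: cint_ae.
- exact/cmeas_integrable/cintegrable_pair.
- exact/cmeas_integrable/cintegrable_pair.
- by apply: filterS ff' => x ->.
Qed.

Lemma cint_pair_lin a f f' g h : memL2 mu f -> memL2 mu f' -> memL2 mu g -> memL2 mu h ->
  {ae mu, forall x, h x = a * f x + f' x} ->
  cint mu (fun x => h x * conjc (g x)) =
  a * cint mu (fun x => f x * conjc (g x)) + cint mu (fun x => f' x * conjc (g x)).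
Proof.
move=> Lf Lf' Lg Lh he; rewrite (cint_pair_ae Lh (memL2_lin a Lf Lf') Lg he).
have [_ <-] := cintegrable_lin a (cintegrable_pair Lf Lg) (cintegrable_pair Lf' Lg).
by congr (cint mu _); apply/funext => x; ring.
Qed.

Lemma bounded_Lfun2 (c : R) (u : T -> R) : mu setT = c%:E -> measurable_fun setT u ->
  (forall x, `|u x| <= 1) -> u \in Lfun mu 2%:E.
Proof.
move=> muT mu_ u1; apply/andP; split; rewrite inE//= /finite_norm unlock /Lnorm.
apply: poweR_lty; apply: (@le_lt_trans _ _ (\int[mu]_x (cst 1%:E x))%E); last first.
  by rewrite integral_cst// mul1e muT ltry.
apply: ge0_le_integral => //=.
- by apply/measurable_EFinP/(@measurableT_comp _ _ _ _ _ _ (fun x : R => x `^ 2)) => //; exact: measurableT_comp.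
- move=> x _; rewrite lee_fin; apply: (@le_trans _ _ (1 `^ 2)); last by rewrite powR1.
  by apply: ge0_ler_powR => //; rewrite ?nnegrE.
Qed.

Lemma Rintegral_eq0_ae (g : T -> R) : (forall x, 0 <= g x) ->
    mu.-integrable setT (EFin \o g) -> (\int[mu]_x g x = 0)%R -> {ae mu, forall x, g x = 0}.
Proof.
move=> g0 ig I0; have /measurable_int mi := ig.
have e0 : (\int[mu]_x `|(EFin \o g) x| = 0)%E.
  under eq_integral => x _ do rewrite /= ger0_norm//.
  rewrite -[LHS]fineK; first by move: I0; rewrite /Rintegral => ->.
  exact: (integrable_fin_num _ ig).
have := (ae_eq_integral_abs mu measurableT mi).1 e0.
by apply: filterS => x /(_ Logic.I) [].
Qed.

Lemma ae_imply (A B : set T) : (A `<=` B) -> {ae mu, forall x, A x} -> {ae mu, forall x, B x}.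
Proof. by move=> AB; exact: filterS. Qed.

End ComplexIntegral.

(** * The inner product on the quotient space *)

Section StarInnerProduct.
Context {R : realType}.
Variables Lam H : R.
Hypothesis H0 : 0 < H.
Implicit Types (phi psi chi : @H1per R Lam H) (a : R[i]).

Lemma H1repr_in phi : in_H1per Lam H (val (H1repr phi)).
Proof. exact/asboolP/(valP (H1repr phi)). Qed.

Lemma memL2_d1 phi : memL2 (mu_cell Lam H) (d1_ phi).
Proof. exact: in_d1 (H1repr_in phi). Qed.
Lemma memL2_d2 phi : memL2 (mu_cell Lam H) (d2_ phi).
Proof. exact: in_d2 (H1repr_in phi). Qed.
Lemma memL2_u phi : memL2 (mu_cell Lam H) (u_ phi).
Proof. exact: in_fun (H1repr_in phi). Qed.
Lemma memL2_top phi : memL2 (mu_h Lam) (top_ phi).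
Proof. exact: (in_top (H1repr_in phi)).1. Qed.
Lemma memL2_bot phi : memL2 (mu_h Lam) (bot_ phi).
Proof. exact: (in_bot (H1repr_in phi)).1. Qed.

Lemma H1raw_comb a (x y z : @H1raw R) : [/\
  forall t, rd1 (x - (a *: y + z)) t = rd1 x t - (a * rd1 y t + rd1 z t),
  forall t, rd2 (x - (a *: y + z)) t = rd2 x t - (a * rd2 y t + rd2 z t),
  forall t, rtop (x - (a *: y + z)) t = rtop x t - (a * rtop y t + rtop z t) &
  forall t, rbot (x - (a *: y + z)) t = rbot x t - (a * rbot y t + rbot z t)].
Proof. by move: x y z => [[[[x1 x2] x3] x4] x5] [[[[y1 y2] y3] y4] y5] [[[[z1 z2] z3] z4] z5]; split. Qed.

(** Representatives are chosen class by class, so the one of a combination differs from the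
    combination of representatives by null data. Linearity is thus available almost everywhere,
    which is enough under the integrals. *)
Lemma H1repr_lin a phi psi :
  [/\ {ae mu_cell Lam H, forall z, d1_ (a *: phi + psi) z = a * d1_ phi z + d1_ psi z},
      {ae mu_cell Lam H, forall z, d2_ (a *: phi + psi) z = a * d2_ phi z + d2_ psi z},
      {ae mu_h Lam, forall t, top_ (a *: phi + psi) t = a * top_ phi t + top_ psi t} &
      {ae mu_h Lam, forall t, bot_ (a *: phi + psi) t = a * bot_ phi t + bot_ psi t}].
Proof.
have : H1class (H1repr (a *: phi + psi)) = H1class (a *: H1repr phi + H1repr psi).
  by rewrite H1reprK H1classD H1classZ !H1reprK.
move=> /H1classP/asboolP; rewrite /d1_ /d2_ /top_ /bot_.
move: (H1repr (a *: phi + psi)) (H1repr phi) (H1repr psi) => x y z.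
have -> : val (x - (a *: y + z)) = val x - (a *: val y + val z) by [].
have [e1 e2 e3 e4] := H1raw_comb a (val x) (val y) (val z).
move=> [_ h1 h2 h3 h4].
have S d (T : measurableType d) (mu : {measure set T -> \bar R}) (f g : T -> R[i]) (f' : T -> R[i]) :
    (forall t, f' t = f t - g t) -> {ae mu, forall z, f' z = 0} -> {ae mu, forall z, f z = g z}.
  by move=> E; apply: filterS => t; rewrite E => /eqP; rewrite subr_eq0 => /eqP.
split.
- exact: (S _ _ (mu_cell Lam H) (rd1 (val x)) (fun t => a * rd1 (val y) t + rd1 (val z) t) _ e1 h1).
- exact: (S _ _ (mu_cell Lam H) (rd2 (val x)) (fun t => a * rd2 (val y) t + rd2 (val z) t) _ e2 h2).
- exact: (S _ _ (mu_h Lam) (rtop (val x)) (fun t => a * rtop (val y) t + rtop (val z) t) _ e3 h3).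
- exact: (S _ _ (mu_h Lam) (rbot (val x)) (fun t => a * rbot (val y) t + rbot (val z) t) _ e4 h4).
Qed.

Lemma measurable_cis (u : R -> R) : continuous u -> measurable_fun setT (u : measurableTypeR R -> R).
Proof. by move=> cu; exact: continuous_measurable_fun. Qed.

Lemma memL2_expi (n : int) :
  memL2 (mu_h Lam) (fun t : measurableTypeR R => conjc (expi (- (2 * pi * n%:~R * t / Lam)))).
Proof.
have [c muT] := @mu_h_fin R Lam.
have cl : continuous (fun t : R => - (2 * pi * n%:~R * t / Lam)).
  move=> t; apply: cvgN; apply: cvgM; last exact: cvg_cst.
  by apply: cvgM; [exact: cvg_cst|exact: cvg_id].
split; apply: (bounded_Lfun2 muT) => [|x].
- apply: measurable_cis => t; apply: (continuous_comp (cl t)); exact: continuous_cos.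
- by rewrite /= cos_max.
- apply: measurable_cis => t; apply: cvgN; apply: (continuous_comp (cl t)); exact: continuous_sin.
- by rewrite /= normrN sin_max.
Qed.

Lemma fcoef_lin (a : R[i]) (f f' h : R -> R[i]) n : memL2 (mu_h Lam) f -> memL2 (mu_h Lam) f' ->
  memL2 (mu_h Lam) h -> {ae mu_h Lam, forall t, h t = a * f t + f' t} ->
  fcoef Lam h n = a * fcoef Lam f n + fcoef Lam f' n.
Proof.
move=> Lf Lf' Lh he; rewrite /fcoef.
(* Conjugating the exponential twice puts the coefficient in the form of an L^2 pairing. *)
have E (g : R -> R[i]) : (fun t => g t * expi (- (2 * pi * n%:~R * t / Lam))) =
   (fun t => g t * conjc (conjc (expi (- (2 * pi * n%:~R * t / Lam))))).
  by apply/funext => t; rewrite conjcK.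
rewrite !E (cint_pair_lin Lf Lf' (memL2_expi n) Lh he); ring.
Qed.

Lemma star_term_lin a phi psi chi n :
  star_term (a *: phi + psi) chi n = a * star_term phi chi n + star_term psi chi n.
Proof.
have [_ _ h3 h4] := H1repr_lin a phi psi.
rewrite /star_term (fcoef_lin n (memL2_top phi) (memL2_top psi) (memL2_top _) h3).
rewrite (fcoef_lin n (memL2_bot phi) (memL2_bot psi) (memL2_bot _) h4).
have D (c p q p' q' u v : R[i]) :
    c * ((a * p + p') * u + (a * q + q') * v) = a * (c * (p * u + q * v)) + c * (p' * u + q' * v).
  by ring.
exact: D.
Qed.

Lemma star_term_conj phi psi n : star_term psi phi n = conjc (star_term phi psi n).
Proof.
have E (s : R) (p q u v : R[i]) :
    s%:C * (p * conjc q + u * conjc v) = conjc (s%:C * (q * conjc p + v * conjc u)).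
  by rewrite conjcM conjcR conjcD !conjcM !conjcK; ring.
exact: E.
Qed.

Lemma psumZ_lin a (c c' : int -> R[i]) N :
  psumZ (fun n => a * c n + c' n) N = a * psumZ c N + psumZ c' N.
Proof. by rewrite /psumZ mulr_sumr -big_split. Qed.

Definition sumZ_cvg (c : int -> R[i]) : Prop :=
  cvgn (fun N => Re (psumZ c N)) /\ cvgn (fun N => Im (psumZ c N)).

Lemma sumZ_lin a (c c' : int -> R[i]) : sumZ_cvg c -> sumZ_cvg c' ->
  sumZ (fun n => a * c n + c' n) = a * sumZ c + sumZ c'.
Proof.
move=> [c1 c2] [c1' c2']; apply/eqP; rewrite eq_complex; apply/andP; split; apply/eqP.
- rewrite ReD ReM /=; apply/(cvg_lim (@Rhausdorff R)).
  rewrite (_ : (fun N => _) = fun N => Re a * Re (psumZ c N) - Im a * Im (psumZ c N) + Re (psumZ c' N)); last first.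
    by apply/funext => N; rewrite psumZ_lin ReD ReM.
  by apply: cvgD => //; apply: cvgB; apply: cvgM => //; exact: cvg_cst.
- rewrite ImD ImM /=; apply/(cvg_lim (@Rhausdorff R)).
  rewrite (_ : (fun N => _) = fun N => Re a * Im (psumZ c N) + Im a * Re (psumZ c N) + Im (psumZ c' N)); last first.
    by apply/funext => N; rewrite psumZ_lin ImD ImM.
  by apply: cvgD => //; apply: cvgD; apply: cvgM => //; exact: cvg_cst.
Qed.

Lemma sumZ_conj (c : int -> R[i]) : sumZ_cvg c ->
  sumZ (fun n => conjc (c n)) = conjc (sumZ c).
Proof.
move=> [c1 c2].
have E N : psumZ (fun n => conjc (c n)) N = conjc (psumZ c N) by rewrite /psumZ conjc_sum.
apply/eqP; rewrite eq_complex /=; apply/andP; split; apply/eqP.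
- by congr (limn _); apply/funext => N; rewrite E; case: (psumZ c N).
- apply/(cvg_lim (@Rhausdorff R)).
  rewrite (_ : (fun N => _) = fun N => - Im (psumZ c N)); first exact: cvgN.
  by apply/funext => N; rewrite E; case: (psumZ c N).
Qed.

Hypothesis equiv : star_norm_equiv Lam H.

(** The hypothesis speaks of the real parts of the diagonal sums. Polarization gives the real parts
    for two different arguments, and replacing [phi] by i [phi] turns them into the imaginary
    parts. *)
Lemma star_term_cvg phi psi : sumZ_cvg (star_term phi psi).
Proof.
have [q _] := equiv.
have st0 chi n : star_term 0 chi n = 0.
  have := star_term_lin 1 0 0 chi n; rewrite scaler0 addr0 mul1r => /eqP.
  by rewrite -[X in X == _]addr0 (inj_eq (addrI _)) eq_sym => /eqP.
have reCvg phi' : cvgn (fun N => Re (psumZ (star_term phi' psi) N)).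
  have E N : Re (psumZ (star_term phi' psi) N) = 2^-1 *
      (Re (psumZ (star_term (1 *: phi' + psi) (1 *: phi' + psi)) N) -
       Re (psumZ (star_term phi' phi') N) - Re (psumZ (star_term psi psi) N)).
    have pt n : star_term (1 *: phi' + psi) (1 *: phi' + psi) n = star_term phi' phi' n +
        star_term psi psi n + (star_term phi' psi n + conjc (star_term phi' psi n)).
      have p1 := star_term_conj phi' phi' n; have p2 := star_term_conj phi' psi n.
      have p3 := star_term_conj psi psi n.
      rewrite star_term_lin (star_term_conj (1 *: phi' + psi) phi') (star_term_conj (1 *: phi' + psi) psi).
      rewrite !star_term_lin p2; move: p1 p3.
      move: (star_term phi' phi' n) (star_term phi' psi n) (star_term psi psi n) => p r s p1 p3.
      by rewrite !mul1r !conjcD conjcK -p1 -p3; ring.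
    have sumE (q0 q1 q2 q3 : int -> R[i]) : (forall n, q0 n = q1 n + q2 n + (q3 n + conjc (q3 n))) ->
        psumZ q0 N = psumZ q1 N + psumZ q2 N + (psumZ q3 N + conjc (psumZ q3 N)).
      by move=> qE; rewrite /psumZ conjc_sum -!big_split; apply: eq_bigr => i _; exact: qE.
    rewrite (sumE _ _ _ _ pt).
    have half (p r t : R[i]) : Re r = 2^-1 * (Re (p + t + (r + conjc r)) - Re p - Re t).
      by rewrite !ReD; case: r => x y /=; field.
    exact: half.
  rewrite (funext E).
  by apply: is_cvgM; [exact: is_cvg_cst|apply: is_cvgB; [apply: is_cvgB; exact: q|exact: q]].
split; first exact: reCvg.
have := reCvg ((0 +i* 1) *: phi).
have E N : Re (psumZ (star_term ((0 +i* 1) *: phi) psi) N) = - Im (psumZ (star_term phi psi) N).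
  have -> : psumZ (star_term ((0 +i* 1) *: phi) psi) N = (0 +i* 1) * psumZ (star_term phi psi) N.
    rewrite /psumZ mulr_sumr; apply: eq_bigr => i _.
    by rewrite -[(0 +i* 1) *: phi]addr0 star_term_lin st0 addr0.
  have im (r : R[i]) : Re ((0 +i* 1) * r) = - Im r by rewrite ReM /=; ring.
  exact: im.
rewrite (funext E) => /is_cvgN; suff -> : (- (fun N => - Im (psumZ (star_term phi psi) N)))%R =
  (fun N => Im (psumZ (star_term phi psi) N)) by [].
by apply/funext => N; exact: opprK.
Qed.

Lemma cint_grad phi psi : cint (mu_cell Lam H) (fun x => d1_ phi x * conjc (d1_ psi x) + d2_ phi x * conjc (d2_ psi x)) =
  cint (mu_cell Lam H) (fun x => d1_ phi x * conjc (d1_ psi x)) +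
  cint (mu_cell Lam H) (fun x => d2_ phi x * conjc (d2_ psi x)).
Proof.
have [_ E] := cintegrable_lin 1 (cintegrable_pair (memL2_d1 phi) (memL2_d1 psi))
  (cintegrable_pair (memL2_d2 phi) (memL2_d2 psi)).
by rewrite mul1r in E; rewrite -E; congr (cint _ _); apply/funext => x; rewrite mul1r.
Qed.

Lemma star_ip_linear a phi psi chi :
  star_ip (a *: phi + psi) chi = a * star_ip phi chi + star_ip psi chi.
Proof.
have [h1 h2 _ _] := H1repr_lin a phi psi.
rewrite /star_ip !cint_grad.
rewrite (cint_pair_lin (memL2_d1 phi) (memL2_d1 psi) (memL2_d1 chi) (memL2_d1 _) h1).
rewrite (cint_pair_lin (memL2_d2 phi) (memL2_d2 psi) (memL2_d2 chi) (memL2_d2 _) h2).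
have -> : star_term (a *: phi + psi) chi = (fun n => a * star_term phi chi n + star_term psi chi n).
  by apply/funext => n; rewrite star_term_lin.
rewrite (sumZ_lin a (star_term_cvg phi chi) (star_term_cvg psi chi)).
have D (p q p' q' z s s' : R[i]) :
    a * p + p' + (a * q + q') + z * (a * s + s') = a * (p + q + z * s) + (p' + q' + z * s').
  by ring.
exact: D.
Qed.

Lemma star_ip_conj phi psi : star_ip phi psi = conjc (star_ip psi phi).
Proof.
rewrite /star_ip !cint_grad conjcD conjcM conjcR conjcD.
rewrite -!cint_conj; [|exact: cintegrable_pair (memL2_d2 _) (memL2_d2 _)|exact: cintegrable_pair (memL2_d1 _) (memL2_d1 _)].
rewrite -sumZ_conj; last exact: star_term_cvg.
have E (u v : R * R -> R[i]) : (fun x => u x * conjc (v x)) = (fun x => conjc (v x * conjc (u x))).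
  by apply/funext => x; rewrite conjcM conjcK mulrC.
rewrite -!E; congr (_ + _ * sumZ _); apply/funext => n; exact: star_term_conj.
Qed.

Lemma star_ip_ge0 phi : 0 <= Re (star_ip phi phi).
Proof.
have ReMM (z : R[i]) : Re (z * conjc z) = normc z ^+ 2 by rewrite mulc_conj.
rewrite ReD addr_ge0//.
  rewrite /cint /=; apply: Rintegral_ge0 => x _.
  by rewrite ReD !ReMM addr_ge0// sqr_ge0.
have ReR (t : R) (z : R[i]) : Re (t%:C * z) = t * Re z by case: z => x y /=; ring.
rewrite ReR mulr_ge0 ?mulr_ge0 ?pi_ge0//.
apply: limr_ge; first exact: (star_term_cvg phi phi).1.
apply: nearW => N; rewrite /psumZ.
elim/big_ind: _ => // [x y x0 y0|i _]; first by rewrite ReD addr_ge0.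
rewrite /star_term ReR mulr_ge0 ?sqrtr_ge0// ReD !ReMM.
by rewrite addr_ge0// sqr_ge0.
Qed.

(** By norm equivalence the function and its gradient vanish almost everywhere. To be zero in the
    quotient the stored traces must vanish as well, which [null_trace] provides. *)
Lemma star_norm_definite phi : star_norm phi = 0 -> phi = 0.
Proof.
move=> n0; have [_ [c [C [c0 _ /(_ phi)]]]] := equiv; rewrite n0 => /andP[le _].
have H1n : H1norm phi = 0.
  by apply/eqP; rewrite eq_le -(pmulr_rle0 _ c0) le sqrtr_ge0.
have Lu := memL2_u phi; have L1 := memL2_d1 phi; have L2 := memL2_d2 phi.
pose sq (f : R * R -> R[i]) x := normc (f x) ^+ 2.
have sqE f : sq f = fun x => Re (f x * conjc (f x)) by apply/funext => x; rewrite mulc_conj.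
have isq f : memL2 (mu_cell Lam H) f -> (mu_cell Lam H).-integrable setT (EFin \o sq f).
  by move=> Lf; rewrite sqE; exact: (cintegrable_pair Lf Lf).1.
have sq0 f x : 0 <= sq f x by rewrite sqr_ge0.
pose g x : R := sq (u_ phi) x + sq (d1_ phi) x + sq (d2_ phi) x.
have g0 x : 0 <= g x by rewrite /g !addr_ge0.
have ig : (mu_cell Lam H).-integrable setT (EFin \o g).
  exact: (integrableD measurableT (integrableD measurableT (isq _ Lu) (isq _ L1)) (isq _ L2)).
have I0 : (\int[mu_cell Lam H]_x g x = 0)%R.
  apply/eqP; rewrite eq_le Rintegral_ge0 ?andbT//.
  by move/eqP: H1n; rewrite /H1norm sqrtr_eq0.
have ae0 := @Rintegral_eq0_ae R _ _ (mu_cell Lam H) g g0 ig I0.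
have a0 : {ae mu_cell Lam H, forall x, u_ phi x = 0} /\ {ae mu_cell Lam H, forall x, d1_ phi x = 0} /\
    {ae mu_cell Lam H, forall x, d2_ phi x = 0}.
  have z0 (p q s : R[i]) : normc p ^+ 2 + normc q ^+ 2 + normc s ^+ 2 = 0 -> [/\ p = 0, q = 0 & s = 0].
    move/eqP; rewrite !paddr_eq0 ?addr_ge0 ?sqr_ge0// !sqrf_eq0 !normc_eq0.
    by case/andP => /andP[/eqP-> /eqP->] /eqP->.
  by split; [|split]; apply: (@ae_imply R _ _ (mu_cell Lam H) _ _ _ ae0) => x /z0[].
have [u0 [d10 d20]] := a0.
have HH : - H <= H <= H by rewrite lexx andbT (ge0_cp (ltW H0)).
have HH' : - H <= - H <= H by rewrite lexx (ge0_cp (ltW H0)).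
have t0 := null_trace H0 HH Lu L2 u0 d20 (in_top (H1repr_in phi)).
have b0 := null_trace H0 HH' Lu L2 u0 d20 (in_bot (H1repr_in phi)).
rewrite -[phi]H1reprK; have -> : (0 : @H1per R Lam H) = H1class 0.
  have := H1classD (0 : @H1data R Lam H) 0; rewrite addr0 => /eqP.
  by rewrite -[X in X == _]addr0 (inj_eq (addrI _)) => /eqP.
apply/H1classP; rewrite subr0; apply/asboolP; split; [exact: u0|exact: d10|exact: d20|exact: t0|exact: b0].
Qed.

Theorem star_inner_product_norm :
  inner_product_norm (@star_ip R Lam H) (@star_norm R Lam H).
Proof.
split; [exact: star_ip_linear|exact: star_ip_conj|exact: star_ip_ge0|by []|exact: star_norm_definite].
Qed.

End StarInnerProduct.

Theorem lemma8 (R : realType) (Lam k h0 H : R) (gamma : R * R -> R)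
  (Lam_gt0 : 0 < Lam) (k_gt0 : 0 < k) (h0_gt0 : 0 < h0) (h0_lt_H : h0 < H)
  (gamma_Linfty : gamma \in Lfun (@leb2 R) +oo%E)
  (gamma_per : {ae @leb2 R, forall x, gamma (x.1 + Lam, x.2) = gamma x})
  (gamma_1 : {ae @leb2 R, forall x, h0 < `|x.2| -> gamma x = 1})
  (star_equiv : star_norm_equiv Lam H)
  (D : R[i] -> H1per Lam H -> H1per Lam H)
  (D_bounded : forall alpha, bounded_linear (@star_norm R Lam H) (D alpha))
  (D_form : forall alpha phi psi,
     star_ip (D alpha phi) psi = a_form k gamma alpha phi psi)
  (D_cutoffs : forall a, cutoffs Lam k a -> ker (D a%:C) = [set 0])
  (J : finType) (al : J -> R) (al_inj : injective al)
  (al_range : range al = propagative Lam D)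
  (delta : J -> R)
  (delta_bounds : forall j, 0 < delta j < k)
  (delta_cutoffs : forall j a, cutoffs Lam k a ->
     ~ cdisk (al j)%:C (delta j) a%:C)
  (delta_hol : forall j,
     holomorphic_on (@star_norm R Lam H) (cdisk (al j)%:C (delta j)) D)
  (delta_ker : forall j z, cdisk (al j)%:C (delta j) z -> finite_dim (ker (D z)))
  (delta_inv : forall j z, cdisk (al j)%:C (delta j) z -> z <> (al j)%:C ->
     op_invertible (@star_norm R Lam H) (D z))
  (M : R) (M_gt3 : 3%:R < M)
  (j : J)
  (delta_star : R) (delta_star_bounds : 0 < delta_star < delta j)
  (n : nat) (r : 'I_n.+1 -> nat)
  (E F : R[i] -> H1per Lam H -> H1per Lam H)
  (Pran : H1per Lam H -> H1per Lam H)
  (Pker : 'I_n.+1 -> H1per Lam H -> H1per Lam H)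
  (factorization : local_factorization (@star_norm R Lam H) D (al j)%:C
     delta_star r E F Pran Pker)
  (p : nat) (p_gt0 : (0 < p)%N)
  (S : 'I_p -> R[i] -> H1per Lam H -> H1per Lam H)
  (S_hol : forall i, holomorphic_on (@star_norm R Lam H)
     (cdisk (al j)%:C (delta_PML delta M)) (S i)) :
  let dPML := delta_PML delta M in
  let m := (\sum_(i < n.+1) r i)%N in
  let C1 := 2%:R^-1 * m%:R * dPML in
  let C2 := 2%:R ^+ (r ord0 + 2) * C_PML (@star_norm R Lam H) D al delta M in
  normc ((2%:R * (@pi R)%:C * (0 +i* 1))^-1 *
     op_trace (circle_integral (@star_norm R Lam H)
       (Hprod (@star_norm R Lam H) D S) (al j)%:C dPML))
  <= C1 * C2 ^+ p *
     \prod_(i < p) max_circle (@star_norm R Lam H) (S i) (al j)%:C dPML.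
Proof.
cbv zeta; set dPML := delta_PML delta M.
have HH : 0 < H by exact: lt_trans h0_lt_H.
have dle i : inf (range delta) <= delta i.
  by apply: ge_inf; [exists 0 => _ [l _ <-]; rewrite ltW//; case/andP: (delta_bounds l)|exists i].
have d0 : 0 < inf (range delta).
  (* The infimum over the finite, inhabited index set is attained, hence positive. *)
  have [i _ di] : exists2 i, true & delta i <= inf (range delta).
    case: (@arg_minP _ _ J j xpredT delta isT) => i _ imin; exists i => //.
    by apply: lb_le_inf; [exists (delta i); exists i|move=> _ [l _ <-]; exact: imin].
  by apply: lt_le_trans di; case/andP: (delta_bounds i).
have M0 : 0 < M by apply: lt_trans M_gt3.
have rho : 0 < dPML < delta j.
  rewrite divr_gt0//= ltr_pdivrMr//; apply: le_lt_trans (dle j) _.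
  by rewrite ltr_pMr; [move: M_gt3; lra|case/andP: (delta_bounds j)].
have Cmax : max_circle (@star_norm R Lam H) (fun z => op_inv (@star_norm R Lam H) (D z)) (al j)%:C dPML
    <= C_PML (@star_norm R Lam H) D al delta M.
  apply: ub_le_sup; last by exists j.
  (* A finite family is bounded above by the sum of its absolute values, so the [sup] in [C_PML]
     dominates the term of index [j]. *)
  pose c i := max_circle (@star_norm R Lam H) (fun z => op_inv (@star_norm R Lam H) (D z)) (al i)%:C dPML.
  exists (\sum_i `|c i|) => _ [i _ <-]; rewrite (bigD1 i)//=.
  by apply: le_trans (ler_norm _) _; rewrite lerDl sumr_ge0.
have := @operator_trace_bound R _ _ _ (star_inner_product_norm HH star_equiv) D (al j)%:C (delta j) dPML
  rho (delta_hol j) (@delta_inv j) delta_star n r E F Pran Pker delta_star_bounds factorization p S _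
  p_gt0 S_hol Cmax.
by [].
Qed.
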